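(* Let $M$ be a smooth manifold of dimension $n\geq 3$, let $g$ be a pseudo-Riemannian metric on $M$, and let $\nabla$ be a Weyl connection for $g$, that is, a torsion-free linear connection on $TM$ with $\nabla g=\beta\otimes g$ for some $\beta\in\Omega^1(M)$. Let $\nu:T^*M\to M$ be the cotangent bundle, $\tau\in\Omega^1(T^*M)$ the tautological one-form, $h_0$ the Patterson--Walker metric of $\nabla$ on $T^*M$, $\boldsymbol{\mathsf{P}}^c$ the conformal Schouten tensor of $\nabla$, and let $|\cdot|^2_{g^\#}$ be the smooth function on $T^*M$ defined by the inverse metric $g^\#$ of $g$, i.e. $\alpha\mapsto g^\#(\alpha,\alpha)$. Then $$h_0-\nu^*(\operatorname{Sym}\boldsymbol{\mathsf{P}}^c)-\tau\otimes\tau+\tfrac12|\cdot|^2_{g^\#}\,\nu^*g$$ is an Einstein metric on $T^*M$, which together with $\Omega=-\mathrm{d}\tau+\nu^*(\operatorname{Alt}\boldsymbol{\mathsf{P}}^c)$ defines an almost para-Kähler structure on $T^*M$. Moreover, different Weyl connections for $g$ lead to isometric metrics on $T^*M$.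
   Context: All manifolds and maps are $C^\infty$. Conventions: for a $\binom{0}{2}$-tensor $b$, $\operatorname{Sym} b(X,Y)=\frac12(b(X,Y)+b(Y,X))$ and $\operatorname{Alt} b(X,Y)=\frac12(b(X,Y)-b(Y,X))$. For one-forms, $\alpha\odot\beta=\operatorname{Sym}(\alpha\otimes\beta)$ and $\alpha\wedge\beta=\operatorname{Alt}(\alpha\otimes\beta)$, so that, viewed as a bilinear form, $\mathrm{d}\tau(X,Y)=\frac12\big(X\tau(Y)-Y\tau(X)-\tau([X,Y])\big)$. Tautological form: $\tau_\alpha(v)=\alpha(\nu'_\alpha(v))$ for $\alpha\in T^*M$, $v\in T_\alpha T^*M$, where $\nu'_\alpha$ is the derivative of $\nu$ at $\alpha$. Patterson--Walker metric: in canonical coordinates $(x^i,\xi_i)$ on $T^*M$ induced by local coordinates $(x^i)$ on $M$, with $\Gamma^k_{ij}$ the Christoffel symbols of $\nabla$, $h_0=(\mathrm{d}\xi_i-\Gamma^k_{ij}\xi_k\,\mathrm{d}x^j)\odot \mathrm{d}x^i$ (summation convention). This is globally well defined and has signature $(n,n)$. Curvature: $R^\nabla(X,Y)(Z)=\nabla_X\nabla_YZ-\nabla_Y\nabla_XZ-\nabla_{[X,Y]}Z$ and $\mathrm{Ric}(\nabla)(X,Y)=\operatorname{tr}\big(Z\mapsto R^\nabla(Z,X)(Y)\big)$. The conformal Schouten tensor $\boldsymbol{\mathsf{P}}^c$ of $\nabla$ is the unique $\binom02$-tensor field satisfying $$\mathrm{Ric}(\nabla)(Y,Z)=(n-1)\boldsymbol{\mathsf{P}}^c(Y,Z)-\boldsymbol{\mathsf{P}}^c(Z,Y)+g(Y,Z)\operatorname{tr}_{g^\#}(\boldsymbol{\mathsf{P}}^c),$$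 equivalently $$\boldsymbol{\mathsf{P}}^c=\tfrac1{n-2}\operatorname{Sym}_0\mathrm{Ric}(\nabla)+\tfrac1n\operatorname{Alt}\mathrm{Ric}(\nabla)+\tfrac{1}{2n(n-1)}\,g\,\operatorname{tr}_{g^\#}(\mathrm{Ric}(\nabla)),$$ where $\operatorname{Sym}_0$ denotes the $g$-trace-free part of the symmetrization. An almost para-Kähler structure on a $2n$-manifold $N$ consists of a pseudo-Riemannian metric $h$ of signature $(n,n)$ and a symplectic form $\Omega$ such that the endomorphism $I:TN\to TN$ defined by $\Omega=h(\cdot,I\cdot)$ satisfies $I^2=\mathrm{Id}_{TN}$. A pseudo-Riemannian metric $h$ is Einstein if $\mathrm{Ric}(h)=\lambda h$ for a constant $\lambda$. *)

(* Defs.v *)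
From HB Require Import structures.
From mathcomp Require Import all_boot all_order all_algebra.
From mathcomp Require Import all_classical all_reals all_analysis.
From mathcomp Require Import ring.

Set Implicit Arguments.
Unset Strict Implicit.
Unset Printing Implicit Defensive.

Import Order.TTheory GRing.Theory Num.Theory.
Import numFieldNormedType.Exports.

Local Open Scope classical_set_scope.
Local Open Scope ring_scope.

(* Points, vectors and covectors of R^n are row vectors.  A bilinear form b is
   the matrix with entries b (e_k) (e_l).  The library's Jacobian matrix has
   entries ('J F x) k l = d F_l / d x_k, so that b pulls back along F to
   'J F x *m b *m ('J F x)^T and a covector a to a *m ('J F x)^T. *)

Section Calculus.
Variable R : realType.

Definition partial n (k : 'I_n) (f : 'rV[R]_n -> R) (x : 'rV[R]_n) : R :=
  'D_(delta_mx 0 k) f x.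

Definition iter_partial n (s : seq 'I_n) (f : 'rV[R]_n -> R) : 'rV[R]_n -> R :=
  foldr (@partial n) f s.

(* C^infty on A, for A open. *)
Definition smooth_on n (A : set 'rV[R]_n) (f : 'rV[R]_n -> R) : Prop :=
  forall (s : seq 'I_n) x, A x -> differentiable (iter_partial s f) x.

Definition smooth_map_on m n (A : set 'rV[R]_m) (F : 'rV[R]_m -> 'rV[R]_n) :
    Prop :=
  forall k : 'I_n, smooth_on A (fun x => F x 0 k).

Definition bilin n (b : 'M[R]_n) (v w : 'rV[R]_n) : R := (v *m b *m w^T) 0 0.

Definition sym_mx n (b : 'M[R]_n) : 'M[R]_n := 2^-1 *: (b + b^T).
Definition alt_mx n (b : 'M[R]_n) : 'M[R]_n := 2^-1 *: (b - b^T).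

Definition tensor_mx n (a c : 'rV[R]_n) : 'M[R]_n := a^T *m c.

Definition metric_trace n (g b : 'M[R]_n) : R :=
  \sum_k \sum_l invmx g k l * b k l.

Definition sym0_mx n (g b : 'M[R]_n) : 'M[R]_n :=
  sym_mx b - (n%:R^-1 * metric_trace g b) *: g.

(* The conformal Schouten tensor for the Ricci tensor r; [schouten_mxP] is its
   defining equation. *)
Definition schouten_mx n (g r : 'M[R]_n) : 'M[R]_n :=
  (n%:R - 2)^-1 *: sym0_mx g r + n%:R^-1 *: alt_mx r
  + ((2 * n%:R * (n%:R - 1))^-1 * metric_trace g r) *: g.

Lemma metric_traceE n (g b : 'M[R]_n) :
  metric_trace g b = \tr (invmx g *m b^T).
Proof.
by apply: eq_bigr => k _; rewrite mxE; apply: eq_bigr => l _; rewrite mxE.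
Qed.

Lemma metric_trace_tr n (g b : 'M[R]_n) : g^T = g ->
  metric_trace g b^T = metric_trace g b.
Proof.
move=> gs; rewrite !metric_traceE trmxK -mxtrace_tr trmx_mul trmx_inv gs.
by rewrite mxtrace_mulC.
Qed.

Lemma schouten_mxP n (g r P : 'M[R]_n) : (3 <= n)%N -> g^T = g ->
  g \in unitmx ->
  r = (n%:R - 1) *: P - P^T + metric_trace g P *: g <-> P = schouten_mx g r.
Proof.
move=> n3 gs gu.
have n0 : n%:R != 0 :> R by rewrite pnatr_eq0 -lt0n (leq_trans _ n3).
have n1 : n%:R - 1 != 0 :> R.
  by rewrite subr_eq0 (eqr_nat R n 1) gtn_eqF // (leq_trans _ n3).
have n2 : n%:R - 2 != 0 :> R by rewrite subr_eq0 (eqr_nat R n 2) gtn_eqF.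
have trg : metric_trace g g = n%:R by rewrite metric_traceE gs mulVmx // mxtrace1.
have trD b c : metric_trace g (b + c) = metric_trace g b + metric_trace g c.
  by rewrite !metric_traceE linearD mulmxDr mxtraceD.
have trZ a b : metric_trace g (a *: b) = a * metric_trace g b.
  by rewrite !metric_traceE linearZ /= -scalemxAr mxtraceZ.
have trN b : metric_trace g (- b) = - metric_trace g b.
  by rewrite -scaleN1r trZ mulN1r.
have gkl k l : g l k = g k l by rewrite -{1}gs mxE.
split=> [rE|PE].
- have tr_r : metric_trace g r = 2 * (n%:R - 1) * metric_trace g P.
    by rewrite rE !trD trN !trZ trg metric_trace_tr //; ring.
  apply/matrixP => k l; rewrite /schouten_mx /sym0_mx /sym_mx /alt_mx tr_r.
  by rewrite !rE !mxE (gkl k l); field; rewrite n0 n1 n2.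
- have tr_P : metric_trace g P = (2 * (n%:R - 1))^-1 * metric_trace g r.
    rewrite PE /schouten_mx /sym0_mx /sym_mx /alt_mx.
    rewrite !(trD, trN, trZ) !metric_trace_tr // trg.
    by field; rewrite n0 n1 n2.
  apply/matrixP => k l; rewrite tr_P {}PE /schouten_mx /sym0_mx /sym_mx /alt_mx.
  by rewrite !mxE (gkl k l); field; rewrite n0 n1 n2.
Qed.

Definition has_signature p q (b : 'M[R]_(p + q)) : Prop :=
  exists2 P : 'M[R]_(p + q), P \in unitmx &
    P *m b *m P^T = block_mx 1%:M 0 0 (- 1%:M).

(* Vector fields and connections on open subsets of R^n; the Christoffel
   symbol Gamma^k_{ab} at x is G k x a b. *)

Definition frame n (k : 'I_n) : 'rV[R]_n -> 'rV[R]_n := fun=> delta_mx 0 k.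

Definition lie_bracket n (X Y : 'rV[R]_n -> 'rV[R]_n) : 'rV[R]_n -> 'rV[R]_n :=
  fun x => \row_k \sum_a (X x 0 a * partial a (fun y => Y y 0 k) x
                        - Y x 0 a * partial a (fun y => X y 0 k) x).

Definition nabla n (G : 'I_n -> 'rV[R]_n -> 'M[R]_n)
    (X Y : 'rV[R]_n -> 'rV[R]_n) : 'rV[R]_n -> 'rV[R]_n :=
  fun x => \row_k (\sum_a X x 0 a * partial a (fun y => Y y 0 k) x
                 + \sum_a \sum_b G k x a b * X x 0 a * Y x 0 b).

Definition torsion n (G : 'I_n -> 'rV[R]_n -> 'M[R]_n)
    (X Y : 'rV[R]_n -> 'rV[R]_n) : 'rV[R]_n -> 'rV[R]_n :=
  fun x => nabla G X Y x - nabla G Y X x - lie_bracket X Y x.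

Definition curvature n (G : 'I_n -> 'rV[R]_n -> 'M[R]_n)
    (X Y Z : 'rV[R]_n -> 'rV[R]_n) : 'rV[R]_n -> 'rV[R]_n :=
  fun x => nabla G X (nabla G Y Z) x - nabla G Y (nabla G X Z) x
         - nabla G (lie_bracket X Y) Z x.

Definition ricci n (G : 'I_n -> 'rV[R]_n -> 'M[R]_n) (x : 'rV[R]_n) :
    'M[R]_n :=
  \matrix_(a, b) \sum_c curvature G (frame c) (frame a) (frame b) x 0 c.

(* (nabla_X b)(Y, Z) *)
Definition nabla_form n (G : 'I_n -> 'rV[R]_n -> 'M[R]_n)
    (b : 'rV[R]_n -> 'M[R]_n) (X Y Z : 'rV[R]_n -> 'rV[R]_n)
    (x : 'rV[R]_n) : R :=
  \sum_a X x 0 a * partial a (fun y => bilin (b y) (Y y) (Z y)) x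
  - bilin (b x) (nabla G X Y x) (Z x) - bilin (b x) (Y x) (nabla G X Z x).

Definition levi_civita n (h : 'rV[R]_n -> 'M[R]_n) :
    'I_n -> 'rV[R]_n -> 'M[R]_n :=
  fun k x => \matrix_(a, b) (2^-1 * \sum_c invmx (h x) k c *
    (partial a (fun y => h y b c) x + partial b (fun y => h y a c) x
     - partial c (fun y => h y a b) x)).

End Calculus.

(* A set with charts [coord i], defined on [dom i], with inverse [param i];
   [chart_at p] is a preferred chart around p.  The axioms of a smooth
   manifold are in [is_manifold]. *)
Record atlas (R : realType) (n : nat) := Atlas {
  pt : Type;
  idx : Type;
  dom : idx -> set pt;
  coord : idx -> pt -> 'rV[R]_n;
  param : idx -> 'rV[R]_n -> pt;
  chart_at : pt -> idx }.

Arguments dom {R n} a i.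
Arguments coord {R n} a i p.
Arguments param {R n} a i x.
Arguments chart_at {R n} a p.

Section Manifold.
Variables (R : realType) (n : nat) (M : atlas R n).

Definition image_of (i : idx M) (A : set (pt M)) : set 'rV[R]_n :=
  coord M i @` (dom M i `&` A).

Definition chart_image (i : idx M) : set 'rV[R]_n := image_of i setT.

Definition overlap (i j : idx M) : set 'rV[R]_n := image_of i (dom M j).

Definition transition (i j : idx M) : 'rV[R]_n -> 'rV[R]_n :=
  coord M j \o param M i.

(* The topology induced by the atlas. *)
Definition mopen (U : set (pt M)) : Prop := forall i, open (image_of i U).

Record is_manifold : Prop := IsManifold {
  chart_atP : forall p, dom M (chart_at M p) p;
  coordK : forall i p, dom M i p -> param M i (coord M i p) = p;
  overlap_open : forall i j, open (overlap i j);
  transition_smooth : forall i j, smooth_map_on (overlap i j) (transition i j);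
  manifold_hausdorff : forall p q : pt M, p <> q ->
    exists U V, [/\ mopen U, mopen V, U p, V q & U `&` V = set0];
  manifold_second_countable : exists B : nat -> set (pt M),
    (forall m, mopen (B m)) /\
    (forall U p, mopen U -> U p -> exists m, B m p /\ B m `<=` U) }.

(* Tensor fields are families of component functions, one for each chart,
   which are only meaningful on the image of the chart. *)

Definition oneform := idx M -> 'rV[R]_n -> 'rV[R]_n.

Definition is_oneform (a : oneform) : Prop :=
  (forall i, smooth_map_on (chart_image i) (a i)) /\
  (forall i j x, overlap i j x ->
     a i x = a j (transition i j x) *m ('J (transition i j) x)^T).

Definition tensor2 := idx M -> 'rV[R]_n -> 'M[R]_n.

Definition is_tensor2 (b : tensor2) : Prop :=
  (forall i k l, smooth_on (chart_image i) (fun x => b i x k l)) /\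
  (forall i j x, overlap i j x ->
     b i x = 'J (transition i j) x *m b j (transition i j x)
             *m ('J (transition i j) x)^T).

(* A linear connection on the tangent bundle, given by its Christoffel symbols
   in the charts. *)
Definition connection := idx M -> 'I_n -> 'rV[R]_n -> 'M[R]_n.

Definition is_connection (D : connection) : Prop :=
  (forall i k a b, smooth_on (chart_image i) (fun x => D i k x a b)) /\
  (forall i j x, overlap i j x -> forall k a b,
     \sum_c D i c x a b * 'J (transition i j) x c k =
     partial a (partial b (fun y => transition i j y 0 k)) x
     + \sum_c \sum_d 'J (transition i j) x a c * 'J (transition i j) x b d *
         D j k (transition i j x) c d).

Definition torsion_free (D : connection) : Prop :=
  forall i x, chart_image i x -> forall a b,
    torsion (D i) (frame a) (frame b) x = 0.

Definition is_metric (h : tensor2) : Prop :=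
  is_tensor2 h /\
  (forall i x, chart_image i x -> (h i x)^T = h i x /\ h i x \in unitmx).

Definition weyl_connection (g : tensor2) (D : connection) : Prop :=
  [/\ is_connection D, torsion_free D &
      exists2 beta : oneform, is_oneform beta &
        forall i x, chart_image i x -> forall a b c,
          nabla_form (D i) (g i) (frame a) (frame b) (frame c) x =
          beta i x 0 a * g i x b c].

Definition Ric (D : connection) : tensor2 := fun i => ricci (D i).

Definition LeviCivita (h : tensor2) : connection := fun i => levi_civita (h i).

Definition einstein_metric (h : tensor2) : Prop :=
  is_metric h /\
  exists lambda : R, forall i x, chart_image i x ->
    Ric (LeviCivita h) i x = lambda *: h i x.

Definition Sym (b : tensor2) : tensor2 := fun i x => sym_mx (b i x).
Definition Alt (b : tensor2) : tensor2 := fun i x => alt_mx (b i x).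

Definition schouten (g : tensor2) (D : connection) : tensor2 :=
  fun i x => schouten_mx (g i x) (Ric D i x).

(* The factor 1/2 comes from the convention that the wedge product of two
   one-forms is Alt of their tensor product. *)
Definition ext_d (a : oneform) : tensor2 := fun i x =>
  \matrix_(k, l) (2^-1 * (partial k (fun y => a i y 0 l) x
                        - partial l (fun y => a i y 0 k) x)).

Definition closed_2form (w : tensor2) : Prop :=
  forall i x, chart_image i x -> forall a b c,
    partial a (fun y => w i y b c) x + partial b (fun y => w i y c a) x
    + partial c (fun y => w i y a b) x = 0.

Definition symplectic (w : tensor2) : Prop :=
  [/\ is_tensor2 w,
      forall i x, chart_image i x -> (w i x)^T = - w i x /\ w i x \in unitmx &
      closed_2form w].

End Manifold.

Arguments oneform {R n} M.
Arguments tensor2 {R n} M.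
Arguments connection {R n} M.

Section Maps.
Variables (R : realType) (m n : nat) (N : atlas R m) (M : atlas R n).
Implicit Type f : pt N -> pt M.

Definition local_map f (i : idx N) (j : idx M) : 'rV[R]_m -> 'rV[R]_n :=
  coord M j \o f \o param N i.

Definition smooth_map f : Prop :=
  (forall U, mopen U -> mopen (f @^-1` U)) /\
  (forall i j, smooth_map_on (image_of i (f @^-1` dom M j)) (local_map f i j)).

Definition pullback f (b : tensor2 M) : tensor2 N := fun i x =>
  let F := local_map f i (chart_at M (f (param N i x))) in
  'J F x *m b (chart_at M (f (param N i x))) (F x) *m ('J F x)^T.

End Maps.

Definition isometric (R : realType) n (N : atlas R n) (h h' : tensor2 N) :
    Prop :=
  exists f f' : pt N -> pt N,
    [/\ smooth_map f, smooth_map f', cancel f f', cancel f' f &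
        forall i x, chart_image i x -> pullback f h' i x = h i x].

(* In row-vector notation, w = h (., I .) reads w = h *m I, where column b of I
   holds the components of I (e_b). *)
Definition almost_para_kahler (R : realType) n (N : atlas R (n + n))
    (h w : tensor2 N) : Prop :=
  [/\ is_metric h,
      forall i x, chart_image i x -> has_signature (h i x),
      symplectic w &
      forall i x, chart_image i x ->
        exists2 I : 'M[R]_(n + n), w i x = h i x *m I & I *m I = 1%:M].

Section Cotangent.
Variables (R : realType) (n : nat) (M : atlas R n).

(* A covector at p is represented by its components in the preferred chart
   at p; [covector_coord i] gives its components in the chart i. *)
Definition covector_coord (i : idx M) (al : pt M * 'rV[R]_n) : 'rV[R]_n :=
  al.2 *m ('J (transition i (chart_at M al.1)) (coord M i al.1))^T.

(* T^*M with the canonical coordinates (x, xi) = [row_mx x xi]. *)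
Definition cotangent : atlas R (n + n) := {|
  pt := (pt M * 'rV[R]_n)%type;
  idx := idx M;
  dom := fun i => [set al | dom M i al.1];
  coord := fun i al => row_mx (coord M i al.1) (covector_coord i al);
  param := fun i z =>
    let p := param M i (lsubmx z) in
    (p, rsubmx z *m ('J (transition (chart_at M p) i)
                       (coord M (chart_at M p) p))^T);
  chart_at := fun al => chart_at M al.1 |}.

Definition cotangent_proj : pt cotangent -> pt M := fst.

(* tau_al (v) = al (nu'_al (v)) *)
Definition tautological : oneform cotangent := fun i z =>
  let al := param cotangent i z in
  let j := chart_at M (cotangent_proj al) in
  covector_coord j al *m ('J (local_map cotangent_proj i j) z)^T.

Definition dx (a : 'I_n) : 'rV[R]_(n + n) := delta_mx 0 (lshift n a).
Definition dxi (a : 'I_n) : 'rV[R]_(n + n) := delta_mx 0 (rshift n a).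

Definition patterson_walker (D : connection M) : tensor2 cotangent :=
  fun i z => \sum_a sym_mx (tensor_mx
    (dxi a - \sum_b (\sum_k D i k (lsubmx z) a b * rsubmx z 0 k) *: dx b)
    (dx a)).

(* al |-> g^# (al, al) *)
Definition covector_sqnorm (g : tensor2 M) (al : pt cotangent) : R :=
  let j := chart_at M (cotangent_proj al) in
  let xi := covector_coord j al in
  bilin (invmx (g j (coord M j (cotangent_proj al)))) xi xi.

Definition weyl_metric (g : tensor2 M) (D : connection M) :
    tensor2 cotangent := fun i z =>
  patterson_walker D i z
  - pullback cotangent_proj (Sym (schouten g D)) i z
  - tensor_mx (tautological i z) (tautological i z)
  + (2^-1 * covector_sqnorm g (param cotangent i z))
      *: pullback cotangent_proj g i z.

Definition weyl_symplectic (g : tensor2 M) (D : connection M) :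
    tensor2 cotangent := fun i z =>
  - ext_d tautological i z
  + pullback cotangent_proj (Alt (schouten g D)) i z.

End Cotangent.

(* Main.v *)
(* In canonical coordinates (x, xi) of T^*M the metric is the block matrix
   h = [[A, 1/2], [1/2, 0]] with
     A_ab = - Gamma^k_ab xi_k - (Sym P)_ab - xi_a xi_b + 1/2 |xi|^2 g_ab,
   and Omega = [[Alt P, 1/2], [- 1/2, 0]].  For such blocks the involution I, the
   signature and the compatibility of h and Omega are matrix identities, and
   d Omega = 0 because Alt P is a multiple of the exterior derivative of
   Gamma^c_ca.

   Everything else rests on one formula.  If the Christoffel symbols of a Weyl
   connection are changed to
     Gamma^c_ab + delta^c_a Y_b + delta^c_b Y_a - g_ab Y^c,
   then Sym P changes by
     T_ab = - Sym(dY)_ab + Gamma^k_ab Y_k + Y_a Y_b - 1/2 |Y|^2 g_ab.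
   - Any two Weyl connections differ in this way, and then the fibre translation
     alpha |-> alpha - Y of T^*M carries one metric to the other.
   - The vector - dA_ab/dxi_c is the symbol above for the constant form Y = xi,
     and A = - (Sym P + T).  The horizontal block of Ric(h) is
     2 SRic(- dA/dxi) + 2 A_cd d^2 A_ab / dxi_c dxi_d, where SRic is the symmetric
     Ricci tensor computed with xi held fixed; by the formula it equals - 2 n A.
     The mixed block is the trace d^2 A_ac / dxi_c dxi_b = - n delta^b_a, so that
     Ric(h) = - 2 n h. *)
Require Import Defs.
From mathcomp Require Import all_boot all_order all_algebra.
From mathcomp Require Import all_classical all_reals all_analysis.
From mathcomp Require Import ring lra.

Set Implicit Arguments.
Unset Strict Implicit.
Unset Printing Implicit Defensive.

Import Order.TTheory GRing.Theory Num.Theory.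
Import numFieldNormedType.Exports.
Import Defs.

Local Open Scope classical_set_scope.
Local Open Scope ring_scope.

(** * Partial derivatives and smooth functions *)

(** The change formula has to serve two kinds of [Y]: a genuine one-form on M, whose derivatives
    enter, and the fibre coordinate xi held fixed, whose components do not vary with x although it
    is no one-form on M. It is therefore proved as an identity between numbers at one point: the
    values of the Christoffel symbols, of the metric, of [Y] and of its dual vector, and their first
    derivatives, are free variables tied only by nabla g = beta (x) g and by the duality of [Y] and
    the vector. For a frozen xi the derivative of [Y] is 0, but that of the dual vector is not.

    Sym P is reached only through the Ricci tensor, whose symmetric part is (n-2) Sym P + tr(Sym P)
    g. For n >= 3 the operator X |-> (n-2) X + tr(X) g is injective, so a change of the Ricci tensor
    of the form (n-2) T + tr(T) g means that Sym P changes by T.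

    The block A is not a tensor: a change of coordinates adds a Hessian term, produced by the
    Christoffel symbols. It has to cancel against the off-diagonal block of the Jacobian matrix of
    the canonical coordinates before h is a metric on the cotangent bundle at all. *)

Lemma fun_big_nil (T U I : Type) (op : U -> U -> U) (e : U) (P : pred I)
    (F : I -> T -> U) :
  (fun y => \big[op/e]_(i <- [::] | P i) F i y) = fun=> e.
Proof. by apply/funext => y; rewrite big_nil. Qed.

Lemma fun_big_cons (T U I : Type) (op : U -> U -> U) (e : U) (P : pred I)
    (F : I -> T -> U) (i : I) (r : seq I) :
  (fun y => \big[op/e]_(j <- i :: r | P j) F j y) =
  if P i then fun y => op (F i y) (\big[op/e]_(j <- r | P j) F j y)
  else fun y => \big[op/e]_(j <- r | P j) F j y.
Proof. by case: ifP => Pi; apply/funext => y; rewrite big_cons Pi. Qed.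

Section Partial.
Variables (R : realType) (n : nat).
Implicit Types (f g : 'rV[R]_n -> R) (x : 'rV[R]_n) (k : 'I_n).
Implicit Types (A : set 'rV[R]_n).

Lemma eq_partial A f g k x : open A -> A x -> (forall y, A y -> f y = g y) ->
  partial k f x = partial k g x.
Proof.
move=> Ao Ax fg; apply: near_eq_derive.
by apply: filterS (open_nbhs_nbhs (conj Ao Ax)) => y /fg.
Qed.

Lemma eq_differentiable A f g x : open A -> A x ->
  (forall y, A y -> f y = g y) -> differentiable f x -> differentiable g x.
Proof.
move=> Ao Ax fg /diff_locallyP [fc fd].
have nA : nbhs (0 : 'rV[R]_n) [set h | A (h + x)].
  have := open_nbhs_nbhs (conj Ao Ax).
  by rewrite -[nbhs x A]/(\near x, A x) (near_shift 0) subr0.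
(* The first-order expansion of [f] is also one of [g], with the same linear part; uniqueness of the
   differential then gives ['d g x]. *)
have gd : g \o shift x = cst (g x) + 'd f x +o_ (0 : 'rV[R]_n) id.
  apply/eqaddoP => e e0.
  move/eqaddoP: fd => /(_ e e0); apply: filterS2 nA => h /= Ah.
  by rewrite !fctE /= -!fg.
have dg := diff_unique fc gd.
by apply/diff_locallyP; rewrite dg.
Qed.

Lemma partialE k f x : differentiable f x ->
  partial k f x = 'd f x (delta_mx 0 k).
Proof. exact: deriveE. Qed.

Lemma partial_cst k (c : R) x : partial k (fun=> c) x = 0.
Proof. exact: derive_cst. Qed.

Lemma partialD k f g x : differentiable f x -> differentiable g x ->
  partial k (fun y => f y + g y) x = partial k f x + partial k g x.
Proof. by move=> df dg; apply: deriveD; exact: diff_derivable. Qed.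

Lemma partialN k f x : differentiable f x ->
  partial k (fun y => - f y) x = - partial k f x.
Proof. by move=> df; apply: deriveN; exact: diff_derivable. Qed.

Lemma partialB k f g x : differentiable f x -> differentiable g x ->
  partial k (fun y => f y - g y) x = partial k f x - partial k g x.
Proof. by move=> df dg; apply: deriveB; exact: diff_derivable. Qed.

Lemma partialM k f g x : differentiable f x -> differentiable g x ->
  partial k (fun y => f y * g y) x = partial k f x * g x + f x * partial k g x.
Proof.
move=> df dg; rewrite addrC [partial k f x * _]mulrC.
by apply: deriveM; exact: diff_derivable.
Qed.

Lemma partialZ k (c : R) f x : differentiable f x ->
  partial k (fun y => c * f y) x = c * partial k f x.
Proof. by move=> df; apply: deriveZ; exact: diff_derivable. Qed.

Lemma partialV k f x : f x != 0 -> differentiable f x ->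
  partial k (fun y => (f y)^-1) x = - (partial k f x * (f x)^-1 * (f x)^-1).
Proof.
move=> f0 df; rewrite /partial deriveV //; last exact: diff_derivable.
by rewrite /GRing.scale /= expr2 invfM mulNr mulrC mulrA.
Qed.

Lemma differentiable_bigsum (I : eqType) (r : seq I) (P : pred I)
    (F : I -> 'rV[R]_n -> R) x :
  (forall i, P i -> differentiable (F i) x) ->
  differentiable (fun y => \sum_(i <- r | P i) F i y) x.
Proof.
move=> dF; elim: r => [|i r IH].
  by rewrite fun_big_nil; exact: differentiable_cst.
rewrite fun_big_cons.
by case: ifP => Pi //; apply: differentiableD => //; exact: dF.
Qed.

Lemma partial_sum (I : eqType) (r : seq I) (P : pred I)
    (F : I -> 'rV[R]_n -> R) k x :
  (forall i, P i -> differentiable (F i) x) ->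
  partial k (fun y => \sum_(i <- r | P i) F i y) x =
  \sum_(i <- r | P i) partial k (F i) x.
Proof.
move=> dF; elim: r => [|i r IH].
  by rewrite fun_big_nil big_nil partial_cst.
rewrite fun_big_cons.
rewrite big_cons; case: ifP => Pi //.
by rewrite partialD ?IH //; [exact: dF|exact: differentiable_bigsum].
Qed.

Lemma partial_coord k l x : partial k (fun y : 'rV[R]_n => y 0 l) x = (k == l)%:R.
Proof.
rewrite partialE; last exact: differentiable_coord.
(* The coordinate function is packed as a linear map, whose differential is itself. *)
have @F : {linear 'rV[R]_n -> R}.
  by exists (fun N : 'rV[R]_n => N 0 l); do 2![eexists]; do ?[constructor];
     rewrite ?mxE// => ? *; rewrite ?mxE//; move=> ?; rewrite !mxE.
rewrite (_ : (fun _ => _) = F) // diff_lin //; last exact: coord_continuous.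
by rewrite /= mxE eqxx eq_sym.
Qed.

End Partial.

Section Smooth.
Variables (R : realType) (n : nat).
Implicit Types (f g : 'rV[R]_n -> R) (x : 'rV[R]_n) (k : 'I_n).
Implicit Types (A : set 'rV[R]_n).

Lemma iter_partial_rcons s k f :
  iter_partial (rcons s k) f = iter_partial s (partial k f).
Proof. exact: foldr_rcons. Qed.

Lemma smooth_on_diff A f x : smooth_on A f -> A x -> differentiable f x.
Proof. by move=> fA Ax; exact: (fA [::]). Qed.

Lemma smooth_on_partial A f k : smooth_on A f -> smooth_on A (partial k f).
Proof. by move=> fA s x Ax; rewrite -iter_partial_rcons; exact: fA. Qed.

Lemma smooth_on_sub A (B : set 'rV[R]_n) f :
  B `<=` A -> smooth_on A f -> smooth_on B f.
Proof. by move=> BA fA s x /BA; exact: fA. Qed.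

Lemma eq_smooth_on A f g : open A -> (forall y, A y -> f y = g y) ->
  smooth_on A f -> smooth_on A g.
Proof.
move=> Ao fg fA s x Ax.
suff e : forall y, A y -> iter_partial s f y = iter_partial s g y.
  by apply: (eq_differentiable Ao Ax e); exact: fA.
elim: s {x Ax} => [|k s IH] y Ay /=; first exact: fg.
exact: eq_partial Ao Ay IH.
Qed.

(* Differentiability up to order [m.+1], by recursion on the order: the form
   in which the product and quotient rules can be iterated. *)
Fixpoint diff_upto A m f : Prop :=
  (forall x, A x -> differentiable f x) /\
  if m is m'.+1 then forall k, diff_upto A m' (partial k f) else True.

(** In [iter_partial] the head of the list is the derivative taken last, whereas [diff_upto] peels
    off the one taken first; hence the induction from the right end of the list. *)
Lemma smooth_onP A f : smooth_on A f <-> forall m, diff_upto A m f.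
Proof.
split=> [fA m|fA s].
  elim: m f fA => [|m IH] f fA; split=> //;
    try by move=> x; exact: smooth_on_diff.
  by move=> k; apply: IH; exact: smooth_on_partial.
have {fA} := fA (size s); elim/last_ind: s f => [|s k IH] f; first by case.
rewrite iter_partial_rcons size_rcons => -[_ fA].
by apply: IH; exact: fA.
Qed.

Lemma diff_uptoW A m f : diff_upto A m.+1 f -> diff_upto A m f.
Proof.
elim: m f => [|m IH] f [fA dfA]; split=> // k.
by apply: IH; exact: dfA.
Qed.

Lemma eq_diff_upto A m f g : open A -> (forall y, A y -> f y = g y) ->
  diff_upto A m f -> diff_upto A m g.
Proof.
move=> Ao; elim: m f g => [|m IH] f g fg [fA dfA]; split=> //;
  try by move=> x Ax; exact: (eq_differentiable Ao Ax fg (fA x Ax)).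
move=> k; apply: (IH (partial k f)); last exact: dfA.
by move=> y Ay; exact: eq_partial Ao Ay fg.
Qed.

Lemma diff_upto_cst A m (c : R) : diff_upto A m (fun=> c).
Proof.
elim: m c => [|m IH] c; split=> //;
  try by move=> x _; exact: differentiable_cst.
move=> k; rewrite (_ : partial k _ = fun=> 0); first exact: IH.
by apply/funext => x; exact: partial_cst.
Qed.

Lemma diff_uptoD A m f g : open A -> diff_upto A m f -> diff_upto A m g ->
  diff_upto A m (fun x => f x + g x).
Proof.
move=> Ao; elim: m f g => [|m IH] f g [fA dfA] [gA dgA]; split=> //;
  try by move=> x Ax; apply: differentiableD; [exact: fA|exact: gA].
move=> k; apply: (@eq_diff_upto A m (fun x => partial k f x + partial k g x)) => //.
  by move=> x Ax; rewrite partialD //; [exact: fA|exact: gA].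
by apply: IH; [exact: dfA|exact: dgA].
Qed.

Lemma diff_uptoM A m f g : open A -> diff_upto A m f -> diff_upto A m g ->
  diff_upto A m (fun x => f x * g x).
Proof.
move=> Ao; elim: m f g => [|m IH] f g /[dup] f1 [fA dfA] /[dup] g1 [gA dgA];
  split=> //; try by move=> x Ax; apply: differentiableM; [exact: fA|exact: gA].
move=> k; apply: (@eq_diff_upto A m
    (fun x => partial k f x * g x + f x * partial k g x)) => //.
  by move=> x Ax; rewrite partialM //; [exact: fA|exact: gA].
apply: diff_uptoD => //; apply: IH.
- exact: dfA.
- exact: diff_uptoW.
- exact: diff_uptoW.
- exact: dgA.
Qed.

Lemma diff_uptoV A m f : open A -> (forall x, A x -> f x != 0) ->
  diff_upto A m f -> diff_upto A m (fun x => (f x)^-1).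
Proof.
move=> Ao f0; elim: m => [|m IH] /[dup] f1 [fA dfA]; split=> //;
  try by move=> x Ax; apply: differentiableV; [exact: fA|exact: f0].
(* The derivative of 1/f involves 1/f itself, but only to the lower order supplied by the induction.
   The sign is written as a constant factor so that the product rule covers the whole expression. *)
move=> k; apply: (@eq_diff_upto A m
    (fun x => (-1 * (partial k f x * (f x)^-1)) * (f x)^-1)) => //.
  by move=> x Ax; rewrite partialV ?mulN1r ?mulNr //; [exact: f0|exact: fA].
have Vm := IH (diff_uptoW f1).
apply: diff_uptoM => //; apply: diff_uptoM => //; first exact: diff_upto_cst.
by apply: diff_uptoM => //; exact: dfA.
Qed.

Lemma smooth_on_cst A (c : R) : smooth_on A (fun=> c).
Proof. by apply/smooth_onP => m; exact: diff_upto_cst. Qed.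

Lemma smooth_on_coord A l : smooth_on A (fun x : 'rV[R]_n => x 0 l).
Proof.
apply/smooth_onP; case=> [|m]; split=> //;
  try by move=> x _; exact: differentiable_coord.
move=> k; rewrite (_ : partial k _ = fun=> (k == l)%:R); first exact: diff_upto_cst.
by apply/funext => x; exact: partial_coord.
Qed.

Lemma smooth_onD A f g : open A -> smooth_on A f -> smooth_on A g ->
  smooth_on A (fun x => f x + g x).
Proof.
by move=> Ao /smooth_onP fA /smooth_onP gA; apply/smooth_onP => m; exact: diff_uptoD.
Qed.

Lemma smooth_onM A f g : open A -> smooth_on A f -> smooth_on A g ->
  smooth_on A (fun x => f x * g x).
Proof.
by move=> Ao /smooth_onP fA /smooth_onP gA; apply/smooth_onP => m; exact: diff_uptoM.
Qed.

Lemma smooth_onV A f : open A -> (forall x, A x -> f x != 0) ->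
  smooth_on A f -> smooth_on A (fun x => (f x)^-1).
Proof.
by move=> Ao f0 /smooth_onP fA; apply/smooth_onP => m; exact: diff_uptoV.
Qed.

Lemma smooth_onN A f : open A -> smooth_on A f -> smooth_on A (fun x => - f x).
Proof.
move=> Ao fA; rewrite (_ : (fun x => _) = fun x => -1 * f x).
  by apply: smooth_onM => //; exact: smooth_on_cst.
by apply/funext => x; rewrite mulN1r.
Qed.

Lemma smooth_onB A f g : open A -> smooth_on A f -> smooth_on A g ->
  smooth_on A (fun x => f x - g x).
Proof. by move=> Ao fA gA; apply: smooth_onD => //; exact: smooth_onN. Qed.

Lemma smooth_on_sum A (I : Type) (r : seq I) (P : pred I)
    (F : I -> 'rV[R]_n -> R) : open A ->
  (forall i, smooth_on A (F i)) ->
  smooth_on A (fun y => \sum_(i <- r | P i) F i y).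
Proof.
move=> Ao FA; elim: r => [|i r IH].
  by rewrite fun_big_nil; exact: smooth_on_cst.
rewrite fun_big_cons.
by case: ifP => Pi //; exact: smooth_onD.
Qed.

Lemma smooth_on_prod A (I : Type) (r : seq I) (P : pred I)
    (F : I -> 'rV[R]_n -> R) : open A ->
  (forall i, smooth_on A (F i)) ->
  smooth_on A (fun y => \prod_(i <- r | P i) F i y).
Proof.
move=> Ao FA; elim: r => [|i r IH].
  by rewrite fun_big_nil; exact: smooth_on_cst.
rewrite fun_big_cons.
by case: ifP => Pi //; exact: smooth_onM.
Qed.

Lemma smooth_on_det A m (F : 'rV[R]_n -> 'M[R]_m) : open A ->
  (forall a b, smooth_on A (fun x => F x a b)) ->
  smooth_on A (fun x => \det (F x)).
Proof.
move=> Ao FA; rewrite /determinant; apply: smooth_on_sum => // s.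
by apply: smooth_onM => //; [exact: smooth_on_cst|exact: smooth_on_prod].
Qed.

(** Cramer's rule: an entry of the inverse is a cofactor divided by the determinant, at the points
    where the matrix is invertible. *)
Lemma smooth_on_invmx A m (F : 'rV[R]_n -> 'M[R]_m) a b : open A ->
  (forall x, A x -> F x \in unitmx) ->
  (forall a b, smooth_on A (fun x => F x a b)) ->
  smooth_on A (fun x => invmx (F x) a b).
Proof.
move=> Ao Fu FA.
apply: (@eq_smooth_on A (fun x => (\det (F x))^-1 * cofactor (F x) b a)) => //.
  by move=> x Ax; rewrite /invmx Fu // !mxE.
apply: smooth_onM => //.
  apply: smooth_onV => //; last exact: smooth_on_det.
  by move=> x /Fu; rewrite unitmxE unitfE.
apply: smooth_onM; rewrite /cofactor //; first exact: smooth_on_cst.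
apply: smooth_on_det => // c d; under eq_fun do rewrite !mxE; exact: FA.
Qed.

End Smooth.

(** * Symmetry of second derivatives *)

Section Schwarz.
Variables (R : realType) (n : nat).
Implicit Types (f : 'rV[R]_n -> R) (x u v : 'rV[R]_n).

Lemma is_derive_line f y u (t : R) : derivable f (t *: u + y) u ->
  is_derive t (1 : R) (fun s : R => f (s *: u + y)) ('D_u f (t *: u + y)).
Proof.
have E : (fun h : R => h^-1 *: (((fun s : R => f (s *: u + y)) \o shift t) (h *: 1)
                                - f (t *: u + y))) =
         (fun h => h^-1 *: ((f \o shift (t *: u + y)) (h *: u) - f (t *: u + y))).
  apply/funext => h /=; congr (_ *: (f _ - _)).
  by rewrite scalerDl addrA [h *: 1]mulr1.
move=> df; split; first by rewrite /derivable E.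
by rewrite /derive E.
Qed.

(* The mean value theorem along [u], then the differentiability of ['D_u f] at
   [x] only: the left-hand difference is symmetric in [u] and [v]. *)
Lemma second_difference A f x u v : open A -> A x ->
  (forall y, A y -> derivable f y u) -> differentiable ('D_u f) x ->
  forall e : R, 0 < e -> exists2 d : R, 0 < d & forall h, 0 < h < d ->
  `|f (h *: u + (h *: v + x)) - f (h *: u + x) - f (h *: v + x) + f x
    - h ^+ 2 * 'D_v ('D_u f) x| <= e * h ^+ 2.
Proof.
move=> Ao Ax dfA dphi e e0; set phi := 'D_u f.
have lin (t s : R) :
    'd phi x (t *: u + s *: v) = t * 'D_u phi x + s * 'D_v phi x.
  by rewrite !deriveE // raddfD /= !linearZ.
have /diff_locallyP [_ /eqaddoP phio] := dphi.
(* The errors at the two ends are at most [e / N * (t * |u| + h * |v|)] and [e / N * (t * |u|)] with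
   [t <= h], so they add up to at most [e * h]; the [+ 1] keeps [N] positive when [u] and [v]
   vanish. *)
pose N : R := 2 * `|u| + `|v| + 1.
have N0 : 0 < N by rewrite ltr_wpDl // addr_ge0 // mulr_ge0.
have := phio (e / N) (divr_gt0 e0 N0) => {phio} phio.
have nA : \forall k \near (0 : 'rV[R]_n), A (k + x).
  have := open_nbhs_nbhs (conj Ao Ax).
  by rewrite -[nbhs x A]/(\near x, A x) (near_shift 0) subr0.
have [r /= r0 Hr] := (nbhs_ballP _ _).1 (filterI phio nA).
exists (r / N); first exact: divr_gt0.
move=> h /andP [h0 hd].
have hN : h * N < r by rewrite -ltr_pdivlMr.
have small (t s : R) : 0 <= t <= h -> 0 <= s <= h ->
    ball (0 : 'rV[R]_n) r (t *: u + s *: v).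
  move=> /andP [t0 th] /andP [s0 sh].
  rewrite -ball_normE /= sub0r normrN; apply: le_lt_trans hN.
  apply: (le_trans (ler_normD _ _)); rewrite !normrZ !ger0_norm //.
  rewrite /N; have := normr_ge0 u; have := normr_ge0 v.
  move: (`|u|) (`|v|) => U V V0 U0; nra.
have bound (t s : R) : 0 <= t <= h -> 0 <= s <= h ->
    A (t *: u + s *: v + x) /\
    `|phi (t *: u + s *: v + x) - phi x - (t * 'D_u phi x + s * 'D_v phi x)|
      <= e / N * (t * `|u| + s * `|v|).
  move=> ht hs; have [/= le1 ?] := Hr _ (small t s ht hs); split=> //.
  move: le1; rewrite !fctE /= lin opprD addrA => le1.
  apply: (le_trans le1); apply: ler_wpM2l; first by rewrite divr_ge0 // ltW.
  apply: (le_trans (ler_normD _ _)); rewrite !normrZ.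
  by move: ht hs => /andP [t0 _] /andP [s0 _]; rewrite !ger0_norm.
pose g (t : R) := f (t *: u + (h *: v + x)) - f (t *: u + x).
have dg (t : R) : 0 <= t <= h -> is_derive t (1 : R) g
    (phi (t *: u + (h *: v + x)) - phi (t *: u + x)).
  move=> ht; apply: is_deriveB; apply: is_derive_line; apply: dfA.
    by rewrite addrA; apply: (bound t h ht _).1; rewrite ltW //=.
  have := (bound t 0 ht _).1; rewrite scale0r addr0; apply.
  by rewrite lexx ltW.
have dg_oo (t : R) : t \in `]0, h[ -> is_derive t (1 : R) g
    (phi (t *: u + (h *: v + x)) - phi (t *: u + x)).
  by rewrite in_itv /= => /andP [/ltW t0 /ltW th]; apply: dg; rewrite t0.
have cg : {within `[0, h], continuous g}.
  apply: derivable_within_continuous => t; rewrite in_itv /= => ht.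
  by have [] := dg t ht.
have [t] := MVT h0 dg_oo cg.
rewrite in_itv /= => /andP [t0 th].
rewrite subr0 {1 2}/g !scale0r !add0r => gE.
have ht : 0 <= t <= h by rewrite !ltW.
have h00 : 0 <= (0 : R) <= h by rewrite lexx ltW.
have hh : 0 <= h <= h by rewrite lexx ltW.
have [_ b1] := bound t h ht hh; have [_ b2] := bound t 0 ht h00.
move: b1 b2; rewrite scale0r addr0 mul0r !addr0 mul0r addr0 => b1 b2.
rewrite -(addrA (t *: u)) in b1.
rewrite (_ : _ + f x = g h - g 0); last first.
  by rewrite /g !scale0r !add0r; ring.
rewrite /g !scale0r !add0r gE -/phi.
set p1 := phi (t *: u + (h *: v + x)) in b1 *.
set p2 := phi (t *: u + x) in b2 *.
have alg (q1 q2 q du dv : R) : (q1 - q2) * h - h ^+ 2 * dv =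
    h * ((q1 - q - (t * du + h * dv)) - (q2 - q - t * du)) by ring.
rewrite (alg _ _ (phi x) ('D_u phi x)).
rewrite normrM (gtr0_norm h0) expr2 mulrCA ler_pM2l //.
apply: (le_trans (ler_normB _ _)).
apply: (le_trans (lerD b1 b2)).
rewrite -mulrDr -mulrA ler_pM2l // ler_pdivrMl // mulrC.
rewrite /N; have := normr_ge0 u; have := normr_ge0 v.
move: (`|u|) (`|v|) => U V V0 U0; nra.
Qed.

Lemma schwarz A f x u v : open A -> A x ->
  (forall y, A y -> derivable f y u) -> (forall y, A y -> derivable f y v) ->
  differentiable ('D_u f) x -> differentiable ('D_v f) x ->
  'D_v ('D_u f) x = 'D_u ('D_v f) x.
Proof.
move=> Ao Ax du dv duu dvv; apply/eqP; rewrite -subr_eq0 -normr_eq0.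
rewrite eq_le normr_ge0 andbT; apply/ler_addgt0Pr => e e0; rewrite add0r.
(* Both mixed derivatives, times [h ^+ 2], approximate one and the same second difference, each up
   to half of the tolerance. *)
have e2 : 0 < e / 2 by rewrite divr_gt0.
have [d1 d10 H1] := second_difference v Ao Ax du duu e2.
have [d2 d20 H2] := second_difference u Ao Ax dv dvv e2.
pose h := Num.min d1 d2 / 2.
have m0 : 0 < Num.min d1 d2 by rewrite lt_min d10.
have h0 : 0 < h by rewrite divr_gt0.
have hm : h < Num.min d1 d2 by rewrite /h ltr_pdivrMr // mulr_natr mulr2n ltrDl.
move: (hm); rewrite lt_min => /andP [hd1 hd2].
have := H1 h; rewrite h0 hd1 => /(_ isT) {}H1.
have := H2 h; rewrite h0 hd2 => /(_ isT) {}H2.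
have hh : 0 < h ^+ 2 by rewrite exprn_gt0.
rewrite -(ler_pM2l hh) -{1}(gtr0_norm hh) -normrM.
apply: le_trans (_ : _ <= e / 2 * h ^+ 2 + e / 2 * h ^+ 2) _; last first.
  by rewrite -mulrDl -splitr mulrC.
apply: le_trans (lerD H2 H1); apply: le_trans (ler_normB _ _).
rewrite [h *: v + (h *: u + x)]addrCA.
have alg (s a b c p q : R) : h ^+ 2 * (p - q) =
    (s - b - a + c - h ^+ 2 * q) - (s - a - b + c - h ^+ 2 * p) by ring.
by rewrite -alg.
Qed.

End Schwarz.

Lemma partialC (R : realType) n (A : set 'rV[R]_n) (f : 'rV[R]_n -> R) a b x :
  open A -> smooth_on A f -> A x ->
  partial a (partial b f) x = partial b (partial a f) x.
Proof.
move=> Ao fA Ax.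
have d v y : A y -> derivable f y v.
  by move=> Ay; apply: diff_derivable; exact: smooth_on_diff fA Ay.
have da := smooth_on_diff (smooth_on_partial a fA) Ax.
have db := smooth_on_diff (smooth_on_partial b fA) Ax.
exact: (schwarz Ao Ax (d _) (d _) db da).
Qed.

(** * Jacobian matrices *)

Section Jacobian.
Variable R : realType.

Lemma differentiable_rV m n (F : 'rV[R]_m -> 'rV[R]_n) x :
  (forall l, differentiable (fun y => F y 0 l) x) -> differentiable F x.
Proof.
move=> dF; rewrite (_ : F = \sum_l (fun y => F y 0 l *: delta_mx 0 l)).
  by apply: differentiable_sum => l; exact: differentiableZl.
apply/funext => y; rewrite {1}[F y]row_sum_delta fct_sumE.
by [].
Qed.

Lemma differentiable_entry m n (F : 'rV[R]_m -> 'rV[R]_n) x l :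
  differentiable F x -> differentiable (fun y => F y 0 l) x.
Proof.
move=> dF; apply: (@differentiable_comp _ _ _ _ F (fun y => y 0 l)) => //.
exact: differentiable_coord.
Qed.

Lemma jacobianE m n (F : 'rV[R]_m -> 'rV[R]_n) x k l : differentiable F x ->
  'J F x k l = partial k (fun y => F y 0 l) x.
Proof.
move=> dF; rewrite mxE -deriveE //; have := @diff_derivable _ _ _ _ _ (delta_mx 0 k) dF.
by move/derive_mx => ->; rewrite mxE.
Qed.

Lemma jacobian_row m n (F : 'rV[R]_m -> 'rV[R]_n) x k : 
  'd F x (delta_mx 0 k) = row k ('J F x).
Proof. by apply/rowP => l; rewrite !mxE. Qed.

Lemma partial_comp m n (F : 'rV[R]_m -> 'rV[R]_n) (f : 'rV[R]_n -> R) x k :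
  differentiable F x -> differentiable f (F x) ->
  partial k (fun y => f (F y)) x = \sum_l 'J F x k l * partial l f (F x).
Proof.
move=> dF df; rewrite partialE; last exact: differentiable_comp.
rewrite -[fun y => _]/(f \o F) diff_comp //= jacobian_row [row k _]row_sum_delta.
rewrite raddf_sum /=; apply: eq_bigr => l _.
by rewrite linearZ /= mxE partialE.
Qed.

Lemma jacobian_comp m n p (F : 'rV[R]_m -> 'rV[R]_n) (G : 'rV[R]_n -> 'rV[R]_p)
    x : differentiable F x -> differentiable G (F x) ->
  'J (G \o F) x = 'J F x *m 'J G (F x).
Proof.
move=> dF dG; apply/matrixP => k l.
have dGF : differentiable (G \o F) x by exact: differentiable_comp.
rewrite (jacobianE k l dGF) mxE.
rewrite (partial_comp (f := fun y => G y 0 l) k dF (differentiable_entry l dG)).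
by apply: eq_bigr => j _; rewrite (jacobianE j l dG).
Qed.

Lemma eq_jacobian m n (A : set 'rV[R]_m) (F G : 'rV[R]_m -> 'rV[R]_n) x :
  open A -> A x -> (forall y, A y -> F y = G y) -> differentiable F x ->
  differentiable G x /\ 'J G x = 'J F x.
Proof.
move=> Ao Ax FG dF.
have dG : differentiable G x.
  apply: differentiable_rV => l.
  apply: (eq_differentiable Ao Ax _ (differentiable_entry l dF)) => y Ay.
  by rewrite FG.
split; first exact: dG.
apply/matrixP => k l; rewrite [LHS](jacobianE k l dG) [RHS](jacobianE k l dF).
by apply: (eq_partial _ Ao Ax) => y Ay; rewrite FG.
Qed.

Lemma jacobian_id n (x : 'rV[R]_n) : 'J id x = 1%:M.
Proof.
have dI : differentiable (id : 'rV[R]_n -> 'rV[R]_n) x.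
  by apply: differentiable_rV => l; exact: differentiable_coord.
by apply/matrixP => k l; rewrite (jacobianE k l dI) partial_coord mxE.
Qed.

Lemma smooth_map_diff m n (A : set 'rV[R]_m) (F : 'rV[R]_m -> 'rV[R]_n) x :
  smooth_map_on A F -> A x -> differentiable F x.
Proof.
by move=> FA Ax; apply: differentiable_rV => l; exact: smooth_on_diff (FA l) Ax.
Qed.

Lemma eq_smooth_map_on m n (A : set 'rV[R]_m) (F G : 'rV[R]_m -> 'rV[R]_n) :
  open A -> (forall y, A y -> F y = G y) -> smooth_map_on A F ->
  smooth_map_on A G.
Proof.
by move=> Ao FG FA l; apply: eq_smooth_on (FA l) => // y /FG ->.
Qed.

Lemma smooth_on_jacobian m n (A : set 'rV[R]_m) (F : 'rV[R]_m -> 'rV[R]_n) k l :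
  open A -> smooth_map_on A F -> smooth_on A (fun x => 'J F x k l).
Proof.
move=> Ao FA; apply: (@eq_smooth_on _ _ A (partial k (fun y => F y 0 l))) => //.
  by move=> x Ax; rewrite (jacobianE k l (smooth_map_diff FA Ax)).
exact: smooth_on_partial.
Qed.

Variables m n : nat.
Implicit Type z : 'rV[R]_(m + n).

Lemma differentiable_lsub z : differentiable (fun y => lsubmx y : 'rV[R]_m) z.
Proof. exact: differentiable_lsubmx. Qed.

Lemma jacobian_lsubmx z :
  'J (fun y => lsubmx y : 'rV[R]_m) z = col_mx 1%:M 0.
Proof.
apply/matrixP => k l; rewrite (jacobianE k l (differentiable_lsub z)).
rewrite (_ : (fun y => _) = fun y : 'rV[R]_(m + n) => y 0 (lshift n l)).
  rewrite partial_coord; case: (split_ordP k) => a ->.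
    by rewrite col_mxEu mxE eq_lshift.
  by rewrite col_mxEd mxE eq_sym eq_lrshift.
by apply/funext => y; rewrite mxE.
Qed.

Lemma partial_lsubmxl (f : 'rV[R]_m -> R) z a : differentiable f (lsubmx z) ->
  partial (lshift n a) (fun y => f (lsubmx y)) z = partial a f (lsubmx z).
Proof.
move=> df; rewrite (partial_comp (f := f) _ (differentiable_lsub z) df).
rewrite jacobian_lsubmx (bigD1 a) //= col_mxEu mxE eqxx mul1r.
rewrite big1 ?addr0 // => b ba; rewrite col_mxEu mxE eq_sym (negbTE ba).
by rewrite mul0r.
Qed.

Lemma partial_lsubmxr (f : 'rV[R]_m -> R) z a : differentiable f (lsubmx z) ->
  partial (rshift m a) (fun y => f (lsubmx y)) z = 0.
Proof.
move=> df; rewrite (partial_comp (f := f) _ (differentiable_lsub z) df).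
by rewrite jacobian_lsubmx big1 // => b _; rewrite col_mxEd mxE mul0r.
Qed.

Lemma differentiable_lsub_comp (f : 'rV[R]_m -> R) z :
  differentiable f (lsubmx z) -> differentiable (fun y => f (lsubmx y)) z.
Proof.
move=> df; apply: (@differentiable_comp _ _ _ _ (fun y => lsubmx y) f) => //.
exact: differentiable_lsub.
Qed.

(** The part of a canonical chart of the cotangent bundle that lies over [A]; the fibre coordinates
    are unrestricted. *)
Definition lsub_set (A : set 'rV[R]_m) : set 'rV[R]_(m + n) :=
  [set z | A (lsubmx z)].

Lemma open_lsub_set A : open A -> open (lsub_set A).
Proof.
move=> Ao; apply: (@open_comp _ _ (fun y : 'rV[R]_(m + n) => lsubmx y)) => //.
move=> z _; exact: differentiable_continuous (differentiable_lsub z).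
Qed.

Lemma smooth_on_lsubmx (A : set 'rV[R]_m) (f : 'rV[R]_m -> R) : open A ->
  smooth_on A f -> smooth_on (lsub_set A) (fun z => f (lsubmx z)).
Proof.
move=> Ao /smooth_onP fA; apply/smooth_onP => p; have := fA p.
elim: p f {fA} => [|p IH] f [fA dfA]; split=> //;
  try by move=> z Az; apply: differentiable_lsub_comp; exact: fA.
move=> k; have oA := open_lsub_set Ao.
case: (split_ordP k) => a ->.
  apply: (@eq_diff_upto _ _ _ _ (fun z => partial a f (lsubmx z))) => //.
    by move=> z Az; rewrite partial_lsubmxl //; exact: fA.
  by apply: IH; exact: dfA.
apply: (@eq_diff_upto _ _ _ _ (fun z => 0)) => //; last exact: diff_upto_cst.
by move=> z Az; rewrite partial_lsubmxr //; exact: fA.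
Qed.

End Jacobian.

(** * Change of Weyl connection *)

Section ConformalChange.
Variables (R : numFieldType) (n : nat).
Implicit Types (a b c d e k : 'I_n).

Lemma sum_deltal (F : 'I_n -> R) a : \sum_c (c == a)%:R * F c = F a.
Proof.
rewrite (bigD1 a) //= eqxx mul1r big1 ?addr0 // => c ca.
by rewrite (negbTE ca) mul0r.
Qed.

Lemma sum_deltar (F : 'I_n -> R) a : \sum_c F c * (c == a)%:R = F a.
Proof. by rewrite -[RHS]sum_deltal; apply: eq_bigr => c _; rewrite mulrC. Qed.

Lemma sum_deltal' (F : 'I_n -> R) a : \sum_c (a == c)%:R * F c = F a.
Proof. by rewrite -[RHS]sum_deltal; apply: eq_bigr => c _; rewrite eq_sym. Qed.

Lemma sum_deltar' (F : 'I_n -> R) a : \sum_c F c * (a == c)%:R = F a.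
Proof. by rewrite -[RHS]sum_deltar; apply: eq_bigr => c _; rewrite eq_sym. Qed.

(* The symmetrised Ricci tensor of a torsion-free connection with Christoffel
   symbols [G k a b], whose first derivatives are [dG e k a b]. *)
Definition sricci (G : 'I_n -> 'I_n -> 'I_n -> R)
    (dG : 'I_n -> 'I_n -> 'I_n -> 'I_n -> R) a b : R :=
  \sum_c dG c c a b - 2^-1 * (\sum_c dG a c b c + \sum_c dG b c a c)
  + \sum_d (\sum_c G c c d) * G d a b - \sum_c \sum_d G d a c * G c b d.

Variables (g : 'I_n -> 'I_n -> R) (Y V : 'I_n -> R).

(* The difference of the Christoffel symbols of two Weyl connections: [Y] is half
   the difference of their one-forms and [V] is the vector dual to [Y]. *)
Definition weyl_change c a b : R :=
  (c == a)%:R * Y b + (c == b)%:R * Y a - g a b * V c.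

Hypothesis gsym : forall a b, g a b = g b a.
Hypothesis YV : forall d, Y d = \sum_c V c * g c d.

Let N := \sum_c V c * Y c.

Lemma weyl_change_sym c a b : weyl_change c a b = weyl_change c b a.
Proof. by rewrite /weyl_change gsym [_ + _ * Y a]addrC. Qed.

Lemma weyl_change_contract (p : 'I_n -> R) a b :
  \sum_d p d * weyl_change d a b = p a * Y b + p b * Y a
    - g a b * \sum_d p d * V d.
Proof.
rewrite (eq_bigr (fun d => (d == a)%:R * (p d * Y b) + (d == b)%:R * (p d * Y a)
   - g a b * (p d * V d))).
  by rewrite sumrB big_split /= !sum_deltal mulr_sumr.
by move=> d _; rewrite /weyl_change; ring.
Qed.

Lemma weyl_change_trace d : \sum_c weyl_change c c d = n%:R * Y d.
Proof.
rewrite (eq_bigr (fun c => Y d + (c == d)%:R * Y c - V c * g c d)).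
  rewrite sumrB big_split /= sum_deltal -YV sumr_const card_ord addrK.
  by rewrite mulr_natl.
by move=> c _; rewrite /weyl_change eqxx mul1r; ring.
Qed.

(** The array [P] is arbitrary because the contraction is needed twice: with [weyl_change] itself
    for the quadratic terms of the curvature, and with the Christoffel symbols for the mixed
    ones. *)
Lemma weyl_change_contract2 (P : 'I_n -> 'I_n -> R) b :
  \sum_c \sum_d P d c * weyl_change c b d =
  \sum_d P d b * Y d + (\sum_c P c c) * Y b
  - \sum_d \sum_c P d c * V c * g d b.
Proof.
rewrite [in RHS]exchange_big /= mulr_suml.
rewrite (eq_bigr (fun c => (c == b)%:R * (\sum_d P d c * Y d) + P c c * Y b
   - \sum_d P d c * V c * g d b)).
  by rewrite sumrB big_split /= sum_deltal.
move=> c _.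
rewrite (eq_bigr (fun d => (c == b)%:R * (P d c * Y d)
   + (c == d)%:R * (P d c * Y b) - P d c * V c * g d b)).
  by rewrite sumrB big_split /= sum_deltal' mulr_sumr.
by move=> d _; rewrite /weyl_change (gsym b d); ring.
Qed.

(** Lowering the index of [V] gives back [Y], so the two terms proportional to V^d Y_a cancel and
    only a multiple of the identity survives. *)
Lemma weyl_change_vector d a :
  \sum_c weyl_change d a c * V c = (d == a)%:R * N.
Proof.
rewrite (eq_bigr (fun c => (d == a)%:R * (V c * Y c)
   + (d == c)%:R * (V c * Y a) - V d * (V c * g c a))).
  by rewrite sumrB big_split /= sum_deltal' -!mulr_sumr -YV addrK.
by move=> c _; rewrite /weyl_change (gsym a c); ring.
Qed.

(** The right-hand side is (n-2) T + tr(T) g for T = Y (x) Y - 1/2 |Y|^2 g, because tr T = (1 - n/2)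
    |Y|^2; so this is the quadratic part of the change formula. *)
Lemma weyl_change_quadratic a b :
  \sum_d (\sum_c weyl_change c c d) * weyl_change d a b
  - \sum_c \sum_d weyl_change d a c * weyl_change c b d =
  (n%:R - 2) * (Y a * Y b - N * g a b).
Proof.
under eq_bigr => d _ do rewrite weyl_change_trace.
rewrite weyl_change_contract weyl_change_contract2.
have -> : \sum_d weyl_change d a b * Y d = \sum_d Y d * weyl_change d a b.
  by apply: eq_bigr => d _; rewrite mulrC.
rewrite weyl_change_contract.
have -> : \sum_c weyl_change c a c = n%:R * Y a.
  by rewrite -weyl_change_trace; apply: eq_bigr => c _; rewrite weyl_change_sym.
have -> : \sum_d \sum_c weyl_change d a c * V c * g d b = N * g a b.
  rewrite -(sum_deltal (fun d => N * g d b)); apply: eq_bigr => d _.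
  by rewrite -mulr_suml weyl_change_vector mulrA.
have -> : \sum_d Y d * V d = N by apply: eq_bigr => d _; rewrite mulrC.
have -> : \sum_d n%:R * Y d * V d = n%:R * N.
  by rewrite mulr_sumr; apply: eq_bigr => d _; rewrite mulrAC mulrA.
ring.
Qed.

Variables (G : 'I_n -> 'I_n -> 'I_n -> R).
Hypothesis Gsym : forall k a b, G k a b = G k b a.
Let tG d := \sum_c G c c d.
(** The Christoffel part of the covariant derivative of [V] in direction [a], lowered with [g]. *)
Let Gg a b := \sum_d \sum_c G d a c * V c * g d b.

(** Besides the Christoffel terms of (n-2) T and of tr(T) g, the contractions leave the symmetrised
    [Gg]. It cancels against the derivative of [g] along [V] ([dg_vector]), which enters through the
    divergence of the change ([dweyl_change_div]). *)
Lemma weyl_change_cross a b :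
  \sum_d (\sum_c G c c d) * weyl_change d a b
  + \sum_d (\sum_c weyl_change c c d) * G d a b
  - \sum_c \sum_d G d a c * weyl_change c b d
  - \sum_c \sum_d weyl_change d a c * G c b d =
  (n%:R - 2) * (\sum_d Y d * G d a b) - g a b * (\sum_d tG d * V d)
  + Gg a b + Gg b a.
Proof.
rewrite weyl_change_contract -/tG.
under [X in _ + X - _ - _]eq_bigr => d _ do rewrite weyl_change_trace -mulrA.
rewrite -mulr_sumr weyl_change_contract2 -/(Gg a b).
have -> : \sum_c \sum_d weyl_change d a c * G c b d =
          \sum_c \sum_d G d b c * weyl_change c a d.
  by rewrite exchange_big /=; apply: eq_bigr => c _; apply: eq_bigr => d _;
     rewrite mulrC.
rewrite weyl_change_contract2 -/(Gg b a).
have tGE d : \sum_c G c d c = tG d by apply: eq_bigr => c _; rewrite Gsym.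
rewrite !tGE -/(tG a) -/(tG b).
have -> : \sum_d G d a b * Y d = \sum_d Y d * G d a b.
  by apply: eq_bigr => d _; rewrite mulrC.
have -> : \sum_d G d b a * Y d = \sum_d Y d * G d a b.
  by apply: eq_bigr => d _; rewrite mulrC Gsym.
ring.
Qed.

Variables (dG : 'I_n -> 'I_n -> 'I_n -> 'I_n -> R).
Variables (beta : 'I_n -> R) (dg : 'I_n -> 'I_n -> 'I_n -> R).
Variables (dY dV : 'I_n -> 'I_n -> R) (gi : 'I_n -> 'I_n -> R).

Definition dweyl_change e c a b : R :=
  (c == a)%:R * dY e b + (c == b)%:R * dY e a - (dg e a b * V c + g a b * dV e c).

(** The classical change of the Schouten tensor, - nabla Y + Y (x) Y - 1/2 |Y|^2 g, symmetrised: the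
    first two terms are minus the symmetrised covariant derivative of [Y]. *)
Definition schouten_change a b : R :=
  - (2^-1 * (dY a b + dY b a)) + \sum_d Y d * G d a b + Y a * Y b
  - 2^-1 * N * g a b.

Hypothesis dgE : forall e a b,
  dg e a b = \sum_d G d e a * g d b + \sum_d G d e b * g d a + beta e * g a b.
Hypothesis dYV : forall e d,
  dY e d = \sum_c dV e c * g c d + \sum_c V c * dg e c d.
Hypothesis giE : forall a c, \sum_b gi a b * g b c = (a == c)%:R.

Let dgsym e a b : dg e a b = dg e b a.
Proof. by rewrite !dgE gsym [X in X + _]addrC. Qed.

Lemma dweyl_change_trace a b : \sum_c dweyl_change a c b c = n%:R * dY a b.
Proof.
rewrite (eq_bigr (fun c => (c == b)%:R * dY a c + dY a b
   - (dV a c * g c b + V c * dg a c b))).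
  rewrite sumrB !big_split /= sum_deltal -dYV sumr_const card_ord.
  by rewrite addrAC subrr add0r mulr_natl.
by move=> c _; rewrite /dweyl_change eqxx mul1r (gsym b) (dgsym a b); ring.
Qed.

Lemma dweyl_change_div a b : \sum_c dweyl_change c c a b =
  dY a b + dY b a - \sum_c V c * dg c a b - g a b * \sum_c dV c c.
Proof.
rewrite (eq_bigr (fun c => (c == a)%:R * dY c b + (c == b)%:R * dY c a
   - (V c * dg c a b + g a b * dV c c))).
  rewrite sumrB !big_split /= !sum_deltal mulr_sumr opprD addrA.
  by [].
by move=> c _; rewrite /dweyl_change [V c * _]mulrC.
Qed.

Lemma dg_vector a b :
  \sum_c V c * dg c a b = Gg a b + Gg b a + (\sum_c beta c * V c) * g a b.
Proof.
rewrite (eq_bigr (fun c => (\sum_d G d a c * V c * g d b)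
   + (\sum_d G d b c * V c * g d a) + beta c * V c * g a b)).
  rewrite !big_split /= mulr_suml; congr (_ + _ + _); exact: exchange_big.
move=> c _; rewrite dgE !mulrDr !mulr_sumr; congr (_ + _ + _).
- by apply: eq_bigr => d _; rewrite (Gsym d a); ring.
- by apply: eq_bigr => d _; rewrite (Gsym d b); ring.
- by ring.
Qed.

Hypothesis gisym : forall a b, gi a b = gi b a.
Let tr (T : 'I_n -> 'I_n -> R) := \sum_a \sum_b gi a b * T a b.

Let gi_raise (F : 'I_n -> R) a : \sum_b gi a b * (\sum_c F c * g c b) = F a.
Proof.
rewrite -[RHS](sum_deltar' F a).
under eq_bigr => b _ do rewrite mulr_sumr.
rewrite exchange_big /=; apply: eq_bigr => c _.
by rewrite -giE mulr_sumr; apply: eq_bigr => b _; rewrite (gsym c); ring.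
Qed.

Let trB T T' : tr (fun a b => T a b - T' a b) = tr T - tr T'.
Proof.
rewrite -sumrB; apply: eq_bigr => a _; rewrite -sumrB; apply: eq_bigr => b _.
by rewrite mulrBr.
Qed.

Let trD T T' : tr (fun a b => T a b + T' a b) = tr T + tr T'.
Proof.
rewrite -big_split; apply: eq_bigr => a _; rewrite -big_split.
by apply: eq_bigr => b _; rewrite mulrDr.
Qed.

Let trZ x T : tr (fun a b => x * T a b) = x * tr T.
Proof.
rewrite mulr_sumr; apply: eq_bigr => a _; rewrite mulr_sumr.
by apply: eq_bigr => b _; rewrite mulrCA.
Qed.

Let tr_g : tr g = n%:R.
Proof.
rewrite -[n in RHS]card_ord -sumr_const; apply: eq_bigr => a _.
by under eq_bigr => b _ do rewrite gsym; rewrite giE eqxx.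
Qed.

(** Moving the Christoffel term to the left, this says that the trace of nabla Y is the divergence
    of V plus beta(V): lowering an index does not commute with nabla, and the defect is nabla g =
    beta (x) g. *)
Let tr_dY : tr dY = \sum_c dV c c + \sum_d tG d * V d
  + tr (fun a b => \sum_d Y d * G d a b) + \sum_c beta c * V c.
Proof.
have E a b : dY a b = \sum_c dV a c * g c b
    + \sum_d (\sum_c V c * G d a c) * g d b + \sum_d Y d * G d a b
    + beta a * (\sum_c V c * g c b).
  rewrite dYV -!addrA; congr (_ + _).
  rewrite (eq_bigr (fun c => (\sum_d G d a c * (V c * g d b))
    + (\sum_d G d a b * (V c * g c d)) + beta a * (V c * g c b))); last first.
    move=> c _; rewrite dgE !mulrDr !mulr_sumr; congr (_ + _ + _).
    - by apply: eq_bigr => d _; ring.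
    - by apply: eq_bigr => d _; rewrite (gsym c d); ring.
    - by ring.
  rewrite !big_split /= -mulr_sumr -addrA; congr (_ + (_ + _)).
    rewrite exchange_big /=; apply: eq_bigr => d _; rewrite mulr_suml.
    by apply: eq_bigr => c _; ring.
  rewrite exchange_big /=; apply: eq_bigr => d _.
  by rewrite YV mulr_suml; apply: eq_bigr => c _; rewrite mulrC.
rewrite (_ : tr dY = tr (fun a b => \sum_c dV a c * g c b
    + \sum_d (\sum_c V c * G d a c) * g d b + \sum_d Y d * G d a b
    + beta a * (\sum_c V c * g c b))); last first.
  by apply: eq_bigr => a _; apply: eq_bigr => b _; rewrite E.
rewrite !trD; congr (_ + _ + _ + _).
- by apply: eq_bigr => a _; rewrite gi_raise.
- transitivity (\sum_a \sum_c V c * G a a c).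
    by apply: eq_bigr => a _; rewrite (gi_raise (fun d => \sum_c V c * G d a c)).
  rewrite exchange_big /=; apply: eq_bigr => c _; rewrite mulr_suml.
  by apply: eq_bigr => d _; rewrite mulrC.
- apply: eq_bigr => a _; rewrite -[V a]gi_raise mulr_sumr.
  by apply: eq_bigr => b _; rewrite mulrCA.
Qed.

Lemma schouten_change_trace : tr schouten_change =
  - (\sum_c dV c c + \sum_d tG d * V d + \sum_c beta c * V c)
  - (2^-1 * n%:R - 1) * N.
Proof.
have trdYT : tr (fun a b => dY b a) = tr dY.
  rewrite /tr exchange_big /=; apply: eq_bigr => a _; apply: eq_bigr => b _.
  by rewrite gisym.
have trYY : tr (fun a b => Y a * Y b) = N.
  apply: eq_bigr => a _; rewrite -[V a]gi_raise mulr_suml.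
  by apply: eq_bigr => b _; rewrite -YV; ring.
rewrite (_ : tr _ = tr (fun a b => - 2^-1 * (dY a b + dY b a)
   + \sum_d Y d * G d a b + Y a * Y b - 2^-1 * N * g a b)); last first.
  by apply: eq_bigr => a _; apply: eq_bigr => b _; rewrite /schouten_change mulNr.
rewrite trB !trD !trZ trD trdYT trYY tr_g tr_dY.
by field.
Qed.

(** Expanding the product terms separates what is linear from what is quadratic in the change. The
    quadratic part is [weyl_change_quadratic]; in the linear part, the derivatives and the mixed
    products combine to covariant derivatives of [Y], and everything proportional to [g] is the
    trace given by [schouten_change_trace]. *)
Lemma sricci_weyl_change a b :
  sricci (fun k a b => G k a b + weyl_change k a b)
         (fun e k a b => dG e k a b + dweyl_change e k a b) a b =
  sricci G dG a b + (n%:R - 2) * schouten_change a b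
  + (\sum_c \sum_d gi c d * schouten_change c d) * g a b.
Proof.
rewrite -/(tr schouten_change) schouten_change_trace.
have q := weyl_change_quadratic a b; have l := weyl_change_cross a b.
have dv := dg_vector a b; rewrite /sricci.
have dGW (F H : 'I_n -> R) : \sum_c (F c + H c) = \sum_c F c + \sum_c H c.
  exact: big_split.
rewrite (dGW _ (fun c => dweyl_change c c a b)).
rewrite (dGW _ (fun c => dweyl_change a c b c)).
rewrite (dGW _ (fun c => dweyl_change b c a c)).
rewrite !dweyl_change_trace dweyl_change_div dv.
have -> : \sum_d (\sum_c (G c c d + weyl_change c c d))
                  * (G d a b + weyl_change d a b) =
  \sum_d (\sum_c G c c d) * G d a b
  + \sum_d (\sum_c G c c d) * weyl_change d a b
  + \sum_d (\sum_c weyl_change c c d) * G d a b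
  + \sum_d (\sum_c weyl_change c c d) * weyl_change d a b.
  rewrite -!big_split /=; apply: eq_bigr => d _; rewrite big_split /=.
  by rewrite mulrDl !mulrDr !addrA.
have -> : \sum_c \sum_d (G d a c + weyl_change d a c)
                  * (G c b d + weyl_change c b d) =
  \sum_c \sum_d G d a c * G c b d
  + \sum_c \sum_d G d a c * weyl_change c b d
  + \sum_c \sum_d weyl_change d a c * G c b d
  + \sum_c \sum_d weyl_change d a c * weyl_change c b d.
  rewrite -!big_split /=; apply: eq_bigr => c _; rewrite -!big_split /=.
  by apply: eq_bigr => d _; rewrite mulrDl !mulrDr !addrA.
rewrite /schouten_change.
have alg (A1 A2 A3 A4 q1 q2 X Z : R) : A1 + A2 - A3 - A4 = X -> q1 - q2 = Z ->
    A1 = X - A2 + A3 + A4 /\ q1 = Z + q2.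
  by move=> <- <-; split; ring.
have [-> ->] := alg _ _ _ _ _ _ _ _ l q.
by field.
Qed.

End ConformalChange.

(** * Curvature and changes of coordinates *)

Section MatrixPartial.
Variables (R : realType) (n : nat).
Implicit Types (x : 'rV[R]_n) (k : 'I_n).

Definition partial_mx k m p (F : 'rV[R]_n -> 'M[R]_(m, p)) x : 'M[R]_(m, p) :=
  \matrix_(a, b) partial k (fun y => F y a b) x.

Definition differentiable_mx m p (F : 'rV[R]_n -> 'M[R]_(m, p)) x : Prop :=
  forall a b, differentiable (fun y => F y a b) x.

Lemma differentiable_mxM m p q (F : 'rV[R]_n -> 'M[R]_(m, p))
    (H : 'rV[R]_n -> 'M[R]_(p, q)) x :
  differentiable_mx F x -> differentiable_mx H x ->
  differentiable_mx (fun y => F y *m H y) x.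
Proof.
move=> dF dH a b.
rewrite (_ : (fun y => _) = fun y => \sum_c F y a c * H y c b).
  by apply: differentiable_bigsum => c _; exact: differentiableM.
by apply/funext => y; rewrite mxE.
Qed.

Lemma partial_mxM k m p q (F : 'rV[R]_n -> 'M[R]_(m, p))
    (H : 'rV[R]_n -> 'M[R]_(p, q)) x :
  differentiable_mx F x -> differentiable_mx H x ->
  partial_mx k (fun y => F y *m H y) x =
  partial_mx k F x *m H x + F x *m partial_mx k H x.
Proof.
move=> dF dH; apply/matrixP => a b; rewrite !mxE.
rewrite (_ : (fun y => _) = fun y => \sum_c F y a c * H y c b).
  rewrite partial_sum => [|c _]; last exact: differentiableM.
  rewrite -big_split /=; apply: eq_bigr => c _.
  by rewrite partialM // !mxE.
by apply/funext => y; rewrite mxE.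
Qed.

Lemma partial_mxD k m p (F H : 'rV[R]_n -> 'M[R]_(m, p)) x :
  differentiable_mx F x -> differentiable_mx H x ->
  partial_mx k (fun y => F y + H y) x = partial_mx k F x + partial_mx k H x.
Proof.
move=> dF dH; apply/matrixP => a b; rewrite !mxE.
rewrite (_ : (fun y => _) = fun y => F y a b + H y a b).
  by rewrite partialD.
by apply/funext => y; rewrite mxE.
Qed.

Lemma eq_partial_mx (A : set 'rV[R]_n) k m p (F H : 'rV[R]_n -> 'M[R]_(m, p)) x :
  open A -> A x -> (forall y, A y -> F y = H y) ->
  partial_mx k F x = partial_mx k H x.
Proof.
move=> Ao Ax FH; apply/matrixP => a b; rewrite !mxE.
by apply: (eq_partial _ Ao Ax) => y Ay; rewrite FH.
Qed.

End MatrixPartial.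

Section Curvature.
Variables (R : realType) (n : nat).
Implicit Types (x : 'rV[R]_n) (G : 'I_n -> 'rV[R]_n -> 'M[R]_n).
Implicit Types (a b c d k : 'I_n).

Lemma sum_frame (F : 'I_n -> R) a x : \sum_b frame a x 0 b * F b = F a.
Proof.
rewrite (bigD1 a) //= mxE !eqxx mul1r big1 ?addr0 // => b ba.
by rewrite mxE (negbTE ba) andbF mul0r.
Qed.

Lemma partial_frame a b k x : partial k (fun y => frame a y 0 b) x = 0 :> R.
Proof. exact: partial_cst. Qed.

Lemma nabla_frame G a Y x k : nabla G (frame a) Y x 0 k =
  partial a (fun y => Y y 0 k) x + \sum_b G k x a b * Y x 0 b.
Proof.
rewrite mxE sum_frame; congr (_ + _).
under eq_bigr => c _ do under eq_bigr => b _ do rewrite mulrAC mulrC.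
under eq_bigr => c _ do rewrite -mulr_sumr.
by rewrite sum_frame.
Qed.

Lemma nabla_frame2 G a b x k : nabla G (frame a) (frame b) x 0 k = G k x a b.
Proof.
rewrite nabla_frame partial_frame add0r.
by under eq_bigr => c _ do rewrite mulrC; rewrite sum_frame.
Qed.

Lemma lie_bracket_frame a b : lie_bracket (frame a) (frame b) = fun=> 0 :> 'rV[R]_n.
Proof.
apply/funext => x; apply/rowP => k; rewrite mxE [RHS]mxE big1 // => c _.
by rewrite !partial_frame !mulr0 subrr.
Qed.

Lemma nabla0 G Y : nabla G (fun=> 0) Y = fun=> 0.
Proof.
apply/funext => x; apply/rowP => k; rewrite mxE [RHS]mxE !big1 ?addr0 // => c _.
  by rewrite big1 // => d _; rewrite mxE mulr0 mul0r.
by rewrite mxE mul0r.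
Qed.

Lemma torsionE G a b x k : torsion G (frame a) (frame b) x 0 k =
  G k x a b - G k x b a.
Proof.
by rewrite /torsion lie_bracket_frame subr0 mxE [X in _ + X]mxE !nabla_frame2.
Qed.

(* [chris G a x] is the matrix of [nabla_a] acting on frames, so that a
   coordinate change acts on [chris G] as a gauge transformation. *)
Definition chris G a x : 'M[R]_n := \matrix_(b, k) G k x a b.

(** The matrices act on frames written as rows, so that nabla_c nabla_a produces the product
    [C a x *m C c x]; hence the order in the commutator. *)
Definition curv_mx (C : 'I_n -> 'rV[R]_n -> 'M[R]_n) c a x : 'M[R]_n :=
  partial_mx c (C a) x - partial_mx a (C c) x
  + (C a x *m C c x - C c x *m C a x).

Lemma curv_mxE C c a x b k : curv_mx C c a x b k =
  partial c (fun y => C a y b k) x - partial a (fun y => C c y b k) x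
  + (\sum_d C a x b d * C c x d k - \sum_d C c x b d * C a x d k).
Proof. by rewrite !mxE. Qed.

Lemma chrisE G a b k : (fun y => chris G a y b k) = fun y => G k y a b.
Proof. by apply/funext => y; rewrite mxE. Qed.

Lemma ricciE G x a b : ricci G x a b = \sum_c curv_mx (chris G) c a x b c.
Proof.
rewrite mxE; apply: eq_bigr => c _.
rewrite /curvature lie_bracket_frame nabla0 subr0 mxE [X in _ + X]mxE !nabla_frame.
have E d e k : (fun y => nabla G (frame d) (frame e) y 0 k) =
    fun y => chris G d y e k.
  by apply/funext => y; rewrite nabla_frame2 mxE.
rewrite curv_mxE !E -!addrA; congr (_ + _).
rewrite opprD addrCA; congr (_ + (_ + _)).
  by apply: eq_bigr => d _; rewrite nabla_frame2 [chris _ _ _ _ _]mxE [chris _ _ _ _ _]mxE mulrC.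
by congr (- _); apply: eq_bigr => d _; rewrite nabla_frame2 [chris _ _ _ _ _]mxE [chris _ _ _ _ _]mxE mulrC.
Qed.

Lemma ricciE' G x a b : ricci G x a b =
  \sum_c partial c (fun y => G c y a b) x
  - \sum_c partial a (fun y => G c y c b) x
  + \sum_d (\sum_c G c x c d) * G d x a b
  - \sum_c \sum_d G d x a c * G c x d b.
Proof.
rewrite ricciE.
rewrite (eq_bigr (fun c => partial c (fun y => G c y a b) x
  - partial a (fun y => G c y c b) x + ((\sum_d G c x c d * G d x a b)
  - \sum_d G c x a d * G d x c b))).
  rewrite big_split /= !sumrB -[RHS]addrA; congr (_ + (_ - _)).
    rewrite exchange_big /=; apply: eq_bigr => d _; rewrite mulr_suml.
    by [].
  by rewrite exchange_big.
move=> c _; rewrite curv_mxE !chrisE.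
congr (_ - _ + (_ - _)).
- by apply: eq_bigr => d _; rewrite !mxE mulrC.
- by apply: eq_bigr => d _; rewrite !mxE mulrC.
Qed.

Lemma ricci_sym G (A : set 'rV[R]_n) x a b : open A -> A x ->
  (forall y, A y -> forall k a b, G k y a b = G k y b a) ->
  2^-1 * (ricci G x a b + ricci G x b a) =
  sricci (fun k a b => G k x a b)
    (fun e k a b => partial e (fun y => G k y a b) x) a b.
Proof.
move=> Ao Ax Gs; rewrite !ricciE' /sricci.
have dGs e k c d : partial e (fun y => G k y c d) x =
    partial e (fun y => G k y d c) x.
  by apply: (eq_partial _ Ao Ax) => y Ay; exact: Gs.
have -> : \sum_c partial c (fun y => G c y b a) x =
          \sum_c partial c (fun y => G c y a b) x.
  by apply: eq_bigr => c _; rewrite dGs.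
have tr d e : \sum_c partial d (fun y => G c y c e) x =
    \sum_c partial d (fun y => G c y e c) x.
  by apply: eq_bigr => c _; rewrite dGs.
rewrite (tr a b) (tr b a).
have -> : \sum_d (\sum_c G c x c d) * G d x b a =
          \sum_d (\sum_c G c x c d) * G d x a b.
  by apply: eq_bigr => d _; rewrite (Gs x Ax).
have -> : \sum_c \sum_d G d x a c * G c x d b =
          \sum_c \sum_d G d x a c * G c x b d.
  by apply: eq_bigr => c _; apply: eq_bigr => d _; rewrite (Gs x Ax _ d).
have -> : \sum_c \sum_d G d x b c * G c x d a =
          \sum_c \sum_d G d x a c * G c x b d.
  rewrite exchange_big /=; apply: eq_bigr => c _; apply: eq_bigr => d _.
  by rewrite (Gs x Ax _ c) mulrC.
by field.
Qed.

(** For symmetric Christoffel symbols, the derivative of their trace is the only term of the Ricci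
    tensor that is not symmetric. *)
Lemma ricci_alt G (A : set 'rV[R]_n) x a b : open A -> A x ->
  (forall y, A y -> forall k a b, G k y a b = G k y b a) ->
  ricci G x a b - ricci G x b a =
  \sum_c partial b (fun y => G c y c a) x
  - \sum_c partial a (fun y => G c y c b) x.
Proof.
move=> Ao Ax Gs; rewrite !ricciE'.
have -> : \sum_c partial c (fun y => G c y b a) x =
          \sum_c partial c (fun y => G c y a b) x.
  apply: eq_bigr => c _; apply: (eq_partial _ Ao Ax) => y Ay; exact: Gs.
have -> : \sum_d (\sum_c G c x c d) * G d x b a =
          \sum_d (\sum_c G c x c d) * G d x a b.
  by apply: eq_bigr => d _; rewrite (Gs x Ax).
have -> : \sum_c \sum_d G d x b c * G c x d a =
          \sum_c \sum_d G d x a c * G c x d b.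
  rewrite exchange_big /=; apply: eq_bigr => c _; apply: eq_bigr => d _.
  by rewrite (Gs x Ax c b d) (Gs x Ax d c a) mulrC.
ring.
Qed.

(** Curvature is conjugated by a gauge transformation: differentiate [C k y *m J y = partial_mx k J
    y + J y *m B k y] once more and antisymmetrise. The second derivatives of [J] drop out by
    symmetry, and its first derivatives are eliminated by the relation itself. *)
Lemma curv_mx_gauge (A : set 'rV[R]_n) (C B : 'I_n -> 'rV[R]_n -> 'M[R]_n)
    (J : 'rV[R]_n -> 'M[R]_n) c a x : open A -> A x ->
  (forall k, differentiable_mx (C k) x) -> (forall k, differentiable_mx (B k) x) ->
  differentiable_mx J x -> (forall k, differentiable_mx (partial_mx k J) x) ->
  partial_mx c (partial_mx a J) x = partial_mx a (partial_mx c J) x ->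
  (forall k y, A y -> C k y *m J y = partial_mx k J y + J y *m B k y) ->
  curv_mx C c a x *m J x = J x *m curv_mx B c a x.
Proof.
move=> Ao Ax dC dB dJ ddJ ddJC CJ.
have E e k : partial_mx e (C k) x *m J x = partial_mx e (partial_mx k J) x
    + partial_mx e J x *m B k x + J x *m partial_mx e (B k) x
    - C k x *m partial_mx e J x.
  have := @eq_partial_mx _ _ A e _ _ _ _ x Ao Ax (CJ k).
  rewrite (partial_mxM e (dC k) dJ).
  rewrite (partial_mxD e (ddJ k) (differentiable_mxM dJ (dB k))).
  rewrite (partial_mxM e dJ (dB k)) addrA => eqE.
  by apply/eqP; rewrite eq_sym subr_eq -eqE.
have D k : partial_mx k J x = C k x *m J x - J x *m B k x.
  by rewrite (CJ k x Ax) addrK.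
rewrite /curv_mx mulmxDl mulmxBl (E c a) (E a c) ddJC.
move: (partial_mx a (partial_mx c J) x) => H; rewrite !D.
rewrite !(mulmxDr, mulmxDl, mulmxN, mulNmx, mulmxA).
move: (C c x *m J x *m B a x) (C a x *m J x *m B c x) => P1 P2.
move: (J x *m B a x *m B c x) (J x *m B c x *m B a x) => P3 P4.
move: (C c x *m C a x *m J x) (C a x *m C c x *m J x) => P5 P6.
move: (J x *m partial_mx c (B a) x) (J x *m partial_mx a (B c) x) => P7 P8.
by apply/matrixP => i j; rewrite !mxE; ring.
Qed.

(** * Transformation law of the Ricci tensor *)

Section ChangeOfCoordinates.
Variables (O : set 'rV[R]_n) (t : 'rV[R]_n -> 'rV[R]_n).
Variables (G G' : 'I_n -> 'rV[R]_n -> 'M[R]_n).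
Hypotheses (Oo : open O) (tO : smooth_map_on O t).
Hypothesis GO : forall k a b, smooth_on O (fun y => G k y a b).
Hypothesis G'O : forall k a b x, O x -> differentiable (fun y => G' k y a b) (t x).
Hypothesis GG' : forall x, O x -> forall k a b,
  \sum_c G c x a b * 'J t x c k = partial a (partial b (fun y => t y 0 k)) x
    + \sum_c \sum_d 'J t x a c * 'J t x b d * G' k (t x) c d.

(** ['J t] is defined through the differential of [t]; the matrix of partial derivatives agrees with
    it on [O] and has entries that can be differentiated directly. *)
Let J (x : 'rV[R]_n) : 'M[R]_n := \matrix_(b, k) partial b (fun y => t y 0 k) x.

Let JE x : O x -> 'J t x = J x.
Proof.
move=> Ox; apply/matrixP => b k.
by rewrite [LHS](jacobianE b k (smooth_map_diff tO Ox)) [RHS]mxE.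
Qed.

Let Jd b k : (fun y => J y b k) = partial b (fun y => t y 0 k).
Proof. by apply/funext => y; rewrite mxE. Qed.

(** The connection [G'] pulled back along [t], with its direction index in the old coordinates but
    its matrix still in the new frame. Passing from [chris G] to [B] is thus a pure gauge
    transformation by [J]. *)
Let B a (x : 'rV[R]_n) : 'M[R]_n := \sum_c J x a c *: chris G' c (t x).

Let dJ k x : O x -> differentiable_mx J x.
Proof.
by move=> Ox a b; rewrite Jd; exact: smooth_on_diff (smooth_on_partial a (tO b)) Ox.
Qed.

Let ddJ k x : O x -> differentiable_mx (partial_mx k J) x.
Proof.
move=> Ox a b; rewrite (_ : (fun y => _) = partial k (partial a (fun y => t y 0 b))).
  exact: smooth_on_diff (smooth_on_partial k (smooth_on_partial a (tO b))) Ox.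
by apply/funext => y; rewrite mxE Jd.
Qed.

Let BE a b k x : B a x b k = \sum_c J x a c * G' k (t x) c b.
Proof.
by rewrite summxE; apply: eq_bigr => c _; rewrite !mxE.
Qed.

Let dG't k c b x : O x -> differentiable (fun y => G' k (t y) c b) x.
Proof.
move=> Ox; apply: (@differentiable_comp _ _ _ _ t (fun y => G' k y c b)).
  exact: smooth_map_diff tO Ox.
exact: G'O.
Qed.

Let dB a x : O x -> differentiable_mx (B a) x.
Proof.
move=> Ox b k; rewrite (_ : (fun y => _) = fun y => \sum_c J y a c * G' k (t y) c b).
  apply: differentiable_bigsum => c _; apply: differentiableM.
    exact: dJ.
  exact: dG't.
by apply/funext => y; rewrite BE.
Qed.

Let gauge k x : O x -> chris G k x *m J x = partial_mx k J x + J x *m B k x.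
Proof.
move=> Ox; apply/matrixP => b l.
rewrite [RHS]mxE [X in X + _]mxE Jd !mxE.
transitivity (\sum_c G c x k b * 'J t x c l).
  by rewrite (JE Ox); apply: eq_bigr => c _; rewrite mxE.
rewrite (GG' Ox) (JE Ox); congr (_ + _).
rewrite exchange_big /=; apply: eq_bigr => d _.
by rewrite BE mulr_sumr; apply: eq_bigr => c _; ring.
Qed.

Let partial_B c a b k x : O x -> partial c (fun y => B a y b k) x =
  \sum_d (partial c (fun y => J y a d) x * G' k (t x) d b)
  + \sum_d \sum_e J x a d * (J x c e * partial e (fun y => G' k y d b) (t x)).
Proof.
move=> Ox; rewrite (_ : (fun y => _) = fun y => \sum_c J y a c * G' k (t y) c b).
  rewrite partial_sum => [|d _]; last first.
    by apply: differentiableM; [exact: dJ|exact: dG't].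
  rewrite -big_split /=; apply: eq_bigr => d _.
  rewrite partialM; [|exact: dJ|exact: dG't].
  congr (_ + _); rewrite -mulr_sumr; congr (_ * _).
  rewrite (partial_comp (f := fun y => G' k y d b) c (smooth_map_diff tO Ox)).
    by rewrite (JE Ox).
  exact: G'O.
by apply/funext => y; rewrite BE.
Qed.

Let BB a c x : B a x *m B c x = \sum_e \sum_f
  (J x c e * J x a f) *: (chris G' f (t x) *m chris G' e (t x)).
Proof.
rewrite /B mulmx_suml exchange_big /=; apply: eq_bigr => f _.
rewrite mulmx_sumr; apply: eq_bigr => e _.
by rewrite -scalemxAl -scalemxAr scalerA mulrC.
Qed.

Let partial_mxB c a x : O x -> partial_mx c (B a) x =
  \sum_d partial c (fun y => J y a d) x *: chris G' d (t x)
  + \sum_e \sum_f (J x c e * J x a f) *: partial_mx e (chris G' f) (t x).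
Proof.
move=> Ox; apply/matrixP => b k; rewrite [LHS]mxE (partial_B _ _ _ _ Ox).
rewrite [RHS]mxE !summxE; congr (_ + _).
  by apply: eq_bigr => d _; rewrite !mxE.
rewrite exchange_big /=; apply: eq_bigr => e _; rewrite summxE.
apply: eq_bigr => f _; rewrite [RHS]mxE [X in _ = _ * X]mxE chrisE mulrCA mulrA.
by [].
Qed.

(** The derivatives of [J], which are second derivatives of [t], enter symmetrically in [a] and [c]
    and cancel; what remains is the pullback of a two-form. *)
Let curv_B c a x : O x -> curv_mx B c a x =
  \sum_e \sum_f (J x c e * J x a f) *: curv_mx (chris G') e f (t x).
Proof.
move=> Ox; rewrite /curv_mx !partial_mxB // !BB.
have -> : \sum_d partial a (fun y => J y c d) x *: chris G' d (t x) =
          \sum_d partial c (fun y => J y a d) x *: chris G' d (t x).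
  by apply: eq_bigr => d _; rewrite !Jd (partialC _ _ Oo (tO d) Ox).
have alg (S X Y Z : 'M[R]_n) : S + X - (S + Y) + Z = X - Y + Z.
  by rewrite opprD addrACA subrr add0r.
rewrite {}alg.
have sw (X : 'I_n -> 'I_n -> 'M[R]_n) :
    \sum_e \sum_f (J x a e * J x c f) *: X e f =
    \sum_e \sum_f (J x c e * J x a f) *: X f e.
  rewrite exchange_big /=; apply: eq_bigr => e _; apply: eq_bigr => f _.
  by rewrite mulrC.
rewrite !sw -!sumrB -big_split /=; apply: eq_bigr => e _.
rewrite -!sumrB -big_split /=; apply: eq_bigr => f _.
by rewrite -!scalerBr -scalerDr.
Qed.

Hypothesis Ju : forall x, O x -> 'J t x \in unitmx.

(** The curvature is pulled back in its two form indices and conjugated by [J] in the other two.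
    Taking the Ricci trace pairs one factor [J] with [invmx J], and the two remaining ones give the
    law of a bilinear form. *)
Lemma ricci_change x : O x ->
  ricci G x = 'J t x *m ricci G' (t x) *m ('J t x)^T.
Proof.
move=> Ox; apply/matrixP => a b; rewrite ricciE.
have [JJ Ju'] := (JE Ox, Ju Ox); rewrite JJ in Ju' *.
have E c : curv_mx (chris G) c a x =
    J x *m curv_mx B c a x *m invmx (J x).
  rewrite -[LHS](mulmxK Ju'); congr (_ *m _).
  apply: (curv_mx_gauge Oo Ox).
  - move=> k b' k'; rewrite (_ : (fun y => _) = fun y => G k' y k b').
      exact: smooth_on_diff (GO k' k b') Ox.
    by apply/funext => y; rewrite mxE.
  - by move=> k; exact: dB.
  - exact: dJ.
  - by move=> k; exact: ddJ.
  - apply/matrixP => i j; rewrite [LHS]mxE [RHS]mxE.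
    have H k : (fun y => partial_mx k J y i j) =
        partial k (partial i (fun y => t y 0 j)).
      by apply/funext => y; rewrite mxE Jd.
    have H2 := partialC c a Oo (smooth_on_partial i (tO j)) Ox.
    exact: (etrans (f_equal (fun F => partial c F x) (H a))
      (etrans H2 (esym (f_equal (fun F => partial a F x) (H c))))).
  - by move=> k y Oy; exact: gauge.
rewrite (eq_bigr (fun c => \sum_d \sum_e \sum_f \sum_k
    J x a f * J x b d * curv_mx (chris G') e f (t x) d k
    * (invmx (J x) k c * J x c e))); last first.
  move=> c _; rewrite E (curv_B _ _ Ox) mulmx_sumr mulmx_suml summxE.
  rewrite [RHS]exchange_big /=; apply: eq_bigr => e _.
  rewrite mulmx_sumr mulmx_suml summxE [RHS]exchange_big /=.
  apply: eq_bigr => f _; rewrite -scalemxAr -scalemxAl mxE [X in _ * X]mxE.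
  rewrite mulr_sumr exchange_big /=; apply: eq_bigr => k _.
  by rewrite [(J x *m _) _ _]mxE mulr_suml mulr_sumr; apply: eq_bigr => d _; ring.
have JJi e k : \sum_c invmx (J x) k c * J x c e = (k == e)%:R.
  by have /matrixP /(_ k e) := mulVmx Ju'; rewrite [LHS]mxE [RHS]mxE.
transitivity (\sum_d \sum_e \sum_f
    J x a f * J x b d * curv_mx (chris G') e f (t x) d e).
  rewrite exchange_big /=; apply: eq_bigr => d _.
  rewrite exchange_big /=; apply: eq_bigr => e _.
  rewrite exchange_big /=; apply: eq_bigr => f _.
  rewrite exchange_big /= -(sum_deltar (fun k =>
    J x a f * J x b d * curv_mx (chris G') e f (t x) d k)).
  by apply: eq_bigr => k _; rewrite -JJi mulr_sumr.
rewrite [RHS]mxE; apply: eq_bigr => d _; rewrite exchange_big /=.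
rewrite [(J x *m _) _ _]mxE mulr_suml; apply: eq_bigr => f _.
rewrite ricciE mulr_sumr mulr_suml; apply: eq_bigr => e _.
by rewrite [(J x)^T _ _]mxE; ring.
Qed.

End ChangeOfCoordinates.

End Curvature.

(** * Charts of the cotangent bundle *)

Section Charts.
Variables (R : realType) (n : nat) (M : atlas R n).
Hypothesis HM : is_manifold M.
Implicit Types (i j k : idx M) (x : 'rV[R]_n) (p : pt M).

Lemma chart_image_open i : open (chart_image i).
Proof.
have -> : chart_image i = overlap i i; last exact: overlap_open.
by apply/seteqP; split=> _ [p [ip jp] <-]; exists p.
Qed.

Lemma chart_imageP i x :
  chart_image i x <-> dom M i (param M i x) /\ coord M i (param M i x) = x.
Proof.
split=> [[p [ip _] <-]|[ip xE]]; first by rewrite (coordK HM).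
by exists (param M i x).
Qed.

Lemma overlapP i j x :
  overlap i j x <-> chart_image i x /\ dom M j (param M i x).
Proof.
split=> [[p [ip jp] <-]|[/chart_imageP [ip xE] jp]].
  by rewrite (coordK HM) //; split=> //; exists p.
by exists (param M i x).
Qed.

Lemma overlap_chart i j x : overlap i j x -> chart_image i x.
Proof. by case/overlapP. Qed.

Lemma chart_image_coord i p : dom M i p -> chart_image i (coord M i p).
Proof. by exists p. Qed.

Lemma overlap_coord i j p : dom M i p -> dom M j p -> overlap i j (coord M i p).
Proof. by exists p. Qed.

Lemma transition_coord i j p : dom M i p ->
  transition i j (coord M i p) = coord M j p.
Proof. by move=> ip; rewrite /transition /= (coordK HM). Qed.

Lemma overlap_transition i j x : overlap i j x -> overlap j i (transition i j x).
Proof.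
move=> /[dup] xij /overlapP [/chart_imageP [ip xE] jp].
by rewrite -[x]xE transition_coord //; exact: overlap_coord.
Qed.

Lemma transitionK i j x : overlap i j x -> transition j i (transition i j x) = x.
Proof.
move=> /[dup] xij /overlapP [/chart_imageP [ip xE] jp].
by rewrite -[X in transition i j X]xE !transition_coord.
Qed.

Lemma transition_diff i j x : overlap i j x -> differentiable (transition i j) x.
Proof. by move=> xij; exact: (smooth_map_diff (@transition_smooth _ _ _ HM i j) xij). Qed.

Lemma jacobian_transition_comp i j k x : overlap i j x -> overlap i k x ->
  'J (transition i k) x = 'J (transition i j) x *m 'J (transition j k) (transition i j x).
Proof.
move=> xij xik.
have xjk : overlap j k (transition i j x).
  move: xij xik => /overlapP [/chart_imageP [ip xE] jp] /overlapP [_ kp].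
  by rewrite -[x]xE transition_coord //; exact: overlap_coord.
have dij := transition_diff xij; have djk := transition_diff xjk.
rewrite -[RHS](jacobian_comp dij djk).
apply: (@eq_jacobian _ _ _ (overlap i j `&` overlap i k) _ _ _ _ _ _ _).2.
- by apply: openI; exact: (overlap_open HM).
- by [].
- move=> y [yij yik]; rewrite /= /transition /=.
  by case/overlapP: yij => _ jp; rewrite (coordK HM).
- exact: differentiable_comp.
Qed.

Lemma jacobian_transition_id i x : chart_image i x -> 'J (transition i i) x = 1%:M.
Proof.
move=> xi; rewrite -(jacobian_id x).
apply: (@eq_jacobian _ _ _ (chart_image i) _ _ _ _ _ _ _).2 => //.
- exact: chart_image_open.
- by move=> y /chart_imageP [_].
Qed.

Lemma jacobian_transitionK i j x : overlap i j x ->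
  'J (transition i j) x *m 'J (transition j i) (transition i j x) = 1%:M.
Proof.
move=> xij; have xi := overlap_chart xij.
rewrite -(jacobian_transition_id xi) -jacobian_transition_comp //.
by apply/overlapP; split=> //; case/chart_imageP: xi.
Qed.

Lemma jacobian_transition_unit i j x : overlap i j x ->
  'J (transition i j) x \in unitmx.
Proof. move=> xij; exact: (mulmx1_unit (jacobian_transitionK xij)).1. Qed.

Lemma jacobian_transitionV i j x : overlap i j x ->
  'J (transition j i) (transition i j x) = invmx ('J (transition i j) x).
Proof.
move=> xij; have Ju := jacobian_transition_unit xij.
by rewrite -[LHS](mulKmx Ju) jacobian_transitionK // mulmx1.
Qed.

(** [param] passes from chart [i] to the preferred chart and [covector_coord] from there to chart
    [j]; by the chain rule the preferred chart drops out. *)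
Lemma covector_coord_param i j (z : 'rV[R]_(n + n)) : overlap i j (lsubmx z) ->
  covector_coord j (param (cotangent M) i z) =
  rsubmx z *m (invmx ('J (transition i j) (lsubmx z)))^T.
Proof.
set x := lsubmx z => xij; rewrite /covector_coord /=.
set p := param M i x; set c := chart_at M p.
have [ip xE] := (chart_imageP i x).1 (overlap_chart xij).
have [_ jp] := (overlapP i j x).1 xij; have cp := chart_atP HM p.
rewrite -mulmxA -trmx_mul; congr (_ *m _^T).
rewrite -jacobian_transitionV // -[x]xE -/p !transition_coord //.
rewrite -(transition_coord c jp) -jacobian_transition_comp //.
  exact: overlap_coord.
exact: overlap_coord.
Qed.

Lemma cotangent_chart_image i z :
  chart_image (M := cotangent M) i z <-> chart_image i (lsubmx z).
Proof.
split=> [[[p al] [/= ip _] <-]|zi].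
  by rewrite row_mxKl; exact: chart_image_coord.
have [ip xE] := (chart_imageP i _).1 zi.
exists (param (cotangent M) i z); first by [].
rewrite [LHS]/= -[RHS]hsubmxK xE; congr row_mx.
have xii : overlap i i (lsubmx z) by apply/overlapP.
rewrite [LHS](covector_coord_param xii) jacobian_transition_id //.
by rewrite invmx1 trmx1 mulmx1.
Qed.

Lemma cotangent_overlap i j z :
  overlap (M := cotangent M) i j z <-> overlap i j (lsubmx z).
Proof.
split=> [[[p al] [/= ip jp] <-]|zij].
  by rewrite row_mxKl; exact: overlap_coord.
have zi := overlap_chart zij; have [_ jp] := (overlapP i j _).1 zij.
have [[p al] [/= ip _] zE] := (cotangent_chart_image i z).2 zi.
exists (p, al); last exact: zE.
split=> //=; move: jp; rewrite -zE row_mxKl (coordK HM) //.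
Qed.

Lemma cotangent_transition i j z : overlap i j (lsubmx z) ->
  transition (M := cotangent M) i j z = row_mx (transition i j (lsubmx z))
    (rsubmx z *m (invmx ('J (transition i j) (lsubmx z)))^T).
Proof. by move=> zij; rewrite -covector_coord_param. Qed.

End Charts.

(** * Block matrices of the metric and of the symplectic form *)

Section CotangentBlocks.
Variables (R : numFieldType) (n : nat).

Definition pw_mx (A : 'M[R]_n) : 'M[R]_(n + n) :=
  block_mx A (2^-1)%:M (2^-1)%:M 0.

Definition symp_mx (B : 'M[R]_n) : 'M[R]_(n + n) :=
  block_mx B (2^-1)%:M (- (2^-1)%:M) 0.

(** The congruence matrix has the shape of the Jacobian matrix of a change of canonical coordinates.
    The cross terms K J^T and J K^T, each with the factor 1/2, shift the horizontal block by - H. In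
    [symp_mx_change] they carry opposite signs and cancel. *)
Lemma pw_mx_change (J K A H : 'M[R]_n) : J \in unitmx -> H^T = H ->
  K *m J^T = - H ->
  block_mx J K 0 (invmx J)^T *m pw_mx A *m (block_mx J K 0 (invmx J)^T)^T =
  pw_mx (J *m A *m J^T - H).
Proof.
move=> Ju Hs KJ.
have JK : J *m K^T = - H by rewrite -[LHS]trmxK trmx_mul trmxK KJ linearN /= Hs.
have JI : J *m invmx J = 1%:M := mulmxV Ju.
have IJ : (invmx J)^T *m J^T = 1%:M by rewrite -trmx_mul JI trmx1.
rewrite /pw_mx tr_block_mx !mulmx_block !trmx0 trmxK.
rewrite !(mulmx0, mul0mx, addr0, add0r) !mul_mx_scalar -!scalemxAl.
rewrite mulmxDl -scalemxAl KJ JK JI IJ -addrA -scalerDr -opprD -mulr2n scalerN.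
rewrite -[H *+ 2]scaler_nat scalerA mulVf ?pnatr_eq0 // scale1r.
by rewrite !scalemx1.
Qed.

Lemma symp_mx_change (J K B H : 'M[R]_n) : J \in unitmx -> H^T = H ->
  K *m J^T = - H ->
  block_mx J K 0 (invmx J)^T *m symp_mx B *m (block_mx J K 0 (invmx J)^T)^T =
  symp_mx (J *m B *m J^T).
Proof.
move=> Ju Hs KJ.
have JK : J *m K^T = - H by rewrite -[LHS]trmxK trmx_mul trmxK KJ linearN /= Hs.
have JI : J *m invmx J = 1%:M := mulmxV Ju.
have IJ : (invmx J)^T *m J^T = 1%:M by rewrite -trmx_mul JI trmx1.
rewrite /symp_mx tr_block_mx !mulmx_block !trmx0 trmxK.
rewrite !(mulmx0, mul0mx, addr0, add0r, mulmxN, mulNmx) !mul_mx_scalar.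
rewrite mulmxBl -!scalemxAl KJ JK JI IJ addrAC -addrA subrr addr0.
by rewrite !scalemx1.
Qed.

Lemma pw_mx_mulV A : pw_mx A *m block_mx 0 2%:M 2%:M (- 4 *: A) = 1%:M.
Proof.
rewrite mulmx_block !(mulmx0, mul0mx, addr0, add0r) -!scalar_mxM.
rewrite mul_mx_scalar mul_scalar_mx [RHS]scalar_mx_block.
have h : 2^-1 * 2 = 1 :> R by rewrite mulVf ?pnatr_eq0.
by rewrite h; congr block_mx; apply/matrixP => i j; rewrite !mxE; field.
Qed.

Lemma symp_mx_mulV B : symp_mx B *m block_mx 0 (- 2%:M) 2%:M (4 *: B) = 1%:M.
Proof.
rewrite mulmx_block !(mulmx0, mul0mx, addr0, add0r, mulNmx, mulmxN, opprK).
rewrite -!scalar_mxM mul_mx_scalar mul_scalar_mx [RHS]scalar_mx_block.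
have h : 2^-1 * 2 = 1 :> R by rewrite mulVf ?pnatr_eq0.
by rewrite h; congr block_mx; apply/matrixP => i j; rewrite !mxE; field.
Qed.

Lemma pw_mx_unit A : pw_mx A \in unitmx.
Proof. exact: (mulmx1_unit (pw_mx_mulV A)).1. Qed.

Lemma symp_mx_unit B : symp_mx B \in unitmx.
Proof. exact: (mulmx1_unit (symp_mx_mulV B)).1. Qed.

Lemma pw_mx_inv A : invmx (pw_mx A) = block_mx 0 2%:M 2%:M (- 4 *: A).
Proof. by rewrite -[RHS](mulKmx (pw_mx_unit A)) pw_mx_mulV mulmx1. Qed.

Lemma tr_pw_mx A : A^T = A -> (pw_mx A)^T = pw_mx A.
Proof. by move=> As; rewrite /pw_mx tr_block_mx As trmx0 !tr_scalar_mx. Qed.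

Lemma tr_symp_mx B : B^T = - B -> (symp_mx B)^T = - symp_mx B.
Proof.
move=> Bs; rewrite /symp_mx tr_block_mx opp_block_mx Bs trmx0 oppr0 opprK.
by rewrite linearN /= !tr_scalar_mx.
Qed.

Lemma pw_symp_involution A B : exists2 I : 'M[R]_(n + n),
  symp_mx B = pw_mx A *m I & I *m I = 1%:M.
Proof.
(* The only candidate is the inverse of the metric times the symplectic form. It is block triangular
   with diagonal blocks -1 and 1, so the off-diagonal block of its square cancels whatever [A] and
   [B] are. *)
exists (block_mx (- 1%:M) 0 (2 *: (A + B)) 1%:M).
  rewrite /pw_mx /symp_mx mulmx_block.
  rewrite !(mulmx0, mul0mx, addr0, add0r, mulmx1, mulmxN) mul_scalar_mx.
  by congr block_mx; apply/matrixP => i j; rewrite !mxE; field.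
rewrite mulmx_block !(mulmx0, mul0mx, addr0, add0r, mulmx1, mul1mx, mulmxN).
by rewrite ?mulNmx ?mulmx1 ?opprK addNr -scalar_mx_block.
Qed.

(** For s = 1 and s = -1, the vectors (v, (s - A) v) have square s |v|^2, and the two families are
    orthogonal to each other; they are the rows of the matrix. *)
Lemma pw_mx_signature A : A^T = A ->
  block_mx 1%:M (1%:M - A) 1%:M (- 1%:M - A) *m pw_mx A
    *m (block_mx 1%:M (1%:M - A) 1%:M (- 1%:M - A))^T =
  block_mx 1%:M 0 0 (- 1%:M) :> 'M[R]_(n + n).
Proof.
move=> As; have T (c : 'M[R]_n) : c^T = c -> (c - A)^T = c - A.
  by move=> cs; rewrite raddfB /= cs As.
have N1 : (- 1%:M : 'M[R]_n)^T = - 1%:M by rewrite raddfN /= trmx1.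
rewrite /pw_mx tr_block_mx trmx1 (T _ (trmx1 _ _)) (T _ N1) !mulmx_block.
rewrite !(mulmx0, addr0, mulmx1, mul1mx, mul_mx_scalar, mul_scalar_mx).
by congr block_mx; apply/matrixP => i j; rewrite !mxE; field.
Qed.

End CotangentBlocks.

(** * Jacobian matrices of changes of canonical coordinates *)

Section CotangentJacobian.
Variables (R : realType) (n : nat) (O : set 'rV[R]_n) (t : 'rV[R]_n -> 'rV[R]_n).
Hypotheses (Oo : open O) (tO : smooth_map_on O t).
Hypothesis Ju : forall x, O x -> 'J t x \in unitmx.
Implicit Type z : 'rV[R]_(n + n).

Definition cotangent_lift z : 'rV[R]_(n + n) :=
  row_mx (t (lsubmx z)) (rsubmx z *m (invmx ('J t (lsubmx z)))^T).

Lemma cotangent_liftl z l : cotangent_lift z 0 (lshift n l) = t (lsubmx z) 0 l.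
Proof. by rewrite row_mxEl. Qed.

Lemma cotangent_liftlE l :
  (fun z => cotangent_lift z 0 (lshift n l)) = fun z => t (lsubmx z) 0 l.
Proof. by apply/funext => z; exact: cotangent_liftl. Qed.

Lemma cotangent_liftr z l : cotangent_lift z 0 (rshift n l) =
  \sum_m z 0 (rshift n m) * invmx ('J t (lsubmx z)) l m.
Proof.
rewrite row_mxEr mxE; apply: eq_bigr => m _.
by rewrite mxE [(invmx _)^T _ _]mxE.
Qed.

Let invJ_smooth l m : smooth_on O (fun x => invmx ('J t x) l m).
Proof.
by apply: smooth_on_invmx => // a b; exact: smooth_on_jacobian.
Qed.

Lemma smooth_cotangent_lift : smooth_map_on (lsub_set (n:=n) O) cotangent_lift.
Proof.
have oO := open_lsub_set (n:=n) Oo.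
move=> k; case: (split_ordP k) => l ->.
  rewrite (_ : (fun z => _) = fun z => t (lsubmx z) 0 l).
    exact: (smooth_on_lsubmx (n:=n) Oo (tO l)).
  by apply/funext => z; exact: cotangent_liftl.
rewrite (_ : (fun z => _) = fun z => \sum_m z 0 (rshift n m) *
    (fun x => invmx ('J t x) l m) (lsubmx z)).
  apply: smooth_on_sum => // m; apply: smooth_onM => //.
    exact: smooth_on_coord.
  exact: (smooth_on_lsubmx (n:=n) Oo (invJ_smooth l m)).
by apply/funext => z; exact: cotangent_liftr.
Qed.

Lemma partial_rshift m a z :
  partial (rshift n a) (fun y : 'rV[R]_(n + n) => y 0 (rshift n m)) z
    = (a == m)%:R.
Proof. by rewrite partial_coord eq_rshift. Qed.

Lemma partial_lrshift m a z :
  partial (lshift n a) (fun y : 'rV[R]_(n + n) => y 0 (rshift n m)) z = 0.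
Proof. by rewrite partial_coord eq_lrshift. Qed.

(** The derivative of the inverse Jacobian matrix is never computed. The old fibre coordinate is the
    new one multiplied by the Jacobian matrix of [t], and it does not vary with the base
    coordinates; differentiating this identity expresses [K *m J^T] by the second derivatives of
    [t]. *)
Lemma cotangent_jacobian z : O (lsubmx z) ->
  exists2 K : 'M[R]_n,
    'J cotangent_lift z = block_mx ('J t (lsubmx z)) K 0
                                   (invmx ('J t (lsubmx z)))^T &
    K *m ('J t (lsubmx z))^T = - (\matrix_(a, k)
      \sum_l cotangent_lift z 0 (rshift n l) *
             partial a (partial k (fun y => t y 0 l)) (lsubmx z)).
Proof.
move=> Oz; have oO := open_lsub_set (n:=n) Oo.
have dF := smooth_map_diff smooth_cotangent_lift Oz.
have dt := smooth_map_diff tO Oz.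
have dtl l := smooth_on_diff (tO l) Oz.
have dzr m : differentiable (fun y : 'rV[R]_(n + n) => y 0 (rshift n m)) z.
  exact: differentiable_coord.
have dN l m := smooth_on_diff (invJ_smooth l m) Oz.
exists (\matrix_(a, l)
  partial (lshift n a) (fun y => cotangent_lift y 0 (rshift n l)) z).
  apply/matrixP => k l; rewrite [LHS](jacobianE k l dF).
  case: (split_ordP k) => a ->; case: (split_ordP l) => b ->.
  - rewrite [RHS]block_mxEul [RHS](jacobianE a b dt).
    rewrite -(partial_lsubmxl (n:=n) a (dtl b)).
    by rewrite cotangent_liftlE.
  - by rewrite [RHS]block_mxEur mxE.
  - rewrite [RHS]block_mxEdl mxE -(partial_lsubmxr (n:=n) a (dtl b)).
    by rewrite cotangent_liftlE.
  rewrite [RHS]block_mxEdr [RHS]mxE.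
  rewrite (_ : (fun y => _) = fun y : 'rV[R]_(n + n) => \sum_m y 0 (rshift n m) *
    (fun x => invmx ('J t x) b m) (lsubmx y)).
    rewrite partial_sum => [|m _]; last first.
      by apply: differentiableM; [exact: dzr|exact: (differentiable_lsub_comp (n:=n) (dN b m))].
    rewrite -[RHS](sum_deltal' (fun m => invmx ('J t (lsubmx z)) b m)).
    apply: eq_bigr => m _; rewrite partialM;
      [|exact: dzr|exact: (differentiable_lsub_comp (n:=n) (dN b m))].
    by rewrite partial_rshift (partial_lsubmxr (n:=n) a (dN b m)) mulr0 addr0.
  by apply/funext => y; exact: cotangent_liftr.
apply/matrixP => a k; rewrite mxE [RHS]mxE [X in _ = - X]mxE.
apply/eqP; rewrite -addr_eq0; apply/eqP.
pose f l (y : 'rV[R]_(n + n)) := cotangent_lift y 0 (rshift n l)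
    * partial k (fun y => t y 0 l) (lsubmx y).
have dtk l : differentiable (partial k (fun y => t y 0 l)) (lsubmx z).
  exact: smooth_on_diff (smooth_on_partial k (tO l)) Oz.
have dFr l : differentiable (fun y => cotangent_lift y 0 (rshift n l)) z.
  exact: smooth_on_diff (smooth_cotangent_lift (rshift n l)) Oz.
have E : partial (lshift n a) (fun y => \sum_l f l y) z = 0.
  rewrite -[RHS](partial_lrshift k a z); apply: (eq_partial _ oO Oz) => y Oy.
  transitivity ((cotangent_lift y *m col_mx 0 ('J t (lsubmx y))^T) 0 k).
    rewrite [RHS]mxE big_split_ord /= [X in _ = X + _]big1 ?add0r => [|l _]; last first.
      by rewrite col_mxEu [X in _ * X]mxE mulr0.
    apply: eq_bigr => l _; rewrite col_mxEd /f; congr (_ * _).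
    by rewrite [RHS]mxE [RHS](jacobianE k l (smooth_map_diff tO Oy)).
  rewrite mul_row_col mulmx0 add0r -mulmxA -trmx_mul.
  have JI : 'J t (lsubmx y) *m invmx ('J t (lsubmx y)) = 1%:M.
    exact: (mulmxV (Ju Oy)).
  by rewrite JI trmx1 mulmx1 mxE.
rewrite -[RHS]E partial_sum => [|l _]; last first.
  by apply: differentiableM; [exact: dFr|exact: (differentiable_lsub_comp (n:=n) (dtk l))].
rewrite -big_split /=; apply: eq_bigr => l _.
rewrite [RHS]partialM; [|exact: dFr|exact: (differentiable_lsub_comp (n:=n) (dtk l))].
apply: f_equal2.
  rewrite mxE; apply: f_equal2; first by [].
  by rewrite [LHS]mxE [LHS](jacobianE k l dt).
by rewrite (partial_lsubmxl (n:=n) a (dtk l)).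
Qed.

Lemma cotangent_hessian_sym z : O (lsubmx z) ->
  let H := \matrix_(a, k) \sum_l cotangent_lift z 0 (rshift n l) *
             partial a (partial k (fun y => t y 0 l)) (lsubmx z) in H^T = H.
Proof.
move=> Oz H; apply/matrixP => a k; rewrite mxE mxE [RHS]mxE.
by apply: eq_bigr => l _; rewrite (partialC k a Oo (tO l) Oz).
Qed.

End CotangentJacobian.

(** * The metric and the symplectic form in canonical coordinates *)

Section Schouten.
Variables (R : realType) (n : nat).
Implicit Types (g r b J : 'M[R]_n).

Lemma sym_mxE b k l : sym_mx b k l = 2^-1 * (b k l + b l k).
Proof. by rewrite !mxE. Qed.

Lemma alt_mxE b k l : alt_mx b k l = 2^-1 * (b k l - b l k).
Proof. by rewrite !mxE. Qed.

Lemma tr_alt_mx b : (alt_mx b)^T = - alt_mx b.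
Proof. by apply/matrixP => k l; rewrite mxE [RHS]mxE !alt_mxE -mulrN opprB. Qed.

Lemma sym_mx_change J b : sym_mx (J *m b *m J^T) = J *m sym_mx b *m J^T.
Proof.
rewrite /sym_mx !trmx_mul trmxK mulmxA -mulmxDl -mulmxDr.
by rewrite -scalemxAr -scalemxAl.
Qed.

Lemma alt_mx_change J b : alt_mx (J *m b *m J^T) = J *m alt_mx b *m J^T.
Proof.
rewrite /alt_mx !trmx_mul trmxK mulmxA -mulmxBl -mulmxBr.
by rewrite -scalemxAr -scalemxAl.
Qed.

Lemma invmx_change J g : J \in unitmx -> g \in unitmx ->
  invmx (J *m g *m J^T) = (invmx J)^T *m invmx g *m invmx J.
Proof.
move=> Ju gu; have u : J *m g *m J^T \in unitmx.
  by rewrite !unitmx_mul unitmx_tr Ju gu.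
have E : J *m g *m J^T *m ((invmx J)^T *m invmx g *m invmx J) = 1%:M.
  rewrite !mulmxA -(mulmxA _ J^T) -trmx_mul mulVmx // trmx1 mulmx1.
  by rewrite mulmxK // mulmxV.
by rewrite -[RHS](mulKmx u) E mulmx1.
Qed.

Lemma metric_trace_change J g r : J \in unitmx -> g \in unitmx ->
  metric_trace (J *m g *m J^T) (J *m r *m J^T) = metric_trace g r.
Proof.
move=> Ju gu; rewrite !metric_traceE invmx_change // !trmx_mul trmxK.
rewrite -!mulmxA (mulmxA (invmx J) J) mulVmx // mul1mx mxtrace_mulC -!mulmxA.
have -> : J^T *m (invmx J)^T = 1%:M by rewrite -trmx_mul mulVmx // trmx1.
by rewrite mulmx1.
Qed.

Lemma schouten_mx_change J g r : J \in unitmx -> g \in unitmx ->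
  schouten_mx (J *m g *m J^T) (J *m r *m J^T) = J *m schouten_mx g r *m J^T.
Proof.
move=> Ju gu; rewrite /schouten_mx /sym0_mx metric_trace_change //.
rewrite sym_mx_change alt_mx_change.
have fD X Y : J *m (X + Y) *m J^T = J *m X *m J^T + J *m Y *m J^T.
  by rewrite mulmxDr mulmxDl.
have fN X : J *m (- X) *m J^T = - (J *m X *m J^T) by rewrite mulmxN mulNmx.
have fZ c X : J *m (c *: X) *m J^T = c *: (J *m X *m J^T).
  by rewrite -scalemxAr -scalemxAl.
by rewrite !(fD, fN, fZ).
Qed.

Lemma alt_schouten_mx g r : g^T = g ->
  alt_mx (schouten_mx g r) = n%:R^-1 *: alt_mx r.
Proof.
move=> gs; have gkl k l : g l k = g k l by rewrite -{1}gs mxE.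
apply/matrixP => k l.
rewrite alt_mxE /schouten_mx /sym0_mx.
rewrite !(mxE, sym_mxE, alt_mxE) (gkl k l).
set A := (n%:R - 2)^-1; set B := n%:R^-1; set C := (_ * _)^-1.
by field.
Qed.

(** Symmetrising turns (n-1) P - P^T into (n-2) Sym P, and the trace only sees Sym P. So the
    symmetric part of the Ricci tensor and Sym P satisfy an equation of their own. *)
Lemma sym_schouten_mx g r k l : (3 <= n)%N -> g^T = g -> g \in unitmx ->
  2^-1 * (r k l + r l k) = (n%:R - 2) * sym_mx (schouten_mx g r) k l
    + metric_trace g (sym_mx (schouten_mx g r)) * g k l.
Proof.
move=> n3 gs gu; have := (schouten_mxP r (schouten_mx g r) n3 gs gu).2 erefl.
move: (schouten_mx g r) => P rE.
have gkl : g l k = g k l by rewrite -{1}gs mxE.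
have -> : metric_trace g (sym_mx P) = metric_trace g P.
  have trD b c : metric_trace g (b + c) = metric_trace g b + metric_trace g c.
    by rewrite !metric_traceE linearD mulmxDr mxtraceD.
  have trZ a b : metric_trace g (a *: b) = a * metric_trace g b.
    by rewrite !metric_traceE linearZ /= -scalemxAr mxtraceZ.
  by rewrite /sym_mx trZ trD metric_trace_tr //; field.
rewrite rE sym_mxE !mxE gkl; move: (metric_trace g P) (P k l) (P l k) => T X Y.
by field.
Qed.

End Schouten.

Section WeylBlocks.
Variables (R : realType) (n : nat) (M : atlas R n).
Hypothesis HM : is_manifold M.
Implicit Types (i j : idx M) (z : 'rV[R]_(n + n)).

Lemma cotangent_transition_jacobian i j z : overlap i j (lsubmx z) ->
  'J (transition (M := cotangent M) i j) z = 'J (cotangent_lift (transition i j)) z.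
Proof.
move=> zij; have oO := open_lsub_set (n:=n) (@overlap_open _ _ _ HM i j).
apply: (@eq_jacobian _ _ _ _ _ _ _ oO zij _ _).2.
- by move=> y yij; rewrite (cotangent_transition HM).
- apply: (smooth_map_diff (A := lsub_set (n:=n) (overlap i j)) _ zij).
  apply: smooth_cotangent_lift.
  + exact: overlap_open.
  + exact: transition_smooth.
  + by move=> x; exact: jacobian_transition_unit.
Qed.

Lemma jacobian_proj i j z : overlap i j (lsubmx z) ->
  'J (local_map (@cotangent_proj _ _ M) i j) z =
  col_mx ('J (transition i j) (lsubmx z)) 0.
Proof.
move=> zij; have dt := transition_diff HM zij.
have := jacobian_comp (differentiable_lsub z) dt.
by rewrite jacobian_lsubmx mul_col_mx mul1mx mul0mx.
Qed.

Lemma chart_at_overlap i z : chart_image i (lsubmx z) ->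
  overlap i (chart_at M (param M i (lsubmx z))) (lsubmx z).
Proof. by move=> zi; apply/(overlapP HM); split=> //; exact: (chart_atP HM). Qed.

Lemma tautologicalE i z : chart_image i (lsubmx z) ->
  tautological (M := M) i z = row_mx (rsubmx z) 0.
Proof.
move=> zi; have zc := chart_at_overlap zi.
rewrite /tautological (covector_coord_param HM zc) (jacobian_proj zc).
rewrite tr_col_mx trmx0 mul_mx_row mulmx0 -mulmxA -trmx_mul.
by rewrite (mulmxV (jacobian_transition_unit HM zc)) trmx1 mulmx1.
Qed.

(** The half of [is_tensor2] that makes a pullback, defined through preferred charts, computable in
    any chart. *)
Definition tensor_law (b : tensor2 M) : Prop := forall i j x, overlap i j x ->
  b i x = 'J (transition i j) x *m b j (transition i j x)
          *m ('J (transition i j) x)^T.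

Lemma pullback_projE (b : tensor2 M) i z : tensor_law b ->
  chart_image i (lsubmx z) ->
  pullback (@cotangent_proj _ _ M) b i z = block_mx (b i (lsubmx z)) 0 0 0.
Proof.
move=> bt zi; have zc := chart_at_overlap zi.
rewrite /pullback (jacobian_proj zc) (bt _ _ _ zc).
rewrite mul_col_mx mul0mx tr_col_mx trmx0 mul_col_row mulmx0 mul0mx.
by rewrite mulmx0.
Qed.

Lemma covector_sqnormE (g : tensor2 M) i z : is_metric g ->
  chart_image i (lsubmx z) ->
  covector_sqnorm g (param (cotangent M) i z) =
  bilin (invmx (g i (lsubmx z))) (rsubmx z) (rsubmx z).
Proof.
move=> [[_ gt] gm] zi; have zc := chart_at_overlap zi.
rewrite /covector_sqnorm (covector_coord_param HM zc) (gt _ _ _ zc).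
rewrite invmx_change; last 2 first.
- exact: (jacobian_transition_unit HM zc).
- apply: (gm _ _ _).2; apply: (overlap_chart HM).
  exact: (overlap_transition HM zc).
by rewrite /bilin trmx_mul trmxK !mulmxA.
Qed.

Definition christoffel_mx (D : connection M) i z : 'M[R]_n :=
  \matrix_(a, b) \sum_k D i k (lsubmx z) a b * z 0 (rshift n k).

Lemma patterson_walkerE (D : connection M) i z :
  (christoffel_mx D i z)^T = christoffel_mx D i z ->
  patterson_walker D i z = pw_mx (- christoffel_mx D i z).
Proof.
move=> Cs.
(* [V] is the sum before symmetrisation; symmetrising splits its identity block into the two
   off-diagonal blocks 1/2 of [pw_mx]. *)
pose V : 'M[R]_(n + n) := block_mx (- christoffel_mx D i z) 0 1%:M 0.
have dxl a b : dx R a 0 (lshift n b) = (b == a)%:R :> R.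
  by rewrite mxE eqxx eq_lshift.
have dxr a b : dx R a 0 (rshift n b) = 0 :> R.
  by rewrite mxE eqxx eq_rlshift.
have dxil a b : dxi R a 0 (lshift n b) = 0 :> R.
  by rewrite mxE eqxx eq_lrshift.
have dxir a b : dxi R a 0 (rshift n b) = (b == a)%:R :> R.
  by rewrite mxE eqxx eq_rshift.
have VE : \sum_a tensor_mx (dxi R a - \sum_b (\sum_k D i k (lsubmx z) a b
    * rsubmx z 0 k) *: dx R b) (dx R a) = V.
  apply/matrixP => k l; rewrite summxE.
  under eq_bigr => a _ do rewrite mxE big_ord1 mxE.
  case: (split_ordP l) => b ->; last first.
    rewrite big1 => [|a _]; last by rewrite dxr mulr0.
    by case: (split_ordP k) => c ->; rewrite ?block_mxEur ?block_mxEdr mxE.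
  under eq_bigr => a _ do rewrite dxl.
  rewrite sum_deltar' mxE [X in _ + X]mxE summxE.
  case: (split_ordP k) => c ->.
    rewrite dxil add0r block_mxEul [RHS]mxE -Cs [(_^T) _ _]mxE [in RHS]mxE; congr (- _).
    under eq_bigr => a _ do rewrite mxE dxl mulrC.
    rewrite sum_deltal'; apply: eq_bigr => m _; by rewrite mxE.
  rewrite dxir block_mxEdl mxE big1 ?subr0 ?mxE // => a _.
  by rewrite mxE dxr mulr0.
rewrite /patterson_walker (_ : \sum_a _ = sym_mx V).
  rewrite /sym_mx /V tr_block_mx add_block_mx scale_block_mx !trmx0 trmx1.
  rewrite !(addr0, add0r, scaler0) raddfN /= Cs scalemx1.
  have h2 (X : 'M[R]_n) : 2^-1 *: (X + X) = X.
    by rewrite -mulr2n -(scaler_nat 2 X) scalerA mulVf ?pnatr_eq0 // scale1r.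
  by rewrite h2.
rewrite -VE /sym_mx raddf_sum -big_split /= scaler_sumr.
by [].
Qed.

Definition weyl_block (g : tensor2 M) (D : connection M) i z : 'M[R]_n :=
  - christoffel_mx D i z - sym_mx (schouten g D i (lsubmx z))
  - (rsubmx z)^T *m rsubmx z
  + (2^-1 * bilin (invmx (g i (lsubmx z))) (rsubmx z) (rsubmx z))
    *: g i (lsubmx z).

Lemma weyl_metricE (g : tensor2 M) (D : connection M) i z :
  is_metric g -> tensor_law (schouten g D) ->
  (christoffel_mx D i z)^T = christoffel_mx D i z ->
  chart_image i (lsubmx z) ->
  weyl_metric g D i z = pw_mx (weyl_block g D i z).
Proof.
move=> gm st Cs zi.
have Sst : tensor_law (Sym (schouten g D)).
  by move=> k j x xkj; rewrite /Sym (st k j x xkj) sym_mx_change.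
have [[_ gt] _] := gm.
rewrite /weyl_metric (covector_sqnormE gm zi) (tautologicalE zi).
rewrite (pullback_projE Sst zi) (pullback_projE gt zi) patterson_walkerE //.
rewrite /tensor_mx tr_row_mx trmx0 mul_col_row !(mulmx0, mul0mx).
rewrite scale_block_mx !scaler0 !opp_block_mx !add_block_mx !(oppr0, addr0).
by [].
Qed.

Lemma weyl_symplecticE (g : tensor2 M) (D : connection M) i z :
  tensor_law (schouten g D) -> chart_image i (lsubmx z) ->
  weyl_symplectic g D i z = symp_mx (alt_mx (schouten g D i (lsubmx z))).
Proof.
move=> st zi.
have Ast : tensor_law (Alt (schouten g D)).
  by move=> k j x xkj; rewrite /Alt (st k j x xkj) alt_mx_change.
rewrite /weyl_symplectic (pullback_projE Ast zi).
have oO := open_lsub_set (n:=n) (chart_image_open HM (i:=i)).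
have tE l y : chart_image i (lsubmx y) -> tautological (M := M) i y 0 (lshift n l)
    = y 0 (rshift n l).
  by move=> yi; rewrite tautologicalE // row_mxEl mxE.
have tE' l y : chart_image i (lsubmx y) -> tautological (M := M) i y 0 (rshift n l)
    = 0.
  by move=> yi; rewrite tautologicalE // row_mxEr mxE.
have pl k l : partial k (fun y => tautological (M := M) i y 0 (lshift n l)) z
    = (k == rshift n l)%:R.
  rewrite -(partial_coord _ _ z); apply: (eq_partial _ oO zi) => y yi.
  exact: tE.
have pr k l : partial k (fun y => tautological (M := M) i y 0 (rshift n l)) z = 0.
  by rewrite -(partial_cst k 0 z); apply: (eq_partial _ oO zi) => y /tE'.
apply/matrixP => k l; rewrite mxE [X in X + _]mxE [(ext_d _ _ _) _ _]mxE.
case: (split_ordP k) => a ->; case: (split_ordP l) => b ->; rewrite ?pl ?pr.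
- by rewrite !block_mxEul !eq_lrshift subrr mulr0 oppr0 add0r.
- rewrite !block_mxEur sub0r eq_rshift !mxE addr0 mulrN opprK eq_sym.
  by rewrite mulr_natr.
- rewrite !block_mxEdl subr0 eq_rshift !mxE addr0.
  by rewrite mulr_natr.
- by rewrite !block_mxEdr subrr mulr0 oppr0 add0r.
Qed.

End WeylBlocks.

(** * Tensoriality, signature and the symplectic form *)

Section WeylTensors.
Variables (R : realType) (n : nat) (M : atlas R n).
Hypothesis HM : is_manifold M.
Variables (g : tensor2 M) (D : connection M).
Hypotheses (gm : is_metric g) (WD : weyl_connection g D).
Implicit Types (i j : idx M) (z : 'rV[R]_(n + n)) (x : 'rV[R]_n).

Let Do i : open (chart_image (M := M) i) := chart_image_open HM (i:=i).
Let D_smooth i k a b : smooth_on (chart_image i) (fun x => D i k x a b).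
Proof. by have [[DS _] _ _] := WD; exact: DS. Qed.

Lemma weyl_christoffel_sym i x : chart_image i x ->
  forall k a b, D i k x a b = D i k x b a.
Proof.
have [_ tf _] := WD => xi k a b; apply/eqP; rewrite -subr_eq0 -torsionE.
by rewrite (tf i x xi a b) mxE.
Qed.

Lemma Ric_law : tensor_law (Ric D).
Proof.
have [[_ DL] _ _] := WD => i j x xij; apply: (ricci_change (O := overlap i j)).
- exact: overlap_open.
- exact: transition_smooth.
- move=> k a b; apply: (smooth_on_sub (A := chart_image i)) => //.
  by move=> y; exact: (overlap_chart HM).
- move=> k a b y yij; apply: (smooth_on_diff (A := chart_image j)) => //.
  exact: (overlap_chart HM (overlap_transition HM yij)).
- by move=> y; exact: DL.
- by move=> y yij; exact: (jacobian_transition_unit HM yij).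
- by [].
Qed.

Lemma metric_unit i x : chart_image i x -> g i x \in unitmx.
Proof. by move=> xi; exact: (gm.2 i x xi).2. Qed.

Lemma metric_tr i x : chart_image i x -> (g i x)^T = g i x.
Proof. by move=> xi; exact: (gm.2 i x xi).1. Qed.

Lemma metric_smooth i a b : smooth_on (chart_image i) (fun x => g i x a b).
Proof. exact: gm.1.1. Qed.

Lemma schouten_law : tensor_law (schouten g D).
Proof.
move=> i j x xij; rewrite /schouten (Ric_law xij) (gm.1.2 i j x xij).
apply: schouten_mx_change; first exact: (jacobian_transition_unit HM xij).
exact: (metric_unit (overlap_chart HM (overlap_transition HM xij))).
Qed.

Lemma Ric_smooth i a b : smooth_on (chart_image i) (fun x => Ric D i x a b).
Proof.
rewrite (_ : (fun x => _) = fun x =>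
  \sum_c partial c (fun y => D i c y a b) x
  - \sum_c partial a (fun y => D i c y c b) x
  + \sum_d (\sum_c D i c x c d) * D i d x a b
  - \sum_c \sum_d D i d x a c * D i c x d b); last first.
  by apply/funext => x; exact: ricciE'.
apply: smooth_onB => //; first apply: smooth_onD => //; first apply: smooth_onB => //.
- by apply: smooth_on_sum => // c; exact: smooth_on_partial.
- by apply: smooth_on_sum => // c; exact: smooth_on_partial.
- apply: smooth_on_sum => // d; apply: smooth_onM => //.
  by apply: smooth_on_sum => // c.
- apply: smooth_on_sum => // c; apply: smooth_on_sum => // d.
  exact: smooth_onM.
Qed.

Lemma metric_inv_smooth i a b :
  smooth_on (chart_image i) (fun x => invmx (g i x) a b).
Proof.
apply: smooth_on_invmx => //; first by move=> x; exact: metric_unit.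
exact: metric_smooth.
Qed.

Lemma schouten_mxE (G r : 'M[R]_n) k l : schouten_mx G r k l =
  (n%:R - 2)^-1 * (2^-1 * (r k l + r l k) - n%:R^-1 * metric_trace G r * G k l)
  + n%:R^-1 * (2^-1 * (r k l - r l k))
  + (2 * n%:R * (n%:R - 1))^-1 * metric_trace G r * G k l.
Proof. by rewrite !mxE. Qed.

Lemma schouten_smooth i a b :
  smooth_on (chart_image i) (fun x => schouten g D i x a b).
Proof.
have trS : smooth_on (chart_image i) (fun x => metric_trace (g i x) (Ric D i x)).
  apply: smooth_on_sum => // k; apply: smooth_on_sum => // l.
  by apply: smooth_onM => //; [exact: metric_inv_smooth|exact: Ric_smooth].
rewrite (_ : (fun x => _) = fun x =>
  (n%:R - 2)^-1 * (2^-1 * (Ric D i x a b + Ric D i x b a)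
    - n%:R^-1 * metric_trace (g i x) (Ric D i x) * g i x a b)
  + n%:R^-1 * (2^-1 * (Ric D i x a b - Ric D i x b a))
  + (2 * n%:R * (n%:R - 1))^-1 * metric_trace (g i x) (Ric D i x) * g i x a b);
  last by apply/funext => x; exact: schouten_mxE.
have cS c f : smooth_on (chart_image i) f -> smooth_on (chart_image i) (fun x => c * f x).
  by move=> fS; apply: smooth_onM => //; exact: smooth_on_cst.
have tg c : smooth_on (chart_image i)
    (fun x => c * metric_trace (g i x) (Ric D i x) * g i x a b).
  by apply: smooth_onM => //; [exact: (cS)|exact: metric_smooth].
apply: smooth_onD => //; apply: smooth_onD => //.
  apply: (cS); apply: smooth_onB => //; apply: (cS).
  by apply: smooth_onD => //; exact: Ric_smooth.
by do 2 apply: (cS); apply: smooth_onB => //; exact: Ric_smooth.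
Qed.

Let oO i : open (lsub_set (n:=n) (chart_image (M := M) i)) :=
  open_lsub_set (n:=n) (chart_image_open HM (i:=i)).

Lemma weyl_christoffel_mx_tr i z : chart_image i (lsubmx z) ->
  (christoffel_mx D i z)^T = christoffel_mx D i z.
Proof.
move=> zi; apply/matrixP => a b; rewrite mxE mxE [RHS]mxE.
by apply: eq_bigr => k _; rewrite (weyl_christoffel_sym zi).
Qed.

Lemma weyl_blockE i z a b : weyl_block g D i z a b =
  - (\sum_k D i k (lsubmx z) a b * z 0 (rshift n k))
  - sym_mx (schouten g D i (lsubmx z)) a b
  - z 0 (rshift n a) * z 0 (rshift n b)
  + 2^-1 * (\sum_c (\sum_d z 0 (rshift n d) * invmx (g i (lsubmx z)) d c)
            * z 0 (rshift n c)) * g i (lsubmx z) a b.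
Proof.
have e (A B C G : 'M[R]_n) c :
    (- A - B - C + c *: G) a b = - A a b - B a b - C a b + c * G a b.
  by rewrite !mxE.
rewrite [LHS]e; congr (_ - _ - _ + _ * _).
- by rewrite mxE.
- by rewrite mxE big_ord1 !mxE.
congr (_ * _); rewrite [LHS]mxE; apply: eq_bigr => c _.
rewrite [(_^T) _ _]mxE [rsubmx z _ _]mxE; congr (_ * _).
by rewrite mxE; apply: eq_bigr => d _; rewrite [rsubmx z _ _]mxE.
Qed.

Lemma weyl_block_smooth i a b :
  smooth_on (lsub_set (n:=n) (chart_image i)) (fun z => weyl_block g D i z a b).
Proof.
rewrite (_ : (fun z => _) = fun z =>
  - (\sum_k D i k (lsubmx z) a b * z 0 (rshift n k))
  - sym_mx (schouten g D i (lsubmx z)) a b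
  - z 0 (rshift n a) * z 0 (rshift n b)
  + 2^-1 * (\sum_c (\sum_d z 0 (rshift n d) * invmx (g i (lsubmx z)) d c)
            * z 0 (rshift n c)) * g i (lsubmx z) a b); last first.
  by apply/funext => z; exact: weyl_blockE.
have xi k : smooth_on (lsub_set (n:=n) (chart_image i)) (fun z => z 0 (rshift n k)).
  exact: smooth_on_coord.
have lift f : smooth_on (chart_image i) f ->
    smooth_on (lsub_set (n:=n) (chart_image i)) (fun z => f (lsubmx z)).
  exact: (smooth_on_lsubmx (n:=n) (chart_image_open HM (i:=i))).
have ginv d c := lift _ (metric_inv_smooth (i:=i) d c).
apply: smooth_onD => //; first apply: smooth_onB => //; first apply: smooth_onB => //.
- apply: smooth_onN => //; apply: smooth_on_sum => // k; apply: smooth_onM => //.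
  exact: (lift _ (@D_smooth i k a b)).
- apply: (lift (fun x => sym_mx (schouten g D i x) a b)).
  rewrite (_ : (fun x => _) = fun x =>
     2^-1 * (schouten g D i x a b + schouten g D i x b a)); last first.
    by apply/funext => x; exact: sym_mxE.
  apply: smooth_onM => //; first exact: smooth_on_cst.
  by apply: smooth_onD => //; exact: schouten_smooth.
- exact: smooth_onM.
- apply: smooth_onM => //; last exact: (lift _ (metric_smooth (i:=i) a b)).
  apply: smooth_onM => //; first exact: smooth_on_cst.
  apply: smooth_on_sum => // c; apply: smooth_onM => //.
  by apply: smooth_on_sum => // d; apply: smooth_onM.
Qed.

Lemma weyl_block_tr i z : chart_image i (lsubmx z) ->
  (weyl_block g D i z)^T = weyl_block g D i z.
Proof.
move=> zi; apply/matrixP => a b; rewrite mxE !weyl_blockE.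
have gs : g i (lsubmx z) b a = g i (lsubmx z) a b.
  by rewrite -{1}(metric_tr zi) mxE.
rewrite gs !sym_mxE; congr (- _ - _ - _ + _).
- by apply: eq_bigr => k _; rewrite (weyl_christoffel_sym zi).
- by rewrite addrC.
- by rewrite mulrC.
Qed.

(** All terms are tensorial except the one with the Christoffel symbols, whose inhomogeneous term,
    paired with the covector, is the Hessian. This is exactly the shift in [pw_mx_change], so that
    the whole block matrix is a tensor. *)
Lemma weyl_block_change i j z : overlap i j (lsubmx z) ->
  let t := transition i j in let J := 'J t (lsubmx z) in
  weyl_block g D i z = J *m weyl_block g D j (cotangent_lift t z) *m J^T
    - \matrix_(a, k) \sum_l cotangent_lift t z 0 (rshift n l) *
         partial a (partial k (fun y => t y 0 l)) (lsubmx z).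
Proof.
move=> zij t J; have [[_ DL] _ _] := WD.
have DLz a b l : \sum_k D i k (lsubmx z) a b * J k l =
    partial a (partial b (fun y => t y 0 l)) (lsubmx z)
    + \sum_c \sum_d J a c * J b d * D j l (t (lsubmx z)) c d.
  exact: DL.
have Ju : J \in unitmx := jacobian_transition_unit HM zij.
have zji := overlap_chart HM (overlap_transition HM zij).
set w := cotangent_lift t z.
have wl : lsubmx w = t (lsubmx z) by rewrite row_mxKl.
have wr : rsubmx w *m J^T = rsubmx z.
  rewrite row_mxKr -mulmxA -trmx_mul.
  have JI : J *m invmx J = 1%:M := mulmxV Ju.
  by rewrite JI trmx1 mulmx1.
set H := (X in _ - X).
have CE : christoffel_mx D i z = H + J *m christoffel_mx D j w *m J^T.
  apply/matrixP => a b; rewrite mxE [RHS]mxE [X in _ = X + _]mxE.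
  transitivity (\sum_l w 0 (rshift n l) * (\sum_k D i k (lsubmx z) a b * J k l)).
    under [RHS]eq_bigr => l _ do rewrite mulr_sumr.
    rewrite exchange_big /=; apply: eq_bigr => k _.
    have -> : z 0 (rshift n k) = (rsubmx w *m J^T) 0 k by rewrite wr mxE.
    rewrite mxE mulr_sumr; apply: eq_bigr => l _.
    by rewrite [rsubmx w _ _]mxE [J^T _ _]mxE; ring.
  under eq_bigr => l _ do rewrite DLz mulrDr.
  rewrite big_split /=; apply: f_equal2; first by [].
  rewrite mxE; transitivity (\sum_d \sum_c
      J a c * (\sum_l D j l (lsubmx w) c d * w 0 (rshift n l)) * J b d).
    rewrite [RHS]exchange_big /=.
    under eq_bigr => l _ do rewrite mulr_sumr.
    rewrite exchange_big /=; apply: eq_bigr => c _.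
    under eq_bigr => l _ do rewrite mulr_sumr.
    rewrite exchange_big /=; apply: eq_bigr => d _.
    rewrite mulr_sumr mulr_suml; apply: eq_bigr => l _.
    by rewrite wl; ring.
  apply: eq_bigr => d _; rewrite [(J *m _) _ _]mxE mulr_suml.
  by apply: eq_bigr => c _; rewrite [(J^T) _ _]mxE [(christoffel_mx _ _ _) _ _]mxE.
have SE : sym_mx (schouten g D i (lsubmx z)) =
    J *m sym_mx (schouten g D j (lsubmx w)) *m J^T.
  by rewrite (schouten_law zij) sym_mx_change wl.
have gE : g i (lsubmx z) = J *m g j (lsubmx w) *m J^T.
  by rewrite wl; exact: gm.1.2.
have NE : bilin (invmx (g i (lsubmx z))) (rsubmx z) (rsubmx z) =
    bilin (invmx (g j (lsubmx w))) (rsubmx w) (rsubmx w).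
  have gu : g j (lsubmx w) \in unitmx by rewrite wl; exact: metric_unit.
  rewrite gE invmx_change // /bilin -wr trmx_mul trmxK !mulmxA.
  rewrite -(mulmxA (rsubmx w)) -trmx_mul mulVmx // trmx1 mulmx1.
  by rewrite -(mulmxA _ (invmx J)) mulVmx // mulmx1.
have fD X Y : J *m (X + Y) *m J^T = J *m X *m J^T + J *m Y *m J^T.
  by rewrite mulmxDr mulmxDl.
have fN X : J *m (- X) *m J^T = - (J *m X *m J^T) by rewrite mulmxN mulNmx.
have fZ c X : J *m (c *: X) *m J^T = c *: (J *m X *m J^T).
  by rewrite -scalemxAr -scalemxAl.
rewrite /weyl_block CE NE SE -wr gE.
move: (sym_mx (schouten g D j (lsubmx w))) => S.
move: (christoffel_mx D j w) => C.
move: (bilin _ _ _) => N; move: (g j (lsubmx w)) (rsubmx w) => G xi.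
rewrite !(fD, fN, fZ) trmx_mul trmxK !mulmxA.
move: (J *m C *m J^T) (J *m S *m J^T) (J *m G *m J^T) => C' S' G'.
move: (J *m xi^T *m xi *m J^T) => X; clear CE; move: H => H.
by apply/matrixP => a b; rewrite !mxE; ring.
Qed.

Lemma weyl_metric_block i z : chart_image i (lsubmx z) ->
  weyl_metric g D i z = pw_mx (weyl_block g D i z).
Proof.
move=> zi; apply: (weyl_metricE HM gm schouten_law _ zi).
exact: weyl_christoffel_mx_tr.
Qed.

Lemma smooth_block_mx (A : set 'rV[R]_(n + n))
    (F1 F2 F3 F4 : 'rV[R]_(n + n) -> 'M[R]_n) k l :
  (forall a b, smooth_on A (fun z => F1 z a b)) ->
  (forall a b, smooth_on A (fun z => F2 z a b)) ->
  (forall a b, smooth_on A (fun z => F3 z a b)) ->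
  (forall a b, smooth_on A (fun z => F4 z a b)) ->
  smooth_on A (fun z => block_mx (F1 z) (F2 z) (F3 z) (F4 z) k l).
Proof.
move=> S1 S2 S3 S4; case: (split_ordP k) => a ->; case: (split_ordP l) => b ->.
- by rewrite (_ : (fun z => _) = fun z => F1 z a b) //; apply/funext => z;
    rewrite block_mxEul.
- by rewrite (_ : (fun z => _) = fun z => F2 z a b) //; apply/funext => z;
    rewrite block_mxEur.
- by rewrite (_ : (fun z => _) = fun z => F3 z a b) //; apply/funext => z;
    rewrite block_mxEdl.
- by rewrite (_ : (fun z => _) = fun z => F4 z a b) //; apply/funext => z;
    rewrite block_mxEdr.
Qed.

Lemma weyl_metric_tensor : is_tensor2 (weyl_metric g D).
Proof.
split=> [i k l|i j z].
  have cE : chart_image (M := cotangent M) i = lsub_set (n:=n) (chart_image (M := M) i).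
    by apply/seteqP; split=> z /(cotangent_chart_image HM).
  rewrite cE; apply: (@eq_smooth_on _ _ _
    (fun z => pw_mx (weyl_block g D i z) k l)) => //.
    by move=> z zi; rewrite weyl_metric_block.
  apply: smooth_block_mx => a b; try exact: smooth_on_cst.
  exact: weyl_block_smooth.
move=> /(cotangent_overlap HM) zij.
rewrite (cotangent_transition_jacobian HM zij) (cotangent_transition HM zij).
have tji := overlap_chart HM (overlap_transition HM zij).
have xij := overlap_chart HM zij.
rewrite weyl_metric_block // weyl_metric_block ?row_mxKl //.
have to := @overlap_open _ _ _ HM i j.
have ts := @transition_smooth _ _ _ HM i j.
have tu (y : 'rV[R]_n) : overlap (M := M) i j y ->
    'J (transition (M := M) i j) y \in unitmx.
  exact: (jacobian_transition_unit HM).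
have [K -> KJ] := cotangent_jacobian to ts tu zij.
rewrite (weyl_block_change zij) -(pw_mx_change _ (tu _ zij) _ KJ) //.
exact: (cotangent_hessian_sym to ts zij).
Qed.

Lemma weyl_metric_is_metric : is_metric (weyl_metric g D).
Proof.
split; first exact: weyl_metric_tensor.
move=> i z /(cotangent_chart_image HM) zi; rewrite weyl_metric_block //.
split; last exact: pw_mx_unit.
by apply: tr_pw_mx; exact: weyl_block_tr.
Qed.

Lemma weyl_metric_signature i z : chart_image (M := cotangent M) i z ->
  has_signature (weyl_metric g D i z).
Proof.
move=> /(cotangent_chart_image HM) zi; rewrite weyl_metric_block //.
set A := weyl_block g D i z.
have E := pw_mx_signature (weyl_block_tr zi).
exists (block_mx 1%:M (1%:M - A) 1%:M (- 1%:M - A)); last exact: E.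
have Du : block_mx 1%:M 0 0 (- 1%:M) \in @unitmx R (n + n).
  apply: (mulmx1_unit (B := block_mx 1%:M 0 0 (- 1%:M)) _).1.
  rewrite mulmx_block !(mulmx0, mul0mx, addr0, add0r, mulmx1, mulmxN, opprK).
  by rewrite -scalar_mx_block.
by move: Du; rewrite -E !unitmx_mul => /andP [/andP [] ].
Qed.

Lemma weyl_symplectic_block i z : chart_image i (lsubmx z) ->
  weyl_symplectic g D i z = symp_mx (alt_mx (schouten g D i (lsubmx z))).
Proof. exact: (weyl_symplecticE HM schouten_law). Qed.

Let cE i : chart_image (M := cotangent M) i =
  lsub_set (n:=n) (chart_image (M := M) i).
Proof. by apply/seteqP; split=> z /(cotangent_chart_image HM). Qed.

Let B i x := alt_mx (schouten g D i x).

Let B_smooth i a b : smooth_on (chart_image i) (fun x => B i x a b).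
Proof.
rewrite (_ : (fun x => _) = fun x =>
  2^-1 * (schouten g D i x a b - schouten g D i x b a)); last first.
  by apply/funext => x; exact: alt_mxE.
apply: smooth_onM => //; first exact: smooth_on_cst.
by apply: smooth_onB => //; exact: schouten_smooth.
Qed.

Lemma weyl_symplectic_tensor : is_tensor2 (weyl_symplectic g D).
Proof.
split=> [i k l|i j z].
  rewrite cE; apply: (@eq_smooth_on _ _ _ (fun z => symp_mx (B i (lsubmx z)) k l)) => //.
    by move=> z zi; rewrite weyl_symplectic_block.
  apply: smooth_block_mx => a b; try exact: smooth_on_cst.
  exact: (smooth_on_lsubmx (n:=n) (chart_image_open HM (i:=i)) (@B_smooth i a b)).
move=> /(cotangent_overlap HM) zij.
rewrite (cotangent_transition_jacobian HM zij) (cotangent_transition HM zij).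
have tji := overlap_chart HM (overlap_transition HM zij).
have xij := overlap_chart HM zij.
rewrite weyl_symplectic_block // weyl_symplectic_block ?row_mxKl //.
have to := @overlap_open _ _ _ HM i j.
have ts := @transition_smooth _ _ _ HM i j.
have tu (y : 'rV[R]_n) : overlap (M := M) i j y ->
    'J (transition (M := M) i j) y \in unitmx.
  exact: (jacobian_transition_unit HM).
have [K -> KJ] := cotangent_jacobian to ts tu zij.
rewrite (symp_mx_change _ (tu _ zij) _ KJ); last first.
  exact: (cotangent_hessian_sym to ts zij).
by rewrite (schouten_law zij) alt_mx_change.
Qed.

(* [d (Alt P) = 0], since [n Alt P = Alt Ric] is the exterior derivative of the
   trace of the connection form. *)
Lemma alt_schouten_closed i x a b c : chart_image i x ->
  partial a (fun y => B i y b c) x + partial b (fun y => B i y c a) x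
    + partial c (fun y => B i y a b) x = 0.
Proof.
move=> xi; pose th a y := \sum_c D i c y c a.
have thS d : smooth_on (chart_image i) (th d).
  by apply: smooth_on_sum => // e; exact: D_smooth.
have BE d e y : chart_image i y -> B i y d e =
    n%:R^-1 * 2^-1 * (partial e (th d) y - partial d (th e) y).
  move=> yi; rewrite /B /schouten (alt_schouten_mx _ (metric_tr yi)).
  rewrite mxE alt_mxE (ricci_alt _ _ (Do (i:=i)) yi); last exact: weyl_christoffel_sym.
  have pth u v : partial u (th v) y = \sum_c partial u (fun y0 => D i c y0 c v) y.
    apply: partial_sum => k _; exact: (smooth_on_diff (@D_smooth i k k v) yi).
  by rewrite !pth mulrA.
have dth d e u : differentiable (partial d (th e)) x.
  exact: (smooth_on_diff (smooth_on_partial d (thS e)) xi).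
have pB u d e : partial u (fun y => B i y d e) x =
    n%:R^-1 * 2^-1 * (partial u (partial e (th d)) x - partial u (partial d (th e)) x).
  rewrite -partialB; [|exact: dth|exact: dth].
  rewrite -partialZ; last by apply: differentiableB; exact: dth.
  by apply: (eq_partial _ (Do (i:=i)) xi) => y yi; exact: BE.
rewrite !pB (partialC a b (Do (i:=i)) (thS c) xi).
rewrite (partialC a c (Do (i:=i)) (thS b) xi).
rewrite (partialC b c (Do (i:=i)) (thS a) xi).
set p1 := partial b (partial a _) x; set p2 := partial c (partial a _) x.
set p3 := partial c (partial b _) x.
by ring.
Qed.

Lemma weyl_symplectic_symplectic : symplectic (weyl_symplectic g D).
Proof.
split; first exact: weyl_symplectic_tensor.
  move=> i z /(cotangent_chart_image HM) zi; rewrite weyl_symplectic_block //.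
  by split; [apply: tr_symp_mx; exact: tr_alt_mx|exact: symp_mx_unit].
move=> i z /(cotangent_chart_image HM) zi a b c.
have wE k l u : partial u (fun y => weyl_symplectic g D i y k l) z =
    partial u (fun y => symp_mx (B i (lsubmx y)) k l) z.
  apply: (eq_partial _ (oO (i:=i)) zi) => y yi.
  by rewrite weyl_symplectic_block.
rewrite !wE.
have dB d e := smooth_on_diff (@B_smooth i d e) zi.
have pll u k l : partial u (fun y => symp_mx (B i (lsubmx y)) (lshift n k) (lshift n l)) z
    = partial u (fun y => B i (lsubmx y) k l) z.
  by congr partial; apply/funext => y; rewrite block_mxEul.
have plr u k l : partial u (fun y => symp_mx (B i (lsubmx y)) (lshift n k) (rshift n l)) z = 0.
  rewrite -(partial_cst u ((2^-1)%:M k l) z); congr partial.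
  by apply/funext => y; rewrite block_mxEur.
have prl u k l : partial u (fun y => symp_mx (B i (lsubmx y)) (rshift n k) (lshift n l)) z = 0.
  rewrite -(partial_cst u ((- (2^-1)%:M : 'M[R]_n) k l) z); congr partial.
  by apply/funext => y; rewrite block_mxEdl.
have prr u k l : partial u (fun y => symp_mx (B i (lsubmx y)) (rshift n k) (rshift n l)) z = 0.
  rewrite -(partial_cst u ((0 : 'M[R]_n) k l) z); congr partial.
  by apply/funext => y; rewrite block_mxEdr.
have pl u k l : partial (lshift n u) (fun y => B i (lsubmx y) k l) z =
    partial u (fun y => B i y k l) (lsubmx z).
  exact: (partial_lsubmxl (n:=n) u (dB k l)).
have pr u k l : partial (rshift n u) (fun y => B i (lsubmx y) k l) z = 0.
  exact: (partial_lsubmxr (n:=n) u (dB k l)).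
case: (split_ordP a) => a' ->; case: (split_ordP b) => b' ->;
  case: (split_ordP c) => c' ->; rewrite ?pll ?plr ?prl ?prr ?pl ?pr ?addr0 //.
exact: alt_schouten_closed.
Qed.

Lemma weyl_almost_para_kahler :
  almost_para_kahler (weyl_metric g D) (weyl_symplectic g D).
Proof.
split; first exact: weyl_metric_is_metric.
- exact: weyl_metric_signature.
- exact: weyl_symplectic_symplectic.
- move=> i z /(cotangent_chart_image HM) zi.
  by rewrite weyl_metric_block // weyl_symplectic_block //; exact: pw_symp_involution.
Qed.

End WeylTensors.

(** * The Einstein equation *)

(** The bookkeeping for the horizontal block of the Ricci tensor: [D] stands for the first fibre
    derivatives of [A], [P] for the base derivatives of [D], and [Q] for the second fibre
    derivatives of the entry [A a b]. The left-hand side adds the divergences of the symbols with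
    upper base and upper fibre index and subtracts the quadratic terms. *)
Lemma ricci_pw_algebra (R : numFieldType) n (D : 'I_n -> 'I_n -> 'I_n -> R)
    (P : 'I_n -> 'I_n -> 'I_n -> 'I_n -> R) (A Q : 'I_n -> 'I_n -> R) a b :
  \sum_c - P c c a b + \sum_c (P a c b c + P b c a c - P c c a b
    + 2 * \sum_d (D c c d * D d a b + A c d * Q c d))
  - (\sum_c \sum_d D d a c * D c b d + \sum_c \sum_d D d a c * D c b d) =
  2 * sricci (fun k a b => - D k a b) (fun e k a b => - P e k a b) a b
  + 2 * \sum_c \sum_d A c d * Q c d.
Proof.
rewrite /sricci.
have -> : \sum_d (\sum_c - D c c d) * - D d a b = \sum_c \sum_d D c c d * D d a b.
  rewrite [RHS]exchange_big /=; apply: eq_bigr => d _.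
  by rewrite sumrN mulrNN mulr_suml.
have -> : \sum_c \sum_d - D d a c * - D c b d = \sum_c \sum_d D d a c * D c b d.
  by apply: eq_bigr => c _; apply: eq_bigr => d _; rewrite mulrNN.
rewrite [X in _ + X - _]big_split /= -[X in _ + (_ + X) - _]mulr_sumr.
rewrite [X in _ + (X + _) - _]sumrB [X in _ + (X - _ + _) - _]big_split /=.
under [X in _ + (_ + _ * X) - _]eq_bigr => c _ do rewrite big_split /=.
rewrite [X in _ + (_ + _ * X) - _]big_split /= !sumrN.
by field.
Qed.

(** * Levi-Civita connection and Ricci tensor of a block metric *)

Section RicciBlock.
Variables (R : realType) (n : nat) (U : set 'rV[R]_(n + n)).
Variables (A : 'rV[R]_(n + n) -> 'M[R]_n) (h : 'rV[R]_(n + n) -> 'M[R]_(n + n)).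
Hypothesis Uo : open U.
Hypothesis AU : forall a b, smooth_on U (fun z => A z a b).
Hypothesis Asym : forall z, U z -> (A z)^T = A z.
Hypothesis hE : forall z, U z -> h z = pw_mx (A z).
Implicit Types (z : 'rV[R]_(n + n)) (a b c d e m : 'I_n) (u : 'I_(n + n)).

Local Notation l_ := (lshift n).
Local Notation r_ := (rshift n).
Let dA u a b z := partial u (fun y => A y a b) z.

Let AC a b z : U z -> A z a b = A z b a.
Proof. by move=> Uz; rewrite -{1}(Asym Uz) mxE. Qed.

Let dAC u a b z : U z -> dA u a b z = dA u b a z.
Proof. by move=> Uz; apply: (eq_partial _ Uo Uz) => y Uy; exact: AC. Qed.

Let dAS u a b : smooth_on U (dA u a b).
Proof. exact: smooth_on_partial. Qed.

Let dAd u a b z : U z -> differentiable (dA u a b) z.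
Proof. by move=> Uz; exact: (smooth_on_diff (@dAS u a b) Uz). Qed.

Let Ad a b z : U z -> differentiable (fun y => A y a b) z.
Proof. by move=> Uz; exact: (smooth_on_diff (AU a b) Uz). Qed.

Let hll u a b z : U z -> partial u (fun y => h y (l_ a) (l_ b)) z = dA u a b z.
Proof.
by move=> Uz; apply: (eq_partial _ Uo Uz) => y Uy; rewrite hE // block_mxEul.
Qed.

Let hlr u a b z : U z -> partial u (fun y => h y (l_ a) (r_ b)) z = 0.
Proof.
move=> Uz; rewrite -(partial_cst u ((2^-1)%:M a b) z).
by apply: (eq_partial _ Uo Uz) => y Uy; rewrite hE // block_mxEur.
Qed.

Let hrl u a b z : U z -> partial u (fun y => h y (r_ a) (l_ b)) z = 0.
Proof.
move=> Uz; rewrite -(partial_cst u ((2^-1)%:M a b) z).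
by apply: (eq_partial _ Uo Uz) => y Uy; rewrite hE // block_mxEdl.
Qed.

Let hrr u a b z : U z -> partial u (fun y => h y (r_ a) (r_ b)) z = 0.
Proof.
move=> Uz; rewrite -(partial_cst u ((0 : 'M[R]_n) a b) z).
by apply: (eq_partial _ Uo Uz) => y Uy; rewrite hE // block_mxEdr.
Qed.

Let G := levi_civita h.

Let GE k z p q : G k z p q = 2^-1 * \sum_c invmx (h z) k c *
  (partial p (fun y => h y q c) z + partial q (fun y => h y p c) z
   - partial c (fun y => h y p q) z).
Proof. by rewrite mxE. Qed.

(** The upper rows of the inverse metric are (0, 2), so an upper base index selects the fibre
    derivative in the Koszul formula; the two other terms differentiate constant entries of the
    metric. *)
Let Gl m z p q : U z -> G (l_ m) z p q = - partial (r_ m) (fun y => h y p q) z.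
Proof.
move=> Uz; rewrite GE hE // pw_mx_inv big_split_ord /=.
rewrite [X in _ * (X + _)]big1 ?add0r => [|c _]; last first.
  by rewrite block_mxEul [X in X * _]mxE mul0r.
rewrite (eq_bigr (fun c => (m == c)%:R *
    (2 * - partial (r_ c) (fun y => h y p q) z))); last first.
  move=> c _; rewrite block_mxEur mxE -[2 *+ _]mulr_natl -mulrA; congr (_ * (_ * _)).
  have -> : partial p (fun y => h y q (r_ c)) z = 0.
    by case: (split_ordP q) => a ->; rewrite ?hlr ?hrr.
  have -> : partial q (fun y => h y p (r_ c)) z = 0.
    by case: (split_ordP p) => a ->; rewrite ?hlr ?hrr.
  by rewrite !add0r.
by rewrite sum_deltal' mulrA mulVf ?pnatr_eq0 // mul1r.
Qed.

Let Gr m z p q : U z -> G (r_ m) z p q =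
  partial p (fun y => h y q (l_ m)) z + partial q (fun y => h y p (l_ m)) z
  - partial (l_ m) (fun y => h y p q) z
  + 2 * \sum_c A z m c * partial (r_ c) (fun y => h y p q) z.
Proof.
move=> Uz; rewrite GE hE // pw_mx_inv big_split_ord /=.
rewrite (eq_bigr (fun c => (m == c)%:R * (2 *
    (partial p (fun y => h y q (l_ c)) z + partial q (fun y => h y p (l_ c)) z
     - partial (l_ c) (fun y => h y p q) z)))); last first.
  by move=> c _; rewrite block_mxEdl mxE -[2 *+ _]mulr_natl -mulrA.
rewrite sum_deltal' mulrDr mulrA mulVf ?pnatr_eq0 // mul1r; congr (_ + _).
rewrite (eq_bigr (fun c => 4 * (A z m c * partial (r_ c) (fun y => h y p q) z))).
  rewrite -mulr_sumr mulrA; congr (_ * _); by field.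
move=> c _; rewrite block_mxEdr mxE.
have -> : partial p (fun y => h y q (r_ c)) z = 0.
  by case: (split_ordP q) => a ->; rewrite ?hlr ?hrr.
have -> : partial q (fun y => h y p (r_ c)) z = 0.
  by case: (split_ordP p) => a ->; rewrite ?hlr ?hrr.
by rewrite !add0r; ring.
Qed.

Let F m a b z := dA (r_ b) a m z.

Let E m a b z := dA (l_ a) b m z + dA (l_ b) a m z - dA (l_ m) a b z
  + 2 * \sum_c A z m c * dA (r_ c) a b z.

Let Glll m a b z : U z -> G (l_ m) z (l_ a) (l_ b) = - dA (r_ m) a b z.
Proof. by move=> Uz; rewrite Gl // hll. Qed.

Let Gllr m a b z : U z -> G (l_ m) z (l_ a) (r_ b) = 0.
Proof. by move=> Uz; rewrite Gl // hlr // oppr0. Qed.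

Let Glrl m a b z : U z -> G (l_ m) z (r_ a) (l_ b) = 0.
Proof. by move=> Uz; rewrite Gl // hrl // oppr0. Qed.

Let Glrr m a b z : U z -> G (l_ m) z (r_ a) (r_ b) = 0.
Proof. by move=> Uz; rewrite Gl // hrr // oppr0. Qed.

Let Grll m a b z : U z -> G (r_ m) z (l_ a) (l_ b) = E m a b z.
Proof.
move=> Uz; rewrite Gr // !hll //; congr (_ + 2 * _).
by apply: eq_bigr => c _; rewrite hll.
Qed.

Let Grlr m a b z : U z -> G (r_ m) z (l_ a) (r_ b) = F m a b z.
Proof.
move=> Uz; rewrite Gr // hrl // hll // hlr // add0r subr0 big1 ?mulr0 ?addr0 //.
by move=> c _; rewrite hlr // mulr0.
Qed.

Let Grrl m a b z : U z -> G (r_ m) z (r_ a) (l_ b) = F m b a z.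
Proof.
move=> Uz; rewrite Gr // hrl // hll // hrl // addr0 subr0 big1 ?mulr0 ?addr0 //.
by move=> c _; rewrite hrl // mulr0.
Qed.

Let Grrr m a b z : U z -> G (r_ m) z (r_ a) (r_ b) = 0.
Proof.
move=> Uz; rewrite Gr // !hrl // hrr // addr0 subr0 big1 ?mulr0 ?addr0 //.
by move=> c _; rewrite hrr // mulr0.
Qed.

(** This trace is the logarithmic derivative of the volume density, and the determinant of [pw_mx A]
    does not depend on [A]. Two of the four terms of the Ricci tensor vanish for this reason
    ([ricG]). *)
Let Gtrace z p : U z -> \sum_c G c z c p = 0.
Proof.
move=> Uz; rewrite big_split_ord /=; case: (split_ordP p) => a ->.
  rewrite -big_split /= big1 // => c _.
  by rewrite Glll // Grrl // /F dAC // addNr.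
by rewrite !big1 ?addr0 // => c _; rewrite ?Gllr ?Grrr.
Qed.

Let Ed m a b z : U z -> differentiable (E m a b) z.
Proof.
move=> Uz; apply: differentiableD.
  by apply: differentiableB; [apply: differentiableD|]; exact: dAd.
apply: differentiableM; first exact: differentiable_cst.
apply: differentiable_bigsum => c _.
by apply: differentiableM; [exact: Ad|exact: dAd].
Qed.

Let Gd k p q z : U z -> differentiable (fun y => G k y p q) z.
Proof.
have e f : (forall y, U y -> f y = G k y p q) -> U z -> differentiable f z ->
    differentiable (fun y => G k y p q) z.
  by move=> fG Uz; exact: (eq_differentiable Uo Uz fG).
move: e; case: (split_ordP k) => m ->; case: (split_ordP p) => a ->;
  case: (split_ordP q) => b -> e Uz.
- apply: (e (fun y => - dA (r_ m) a b y)) => //.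
    by move=> y Uy; rewrite Glll.
  by apply: differentiableN; exact: dAd.
- by apply: (e (fun=> 0)) => // y Uy; rewrite Gllr.
- by apply: (e (fun=> 0)) => // y Uy; rewrite Glrl.
- by apply: (e (fun=> 0)) => // y Uy; rewrite Glrr.
- apply: (e (E m a b)) => //; last exact: Ed.
  by move=> y Uy; rewrite Grll.
- apply: (e (F m a b)) => //; last exact: dAd.
  by move=> y Uy; rewrite Grlr.
- apply: (e (F m b a)) => //; last exact: dAd.
  by move=> y Uy; rewrite Grrl.
- by apply: (e (fun=> 0)) => // y Uy; rewrite Grrr.
Qed.

Let ricG z p q : U z -> ricci G z p q =
  \sum_c partial c (fun y => G c y p q) z - \sum_c \sum_d G d z p c * G c z d q.
Proof.
move=> Uz; rewrite ricciE'.
rewrite [X in _ + X - _]big1 => [|d _]; last by rewrite Gtrace ?mul0r.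
rewrite addr0; congr (_ - _); rewrite -[RHS]subr0; congr (_ - _).
rewrite -partial_sum => [|c _]; last exact: Gd.
rewrite -[RHS](partial_cst p 0 z); apply: (eq_partial _ Uo Uz) => y Uy.
exact: Gtrace.
Qed.

Let pG k p q u f z : (forall y, U y -> G k y p q = f y) -> U z ->
  partial u (fun y => G k y p q) z = partial u f z.
Proof. by move=> Gf Uz; exact: (eq_partial _ Uo Uz). Qed.

Lemma ricci_pw_rr a b z : U z -> ricci (levi_civita h) z (r_ a) (r_ b) = 0.
Proof.
move=> Uz; rewrite ricG // !big_split_ord /=.
rewrite [X in X + _ - _]big1 => [|c _]; last first.
  by rewrite (@pG _ _ _ _ (fun=> 0) z) ?partial_cst // => y Uy; rewrite Glrr.
rewrite [X in _ + X - _]big1 => [|c _]; last first.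
  by rewrite (@pG _ _ _ _ (fun=> 0) z) ?partial_cst // => y Uy; rewrite Grrr.
rewrite !big1 ?addr0 ?subr0 // => c _; rewrite big_split_ord /= !big1 ?addr0 //.
- by move=> d _; rewrite Grrr // mul0r.
- by move=> d _; rewrite Glrr // mul0r.
- by move=> d _; rewrite Glrr // mulr0.
- by move=> d _; rewrite Glrl // mul0r.
Qed.

Lemma ricci_pw_lr a b z : U z -> ricci (levi_civita h) z (l_ a) (r_ b) =
  \sum_c partial (r_ c) (partial (r_ b) (fun y => A y a c)) z.
Proof.
move=> Uz; rewrite ricG // !big_split_ord /=.
rewrite [X in X + _ - _]big1 => [|c _]; last first.
  by rewrite (@pG _ _ _ _ (fun=> 0) z) ?partial_cst // => y Uy; rewrite Gllr.
rewrite add0r -[RHS]subr0; congr (_ - _).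
  by apply: eq_bigr => c _; apply: pG => // y Uy; exact: Grlr.
rewrite !big1 ?addr0 ?subr0 // => c _; rewrite big_split_ord /= !big1 ?addr0 //.
- by move=> d _; rewrite Grrr // mulr0.
- by move=> d _; rewrite Gllr // mul0r.
- by move=> d _; rewrite Glrr // mulr0.
- by move=> d _; rewrite Gllr // mulr0.
Qed.

Lemma ricci_pw_rl a b z : U z -> ricci (levi_civita h) z (r_ b) (l_ a) =
  \sum_c partial (r_ c) (partial (r_ b) (fun y => A y a c)) z.
Proof.
move=> Uz; rewrite ricG // !big_split_ord /=.
rewrite [X in X + _ - _]big1 => [|c _]; last first.
  by rewrite (@pG _ _ _ _ (fun=> 0) z) ?partial_cst // => y Uy; rewrite Glrl.
rewrite add0r -[RHS]subr0; congr (_ - _).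
  by apply: eq_bigr => c _; apply: pG => // y Uy; exact: Grrl.
rewrite !big1 ?addr0 ?subr0 // => c _; rewrite big_split_ord /= !big1 ?addr0 //.
- by move=> d _; rewrite Grrr // mul0r.
- by move=> d _; rewrite Glrr // mul0r.
- by move=> d _; rewrite Glrl // mulr0.
- by move=> d _; rewrite Glrl // mul0r.
Qed.

Lemma ricci_pw_ll a b z : U z -> ricci (levi_civita h) z (l_ a) (l_ b) =
  2 * sricci (fun k a b => - dA (r_ k) a b z)
    (fun e k a b => - partial (l_ e) (dA (r_ k) a b) z) a b
  + 2 * \sum_c \sum_d A z c d
        * partial (r_ c) (partial (r_ d) (fun y => A y a b)) z.
Proof.
move=> Uz; rewrite ricG // !big_split_ord /=.
rewrite (eq_bigr (fun c => - partial (l_ c) (dA (r_ c) a b) z)); last first.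
  move=> c _; rewrite (@pG _ _ _ _ (fun y => - dA (r_ c) a b y) z) //.
    by rewrite partialN //; exact: dAd.
  by move=> y Uy; exact: Glll.
rewrite [X in _ + X - _](eq_bigr (fun c =>
    partial (l_ a) (dA (r_ c) b c) z + partial (l_ b) (dA (r_ c) a c) z
    - partial (l_ c) (dA (r_ c) a b) z
    + 2 * \sum_d (dA (r_ c) c d z * dA (r_ d) a b z
                  + A z c d * partial (r_ c) (dA (r_ d) a b) z))); last first.
  move=> c _; rewrite (@pG _ _ _ _ (E c a b) z) //; last by move=> y Uy; exact: Grll.
  have sw u d e : partial (r_ c) (dA u d e) z = partial u (dA (r_ c) d e) z.
    exact: (partialC _ _ Uo (AU d e) Uz).
  rewrite partialD; last 2 first.
  - by apply: differentiableB; [apply: differentiableD|]; exact: dAd.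
  - apply: differentiableM; first exact: differentiable_cst.
    apply: differentiable_bigsum => d _.
    by apply: differentiableM; [exact: Ad|exact: dAd].
  rewrite partialB; [|by apply: differentiableD; exact: dAd|exact: dAd].
  rewrite partialD; [|exact: dAd|exact: dAd].
  rewrite !sw; congr (_ + _).
  rewrite partialZ; last first.
    apply: differentiable_bigsum => d _.
    by apply: differentiableM; [exact: Ad|exact: dAd].
  congr (_ * _); rewrite partial_sum => [|d _]; last first.
    by apply: differentiableM; [exact: Ad|exact: dAd].
  by apply: eq_bigr => d _; rewrite partialM; [|exact: Ad|exact: dAd].
(* In the quadratic term, the base and the fibre values of the outer summation index contribute
   equally, which produces the factor 2 in front of this part of [sricci]. *)
have q1 : \sum_(i < n) \sum_(d < n + n) G d z (l_ a) (l_ i) * G (l_ i) z d (l_ b)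
    = \sum_c \sum_d dA (r_ d) a c z * dA (r_ c) b d z.
  apply: eq_bigr => c _; rewrite big_split_ord /= [X in _ + X]big1 ?addr0.
    by apply: eq_bigr => d _; rewrite !Glll // mulrNN (dAC _ d b).
  by move=> d _; rewrite Glrl // mulr0.
have q2 : \sum_(i < n) \sum_(d < n + n) G d z (l_ a) (r_ i) * G (r_ i) z d (l_ b)
    = \sum_c \sum_d dA (r_ d) a c z * dA (r_ c) b d z.
  rewrite [RHS]exchange_big /=.
  apply: eq_bigr => c _; rewrite big_split_ord /= [X in X + _]big1 ?add0r.
    by apply: eq_bigr => d _; rewrite Grlr // Grrl.
  by move=> d _; rewrite Gllr // mul0r.
rewrite q1 q2.
exact: (ricci_pw_algebra (fun k a b => dA (r_ k) a b z)
  (fun e k a b => partial (l_ e) (dA (r_ k) a b) z) (fun c d => A z c d)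
  (fun c d => partial (r_ c) (dA (r_ d) a b) z) a b).
Qed.

End RicciBlock.

Section FrameCompat.
Variables (R : realType) (n : nat).
Implicit Types (a b c d k : 'I_n) (x : 'rV[R]_n).

Lemma bilinE (B : 'M[R]_n) (v w : 'rV[R]_n) :
  bilin B v w = \sum_c \sum_d v 0 c * B c d * w 0 d.
Proof.
rewrite /bilin mxE exchange_big /=; apply: eq_bigr => d _.
by rewrite mxE mulr_suml; apply: eq_bigr => c _; rewrite mxE.
Qed.

Lemma bilin_framer (B : 'M[R]_n) v d x :
  bilin B v (frame d x) = \sum_c v 0 c * B c d.
Proof.
rewrite bilinE; apply: eq_bigr => c _.
by under eq_bigr => e _ do rewrite mulrC; rewrite sum_frame.
Qed.

Lemma bilin_framel (B : 'M[R]_n) w c x :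
  bilin B (frame c x) w = \sum_d B c d * w 0 d.
Proof.
rewrite bilinE; under eq_bigr => e _ do under eq_bigr => d _ do rewrite -mulrA.
by under eq_bigr => e _ do rewrite -mulr_sumr; rewrite sum_frame.
Qed.

Lemma bilin_frame (B : 'M[R]_n) c d x y :
  bilin B (frame c x) (frame d y) = B c d.
Proof. by rewrite bilin_framer sum_frame. Qed.

Lemma nabla_form_frame (G : 'I_n -> 'rV[R]_n -> 'M[R]_n)
    (B : 'rV[R]_n -> 'M[R]_n) a c d x :
  nabla_form G B (frame a) (frame c) (frame d) x =
  partial a (fun y => B y c d) x - \sum_k G k x a c * B x k d
  - \sum_k B x c k * G k x a d.
Proof.
rewrite /nabla_form sum_frame bilin_framer bilin_framel; congr (_ - _ - _).
- by congr (partial _ _ _); apply/funext => y; rewrite bilin_frame.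
- by apply: eq_bigr => k _; rewrite nabla_frame2.
- by apply: eq_bigr => k _; rewrite nabla_frame2.
Qed.

End FrameCompat.

(** * The Ricci tensor of the metric of a Weyl connection *)

Section WeylEinstein.
Variables (R : realType) (n : nat) (M : atlas R n).
Hypothesis HM : is_manifold M.
Variables (g : tensor2 M) (D : connection M).
Hypotheses (n3 : (3 <= n)%N) (gm : is_metric g) (WD : weyl_connection g D).

Lemma weyl_compat (DD : connection M) : weyl_connection g DD ->
  exists2 beta : oneform M, is_oneform beta &
  forall i x, chart_image i x -> forall e a b,
  partial e (fun y => g i y a b) x =
  \sum_d DD i d x e a * g i x d b + \sum_d DD i d x e b * g i x d a
  + beta i x 0 e * g i x a b.
Proof.
case=> _ _ [beta betaF gb]; exists beta => // i x xi e a b.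
rewrite -(gb i x xi e a b) nabla_form_frame.
have gs c d : g i x c d = g i x d c by rewrite -{1}((gm.2 i x xi).1) mxE.
rewrite [X in _ - X](eq_bigr (fun d => DD i d x e b * g i x d a)).
  by ring.
by move=> d _; rewrite mulrC gs.
Qed.

Variable i : idx M.
Implicit Types (z : 'rV[R]_(n + n)) (a b c d e k : 'I_n).

Local Notation l_ := (lshift n).
Local Notation r_ := (rshift n).
Let U := lsub_set (n:=n) (chart_image (M := M) i).
Let Uo : open U := open_lsub_set (n:=n) (chart_image_open HM (i:=i)).
Let A := weyl_block g D i.
Let gx z a b := g i (lsubmx z) a b.
Let gi z a b := invmx (g i (lsubmx z)) a b.
Let xi z d := z 0 (r_ d).
Let V z k := \sum_d gi z k d * xi z d.
(* The connection [D] changed by the one-form with constant components [xi z];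
   also the Christoffel symbols with three horizontal indices of the metric. *)
Let P k a b z := D i k (lsubmx z) a b + weyl_change (gx z) (xi z) (V z) k a b.

Let gxs z a b : U z -> gx z a b = gx z b a.
Proof. by move=> Uz; rewrite /gx -{1}(metric_tr gm Uz) mxE. Qed.

Let gis z a b : U z -> gi z a b = gi z b a.
Proof.
move=> Uz; rewrite /gi -{1}(metric_tr gm Uz) -trmx_inv mxE.
by [].
Qed.

Let giE z a c : U z -> \sum_b gi z a b * gx z b c = (a == c)%:R.
Proof.
move=> Uz; have /matrixP /(_ a c) := mulVmx (metric_unit gm Uz).
by rewrite [LHS]mxE [RHS]mxE.
Qed.

Let xiV z d : U z -> xi z d = \sum_c V z c * gx z c d.
Proof.
move=> Uz; rewrite /V -[LHS](sum_deltal (xi z)).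
under [RHS]eq_bigr => c _ do rewrite mulr_suml.
rewrite [RHS]exchange_big /=; apply: eq_bigr => e _.
rewrite -(@giE z e d Uz) mulr_suml; apply: eq_bigr => c _.
by rewrite (@gis z e c Uz); ring.
Qed.

Let dlift f z : differentiable f (lsubmx z) ->
  differentiable (fun y => f (lsubmx y) : R) z.
Proof. exact: differentiable_lsub_comp. Qed.

Let dxi d z : differentiable (fun y => xi y d) z.
Proof. exact: differentiable_coord. Qed.

Let pxr k d z : partial (r_ k) (fun y => xi y d) z = (k == d)%:R.
Proof. exact: partial_rshift. Qed.

Let pxl k d z : partial (l_ k) (fun y => xi y d) z = 0.
Proof. exact: partial_lrshift. Qed.

Let gd a b z : U z -> differentiable (fun x => g i x a b) (lsubmx z).
Proof. by move=> Uz; exact: (smooth_on_diff (metric_smooth gm (i:=i) a b) Uz). Qed.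

Let gid a b z : U z -> differentiable (fun x => invmx (g i x) a b) (lsubmx z).
Proof.
by move=> Uz; exact: (smooth_on_diff (metric_inv_smooth HM gm (i:=i) a b) Uz).
Qed.

Let Dd k a b z : U z -> differentiable (fun x => D i k x a b) (lsubmx z).
Proof.
move=> Uz; have [[DS _] _ _] := WD; exact: (smooth_on_diff (DS i k a b) Uz).
Qed.

Let Sd a b z : U z -> differentiable (fun x => sym_mx (schouten g D i x) a b) (lsubmx z).
Proof.
move=> Uz; have Ss := smooth_on_diff (schouten_smooth HM gm WD (i:=i) _ _) Uz.
rewrite (_ : (fun x => _) = fun x =>
  2^-1 * (schouten g D i x a b + schouten g D i x b a)); last first.
  by apply/funext => x; exact: sym_mxE.
apply: differentiableM; first exact: differentiable_cst.
by apply: differentiableD; exact: Ss.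
Qed.

Let Vd k z : U z -> differentiable (fun y => V y k) z.
Proof.
move=> Uz; apply: differentiable_bigsum => d _; apply: differentiableM => //.
by apply: (dlift (f := fun x => invmx (g i x) k d)); exact: gid.
Qed.

Let gl_r a b k z : U z -> partial (r_ k) (fun y => gx y a b) z = 0.
Proof.
by move=> Uz; rewrite (partial_lsubmxr (f := fun x => g i x a b) k (gd a b Uz)).
Qed.

Let gil_r a b k z : U z -> partial (r_ k) (fun y => gi y a b) z = 0.
Proof.
move=> Uz.
by rewrite (partial_lsubmxr (f := fun x => invmx (g i x) a b) k (gid a b Uz)).
Qed.

Let gxd a b z : U z -> differentiable (fun y => gx y a b) z.
Proof. by move=> Uz; exact: (dlift (gd a b Uz)). Qed.

Let gixd a b z : U z -> differentiable (fun y => gi y a b) z.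
Proof. by move=> Uz; exact: (dlift (gid a b Uz)). Qed.

Let Vr k c z : U z -> partial (r_ c) (fun y => V y k) z = gi z k c.
Proof.
move=> Uz; rewrite partial_sum => [|d _]; last by apply: differentiableM => //; exact: gixd.
rewrite -[RHS](sum_deltar' (gi z k)); apply: eq_bigr => d _.
by rewrite partialM ?gil_r ?pxr ?mul0r ?add0r //; exact: gixd.
Qed.

Let Nq y := \sum_c V y c * xi y c.

Let Nd z : U z -> differentiable Nq z.
Proof.
move=> Uz; apply: differentiable_bigsum => c _.
by apply: differentiableM => //; exact: Vd.
Qed.

Let Nr k z : U z -> partial (r_ k) Nq z = 2 * V z k.
Proof.
move=> Uz; rewrite partial_sum => [|c _]; last first.
  by apply: differentiableM => //; exact: Vd.
rewrite (eq_bigr (fun c => gi z k c * xi z c + (k == c)%:R * V z c)).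
  by rewrite big_split /= sum_deltal' -/(V z k) mulr_natl.
move=> c _; rewrite partialM ?Vr ?pxr //; last exact: Vd.
by rewrite (gis c k Uz) [V z c * _]mulrC.
Qed.

Let AE a b y : U y -> A y a b = - (\sum_k D i k (lsubmx y) a b * xi y k)
  - sym_mx (schouten g D i (lsubmx y)) a b
  - xi y a * xi y b + 2^-1 * Nq y * gx y a b.
Proof.
move=> Uy; rewrite /A weyl_blockE; congr (_ + 2^-1 * _ * _).
apply: eq_bigr => c _; congr (_ * _); apply: eq_bigr => d _.
by rewrite mulrC -/(gi y d c) (gis d c Uy).
Qed.

Let partial_A_r a b k z : U z ->
  partial (r_ k) (fun y => A y a b) z = - P k a b z.
Proof.
move=> Uz; rewrite (eq_partial _ Uo Uz (fun y Uy => AE a b Uy)).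
have d1 : differentiable (fun y => \sum_k D i k (lsubmx y) a b * xi y k) z.
  apply: differentiable_bigsum => c _; apply: differentiableM => //.
  exact: (dlift (Dd c a b Uz)).
have d2 := dlift (Sd a b Uz).
have d3 : differentiable (fun y => xi y a * xi y b) z.
  exact: differentiableM.
have d4 : differentiable (fun y => 2^-1 * Nq y) z.
  by apply: differentiableM; [exact: differentiable_cst|exact: Nd].
rewrite partialD; last 2 first.
- apply: differentiableB d3; apply: differentiableB d2; exact: differentiableN.
- by apply: differentiableM => //; exact: gxd.
rewrite partialB; [|by apply: differentiableB d2; exact: differentiableN|exact: d3].
rewrite partialB; [|exact: differentiableN|exact: d2].
rewrite partialN //.
rewrite (partialM _ d4 (gxd a b Uz)) (partialZ _ _ (Nd Uz)) Nr // gl_r //.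
rewrite (partialM _ (dxi a z) (dxi b z)) !pxr.
rewrite (partial_lsubmxr (f := fun x => sym_mx (schouten g D i x) a b) k (Sd a b Uz)).
rewrite partial_sum => [|c _]; last first.
  by apply: differentiableM => //; exact: (dlift (Dd c a b Uz)).
rewrite (eq_bigr (fun c => (k == c)%:R * D i c (lsubmx z) a b)); last first.
  move=> c _; rewrite (partialM _ (dlift (Dd c a b Uz)) (dxi c z)) pxr.
  rewrite (partial_lsubmxr (f := fun x => D i c x a b) k (Dd c a b Uz)).
  by rewrite mul0r add0r mulrC.
rewrite sum_deltal' /P /weyl_change.
move: (Nq z) (V z k) (gx z a b) (xi z a) (xi z b) (D i k _ a b) => N v G X Y W.
by field.
Qed.

Let Pd k a b z : U z -> differentiable (P k a b) z.
Proof.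
move=> Uz; apply: differentiableD; first exact: (dlift (Dd k a b Uz)).
apply: differentiableB.
  by apply: differentiableD; apply: differentiableM => //; exact: differentiable_cst.
by apply: differentiableM; [exact: gxd|exact: Vd].
Qed.

Let dg z e a b := partial e (fun x => g i x a b) (lsubmx z).
Let dV z e c := partial (l_ e) (fun y => V y c) z.

Let partial_P u k a b z : U z -> partial u (P k a b) z =
  partial u (fun y => D i k (lsubmx y) a b) z
  + ((k == a)%:R * partial u (fun y => xi y b) z
     + (k == b)%:R * partial u (fun y => xi y a) z
     - (partial u (fun y => gx y a b) z * V z k
        + gx z a b * partial u (fun y => V y k) z)).
Proof.
move=> Uz.
have d1 c d : differentiable (fun y => (k == c)%:R * xi y d) z.
  by apply: differentiableM => //; exact: differentiable_cst.
have d2 : differentiable (fun y => gx y a b * V y k) z.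
  by apply: differentiableM; [exact: gxd|exact: Vd].
rewrite partialD; [|exact: (dlift (Dd k a b Uz))|]; last first.
  by apply: differentiableB d2; exact: differentiableD.
rewrite partialB; [|exact: differentiableD|exact: d2].
rewrite (partialD _ (d1 a b) (d1 b a)) !partialZ //.
by rewrite (partialM _ (gxd a b Uz) (@Vd k z Uz)).
Qed.

Let partial_P_l e k a b z : U z -> partial (l_ e) (P k a b) z =
  partial e (fun x => D i k x a b) (lsubmx z)
  + dweyl_change (gx z) (V z) (dg z) (fun _ _ => 0) (dV z) e k a b.
Proof.
move=> Uz; rewrite partial_P // !pxl.
rewrite (partial_lsubmxl (f := fun x => D i k x a b) e (Dd k a b Uz)).
by rewrite (partial_lsubmxl (f := fun x => g i x a b) e (gd a b Uz)).
Qed.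

Let partial_P_r c k a b z : U z -> partial (r_ c) (P k a b) z =
  (k == a)%:R * (c == b)%:R + (k == b)%:R * (c == a)%:R - gx z a b * gi z k c.
Proof.
move=> Uz; rewrite partial_P // !pxr gl_r // Vr // mul0r add0r.
by rewrite (partial_lsubmxr (f := fun x => D i k x a b) c (Dd k a b Uz)) add0r.
Qed.

(** The left-hand side is the base derivative of the fixed covector [xi]. Its dual vector [V] does
    vary along the base, since the inverse metric does, and compensates the derivative of [g]. *)
Let dYV z e d : U z ->
  0 = \sum_c dV z e c * gx z c d + \sum_c V z c * dg z e c d.
Proof.
move=> Uz; rewrite -[LHS](pxl e d z).
rewrite (eq_partial _ Uo Uz (g := fun y => \sum_c V y c * gx y c d)); last first.
  by move=> y Uy; exact: xiV.
rewrite partial_sum => [|c _]; last first.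
  by apply: differentiableM; [exact: Vd|exact: gxd].
rewrite -big_split /=; apply: eq_bigr => c _.
rewrite (partialM _ (@Vd c z Uz) (gxd c d Uz)).
by rewrite (partial_lsubmxl (f := fun x => g i x c d) e (gd c d Uz)).
Qed.

Let partial_A_rr c d a b z : U z ->
  partial (r_ c) (partial (r_ d) (fun y => A y a b)) z =
  - ((d == a)%:R * (c == b)%:R + (d == b)%:R * (c == a)%:R - gx z a b * gi z d c).
Proof.
move=> Uz; rewrite -(@partial_P_r c d a b z Uz) -(partialN _ (@Pd d a b z Uz)).
by apply: (eq_partial _ Uo Uz) => y Uy; exact: partial_A_r.
Qed.

Let partial_A_lr e k a b z : U z ->
  partial (l_ e) (partial (r_ k) (fun y => A y a b)) z = - partial (l_ e) (P k a b) z.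
Proof.
move=> Uz; rewrite -(partialN _ (@Pd k a b z Uz)).
by apply: (eq_partial _ Uo Uz) => y Uy; exact: partial_A_r.
Qed.

Let tr z (T : 'I_n -> 'I_n -> R) := \sum_a \sum_b gi z a b * T a b.

Let sricci_G z a b : U z ->
  sricci (fun k a b => P k a b z) (fun e k a b => partial (l_ e) (P k a b) z) a b
  = - ((n%:R - 2) * A z a b + tr z (A z) * gx z a b).
Proof.
move=> Uz; have [beta _ compat] := weyl_compat WD.
pose D0 k a b := D i k (lsubmx z) a b.
pose S a b := sym_mx (schouten g D i (lsubmx z)) a b.
pose T := schouten_change (gx z) (xi z) (V z) D0 (fun _ _ => 0).
have AST c d : A z c d = - (S c d + T c d).
  rewrite AE // /T /schouten_change -/(Nq z) addr0 mulr0 oppr0 add0r.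
  rewrite (eq_bigr (fun k => xi z k * D0 k c d)).
    rewrite -/(S c d); move: (\sum_k _) (S c d) (Nq z) => X Y Z; ring.
  by move=> k _; rewrite mulrC.
have trA : tr z (A z) = - (tr z S + tr z T).
  rewrite /tr -[RHS]mulN1r mulrDr !mulr_sumr -big_split /=.
  apply: eq_bigr => c _; rewrite !mulr_sumr -big_split /=.
  by apply: eq_bigr => d _; rewrite AST; ring.
have xic : chart_image i (lsubmx z) := Uz.
have sG := ricci_sym a b (chart_image_open HM (i:=i)) xic
  (weyl_christoffel_sym WD (i:=i)).
have := @sricci_weyl_change R n (gx z) (xi z) (V z) (fun a b => gxs a b Uz)
  (fun d => xiV d Uz) D0 (weyl_christoffel_sym WD xic)
  (fun e k a b => partial e (fun x => D i k x a b) (lsubmx z))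
  (fun e => beta i (lsubmx z) 0 e) (dg z) (fun _ _ => 0) (dV z) (gi z)
  (compat i (lsubmx z) xic) (fun e d => dYV e d Uz) (fun a c => giE a c Uz)
  (fun a b => gis a b Uz) a b.
rewrite -sG (sym_schouten_mx _ _ _ n3 (metric_tr gm xic) (metric_unit gm xic)).
have -> : metric_trace (g i (lsubmx z)) (sym_mx (schouten_mx (g i (lsubmx z))
    (ricci (D i) (lsubmx z)))) = tr z S by [].
rewrite -/(S a b) -/(tr z T) -/(T a b) -/(gx z a b) => E.
have F : (fun e k a b => partial (l_ e) (P k a b) z) = fun e k a b =>
    partial e (fun x => D i k x a b) (lsubmx z)
    + dweyl_change (gx z) (V z) (dg z) (fun _ _ => 0) (dV z) e k a b.
  apply/funext => e; apply/funext => k; apply/funext => c; apply/funext => d.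
  exact: partial_P_l.
rewrite F [LHS]E AST trA.
move: (tr z S) (tr z T) (S a b) (T a b) (gx z a b) => X1 X2 X3 X4 X5.
by ring.
Qed.

(** The constant comes out because the traces cancel in the horizontal block: twice the symmetric
    Ricci tensor gives - 2 (n-2) A - 2 tr(A) g, and contracting A with the second fibre derivatives
    gives - 4 A + 2 tr(A) g. *)
Lemma weyl_metric_ricci z : chart_image i (lsubmx z) ->
  ricci (levi_civita (weyl_metric g D i)) z = (- (2 * n%:R)) *: weyl_metric g D i z.
Proof.
move=> Uz; rewrite (weyl_metric_block HM gm WD Uz).
have AU a b : smooth_on U (fun z => A z a b) := weyl_block_smooth HM gm WD a b.
have As y : U y -> (A y)^T = A y := fun Uy => weyl_block_tr gm WD Uy.
have hE y : U y -> weyl_metric g D i y = pw_mx (A y).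
  exact: weyl_metric_block.
have lr a b : \sum_c partial (r_ c) (partial (r_ b) (fun y => A y a c)) z =
    - (2 * n%:R) * (2^-1)%:M a b.
  rewrite (eq_bigr (fun c => - (b == a)%:R - (b == c)%:R * (c == a)%:R
      + gi z b c * gx z c a)).
    rewrite big_split /= sumrB giE // sumr_const card_ord sum_deltal'.
    rewrite mxE subrK -mulr_natr eq_sym -[2^-1 *+ _]mulr_natr.
    by field.
  move=> c _; rewrite partial_A_rr // eqxx mulr1 (gxs a c Uz).
  by ring.
apply/matrixP => k l; rewrite [RHS]mxE.
case: (split_ordP k) => a ->; case: (split_ordP l) => b ->.
- rewrite (ricci_pw_ll Uo AU As hE) // block_mxEul.
  have -> : sricci (fun k a b => - partial (r_ k) (fun y => A y a b) z)
     (fun e k a b => - partial (l_ e) (partial (r_ k) (fun y => A y a b)) z) a b =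
     - ((n%:R - 2) * A z a b + tr z (A z) * gx z a b).
    rewrite -sricci_G //; congr (sricci _ _ a b).
      apply/funext => e; apply/funext => c; apply/funext => d.
      by rewrite partial_A_r // opprK.
    apply/funext => e; apply/funext => f; apply/funext => c; apply/funext => d.
    by rewrite partial_A_lr // opprK.
  have -> : \sum_c \sum_d A z c d * partial (r_ c) (partial (r_ d) (fun y => A y a b)) z
      = - (2 * A z a b) + tr z (A z) * gx z a b.
    rewrite (eq_bigr (fun c => - ((c == b)%:R * A z c a) - (c == a)%:R * A z c b
        + \sum_d gi z c d * A z c d * gx z a b)); last first.
      move=> c _; rewrite (eq_bigr (fun d => (d == a)%:R * (- (c == b)%:R * A z c d)
        + (d == b)%:R * (- (c == a)%:R * A z c d) + gi z c d * A z c d * gx z a b)).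
        by rewrite !big_split /= !sum_deltal; ring.
      by move=> d _; rewrite partial_A_rr // (gis d c Uz); ring.
    rewrite big_split /= sumrB sumrN !sum_deltal.
    have -> : A z b a = A z a b by rewrite -{1}(As z Uz) mxE.
    congr (_ + _); first by ring.
    rewrite /tr mulr_suml; apply: eq_bigr => c _; by rewrite mulr_suml.
  by rewrite -/(A z a b); move: (tr z (A z)) (A z a b) (gx z a b) => X Y Z; ring.
- by rewrite (ricci_pw_lr Uo AU As hE) // lr block_mxEur.
- by rewrite (ricci_pw_rl Uo AU As hE) // lr block_mxEdl !mxE eq_sym.
- by rewrite (ricci_pw_rr Uo AU As hE) // block_mxEdr mxE mulr0.
Qed.

End WeylEinstein.

Lemma weyl_metric_einstein (R : realType) n (M : atlas R n) (g : tensor2 M)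
    (D : connection M) : (3 <= n)%N -> is_manifold M -> is_metric g ->
  weyl_connection g D -> einstein_metric (weyl_metric g D).
Proof.
move=> n3 HM gm WD; split; first exact: weyl_metric_is_metric.
exists (- (2 * n%:R)) => i z /(cotangent_chart_image HM) zi.
exact: weyl_metric_ricci.
Qed.

(** * Isometries between the metrics of two Weyl connections *)

Section WeylDifference.
Variables (R : numFieldType) (n : nat).
Implicit Types (a b c d e k : 'I_n).
Variables (g gi : 'I_n -> 'I_n -> R) (G G' : 'I_n -> 'I_n -> 'I_n -> R).
Variables (beta beta' : 'I_n -> R).
Hypothesis gsym : forall a b, g a b = g b a.
Hypothesis giE : forall a c, \sum_b gi a b * g b c = (a == c)%:R.
Hypothesis Gsym : forall k a b, G k a b = G k b a.
Hypothesis G'sym : forall k a b, G' k a b = G' k b a.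
Hypothesis compat : forall e a b,
  \sum_d G d e a * g d b + \sum_d G d e b * g d a + beta e * g a b =
  \sum_d G' d e a * g d b + \sum_d G' d e b * g d a + beta' e * g a b.
Hypothesis gisym : forall a b, gi a b = gi b a.

Let Y a := 2^-1 * (beta a - beta' a).
Let V k := \sum_d gi k d * Y d.

(* The Koszul trick: lowering an index of [G' - G] gives a tensor symmetric in
   its first two arguments, whose symmetrisation in the last two is known. *)
Lemma weyl_connection_change k a b : G' k a b = G k a b + weyl_change g Y V k a b.
Proof.
pose w a b c := \sum_d (G' d a b - G d a b) * g d c.
have ws c d e : w c d e = w d c e.
  by apply: eq_bigr => f _; rewrite Gsym G'sym.
have wE c d e : w c d e + w c e d = 2 * (Y c * g d e).
  pose L (H : 'I_n -> 'I_n -> 'I_n -> R) p q := \sum_f H f c p * g f q.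
  have wD p q : w c p q = L G' p q - L G p q.
    by rewrite -sumrB; apply: eq_bigr => f _; rewrite mulrBl.
  have : L G d e + L G e d + beta c * g d e =
      L G' d e + L G' e d + beta' c * g d e by exact: compat.
  rewrite !wD /Y => /eqP; rewrite -subr_eq0 => /eqP E.
  apply/eqP; rewrite -subr_eq0 -oppr_eq0; apply/eqP; rewrite -[RHS]E.
  by field.
have {}wE c d e : w c d e = Y c * g d e + Y d * g c e - Y e * g c d.
  have h1 := wE c d e; have h2 := wE d c e; have h3 := wE e c d.
  rewrite (ws d c) in h2; rewrite (ws e c) (ws e d) in h3.
  have -> : w c d e = 2^-1 * ((w c d e + w c e d) + (w c d e + w d e c)
     - (w c e d + w d e c)) by field.
  by rewrite h1 h2 h3; field.
have lower c d : \sum_f gi f k * w c d f = G' k c d - G k c d.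
  rewrite -(sum_deltar' (fun f => G' f c d - G f c d) k).
  under eq_bigr => f _ do rewrite mulr_sumr.
  rewrite exchange_big /=; apply: eq_bigr => f _; rewrite -giE mulr_sumr.
  by apply: eq_bigr => e _; rewrite (gsym f e) (gisym e k); ring.
have -> : G' k a b = G k a b + (G' k a b - G k a b) by ring.
congr (_ + _); rewrite -lower /weyl_change.
rewrite (eq_bigr (fun f => Y a * (gi k f * g f b) + Y b * (gi k f * g f a)
   - g a b * (gi k f * Y f))).
  by rewrite sumrB big_split /= -!mulr_sumr !giE -/(V k); ring.
by move=> f _; rewrite wE (gisym f k) (gsym a f) (gsym b f); ring.
Qed.

End WeylDifference.

(** * Fibre translations of the cotangent bundle *)

Section Translation.
Variables (R : realType) (n : nat) (M : atlas R n).
Hypothesis HM : is_manifold M.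
Variable th : oneform M.
Hypothesis thF : is_oneform th.
Implicit Types (i j : idx M) (z : 'rV[R]_(n + n)).

Definition translation (al : pt (cotangent M)) : pt (cotangent M) :=
  let c := chart_at M al.1 in (al.1, al.2 + th c (coord M c al.1)).

(** The coordinate expression of [translation] when source and target use the same canonical chart
    ([translation_param]). *)
Definition shear i z : 'rV[R]_(n + n) :=
  row_mx (lsubmx z) (rsubmx z + th i (lsubmx z)).

Lemma translation_coord i j z : overlap i j (lsubmx z) ->
  coord (cotangent M) j (translation (param (cotangent M) i z)) =
  cotangent_lift (transition i j) (shear i z).
Proof.
move=> zij; have [/(chart_imageP HM) [ip xE] jp] := (overlapP HM _ _ _).1 zij.
set p := param M i (lsubmx z); set c := chart_at M p.
have cp : dom M c p by exact: (chart_atP HM).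
rewrite /cotangent_lift /shear row_mxKl row_mxKr; congr row_mx.
rewrite mulmxDl -(covector_coord_param HM zij) /covector_coord /= mulmxDl.
congr (_ + _).
have e1 := thF.2 j c (coord M j p) (overlap_coord jp cp).
rewrite (transition_coord HM) // in e1; rewrite -e1.
have e2 := thF.2 i j (lsubmx z) zij.
have Ju := jacobian_transition_unit HM zij.
have JI : invmx ('J (transition i j) (lsubmx z)) *m 'J (transition i j) (lsubmx z) = 1%:M.
  exact: mulVmx Ju.
by rewrite e2 -mulmxA -trmx_mul JI trmx1 mulmx1.
Qed.

Lemma cotangent_coordK i (al : pt (cotangent M)) : dom (cotangent M) i al ->
  param (cotangent M) i (coord (cotangent M) i al) = al.
Proof.
case: al => p a /= ip; rewrite row_mxKl row_mxKr (coordK HM) //; congr pair.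
rewrite /covector_coord /=; set c := chart_at M p.
have cp : dom M c p by exact: (chart_atP HM).
rewrite -mulmxA -trmx_mul -(transition_coord HM c ip).
have ic := overlap_coord ip cp.
have := jacobian_transitionK HM (overlap_transition HM ic).
rewrite (transitionK HM ic) => ->.
by rewrite trmx1 mulmx1.
Qed.

Lemma shear_chart i z : chart_image i (lsubmx z) -> chart_image i (lsubmx (shear i z)).
Proof. by rewrite row_mxKl. Qed.

Lemma overlap_refl i (x : 'rV[R]_n) : chart_image i x -> overlap i i x.
Proof. by move=> xi; apply/(overlapP HM); split=> //; case/(chart_imageP HM): xi. Qed.

Lemma cotangent_lift_id i z : chart_image i (lsubmx z) ->
  cotangent_lift (transition i i) z = z.
Proof.
move=> zi; rewrite /cotangent_lift (jacobian_transition_id HM zi) invmx1 trmx1 mulmx1.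
have [_ e] := (chart_imageP HM i _).1 zi.
by rewrite /transition /= e hsubmxK.
Qed.

Lemma translation_param i z : chart_image i (lsubmx z) ->
  translation (param (cotangent M) i z) = param (cotangent M) i (shear i z).
Proof.
move=> zi; have ii := overlap_refl zi.
have := translation_coord ii; rewrite (cotangent_lift_id (shear_chart zi)) => <-.
by rewrite cotangent_coordK //=; case/(chart_imageP HM): zi.
Qed.

Let th_smooth i l : smooth_on (chart_image i) (fun x => th i x 0 l).
Proof. exact: thF.1. Qed.

Lemma shear_smooth i : smooth_map_on (lsub_set (n:=n) (chart_image i)) (shear i).
Proof.
have oO := open_lsub_set (n:=n) (chart_image_open HM (i:=i)).
move=> k; case: (split_ordP k) => l ->.
  rewrite (_ : (fun z => _) = fun z : 'rV[R]_(n + n) => z 0 (lshift n l)).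
    exact: smooth_on_coord.
  by apply/funext => z; rewrite row_mxEl mxE.
rewrite (_ : (fun z => _) = fun z : 'rV[R]_(n + n) =>
   z 0 (rshift n l) + th i (lsubmx z) 0 l).
  apply: smooth_onD => //; first exact: smooth_on_coord.
  exact: (smooth_on_lsubmx (n:=n) (chart_image_open HM (i:=i)) (@th_smooth i l)).
by apply/funext => z; rewrite row_mxEr mxE mxE.
Qed.

Lemma shear_jacobian i z : chart_image i (lsubmx z) ->
  'J (shear i) z = block_mx 1%:M
    (\matrix_(a, l) partial a (fun x => th i x 0 l) (lsubmx z)) 0 1%:M.
Proof.
move=> zi; have dS := smooth_map_diff (@shear_smooth i) zi.
have dth l := smooth_on_diff (@th_smooth i l) zi.
have dlth l := differentiable_lsub_comp (n:=n) (dth l).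
have el l : (fun y => shear i y 0 (lshift n l)) = fun y : 'rV[R]_(n + n) => y 0 (lshift n l).
  by apply/funext => y; rewrite row_mxEl mxE.
have er l : (fun y => shear i y 0 (rshift n l)) =
    fun y : 'rV[R]_(n + n) => y 0 (rshift n l) + th i (lsubmx y) 0 l.
  by apply/funext => y; rewrite row_mxEr mxE mxE.
apply/matrixP => k l; rewrite [LHS](jacobianE k l dS).
case: (split_ordP l) => b ->; rewrite ?el ?er ?partial_coord.
  case: (split_ordP k) => a ->.
    by rewrite block_mxEul mxE eq_lshift.
  by rewrite block_mxEdl mxE eq_rlshift.
rewrite partialD; [|exact: differentiable_coord|exact: dlth].
case: (split_ordP k) => a ->.
  rewrite partial_lrshift add0r block_mxEur mxE.
  exact: (partial_lsubmxl (n:=n) a (dth b)).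
rewrite partial_rshift block_mxEdr mxE.
by rewrite (partial_lsubmxr (n:=n) a (dth b)) addr0.
Qed.

Lemma local_translation i j z : overlap i j (lsubmx z) ->
  local_map translation i j z = cotangent_lift (transition i j) (shear i z).
Proof. exact: translation_coord. Qed.

Lemma image_of_cotangent i (U : set (pt (cotangent M))) z :
  image_of (M := cotangent M) i U z <->
  chart_image i (lsubmx z) /\ U (param (cotangent M) i z).
Proof.
split=> [[al [ial Ual] <-]|[/(cotangent_chart_image HM) [al [ial _] <-] Ual]].
  rewrite cotangent_coordK //; split=> //.
  by apply/(cotangent_chart_image HM); exists al.
by rewrite cotangent_coordK // in Ual; exists al.
Qed.

Lemma translation_smooth : smooth_map translation.
Proof.
split=> [U Uo i|i j].
  have oO := open_lsub_set (n:=n) (chart_image_open HM (i:=i)).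
  rewrite openE => z /image_of_cotangent [zi Uz].
  have zS : image_of (M := cotangent M) i U (shear i z).
    apply/image_of_cotangent; split; first exact: shear_chart.
    by rewrite -translation_param.
  have dS := smooth_map_diff (@shear_smooth i) zi.
  have nS := differentiable_continuous dS (open_nbhs_nbhs (conj (Uo i) zS)).
  have nz : nbhs z (lsub_set (n:=n) (chart_image (M := M) i)) by exact: open_nbhs_nbhs.
  rewrite /interior; apply: filterS2 nz nS => y yi /image_of_cotangent [_ Uy].
  apply/image_of_cotangent; split; first exact: yi.
  have := Uy; rewrite -(translation_param yi); exact.
have E : image_of (M := cotangent M) i (translation @^-1` dom (cotangent M) j) =
    lsub_set (n:=n) (overlap (M := M) i j).
  apply/seteqP; split=> z.
    by move=> /image_of_cotangent [zi jp]; apply/(overlapP HM).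
  by move=> /(overlapP HM) [zi jp]; apply/image_of_cotangent.
rewrite E; have to := @overlap_open _ _ _ HM i j.
have ts := @transition_smooth _ _ _ HM i j.
have oO := open_lsub_set (n:=n) to.
apply: (@eq_smooth_map_on _ _ _ _
  (fun z => cotangent_lift (transition (M := M) i j) (shear i z))) => //.
  by move=> z zij; rewrite local_translation.
move=> k; case: (split_ordP k) => l ->.
  rewrite (_ : (fun z => _) = fun z : 'rV[R]_(n + n) => transition (M := M) i j (lsubmx z) 0 l).
    exact: (smooth_on_lsubmx (n:=n) to (ts l)).
  by apply/funext => z; rewrite cotangent_liftl row_mxKl.
rewrite (_ : (fun z => _) = fun z : 'rV[R]_(n + n) => \sum_m
    (z 0 (rshift n m) + th i (lsubmx z) 0 m)
    * (fun x => invmx ('J (transition (M := M) i j) x) l m) (lsubmx z)).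
  apply: smooth_on_sum => // m; apply: smooth_onM => //.
    apply: smooth_onD => //; first exact: smooth_on_coord.
    apply: (smooth_on_lsubmx (n:=n) (f := fun x => th i x 0 m) to).
    by apply: smooth_on_sub (@th_smooth i m) => x /(overlap_chart HM).
  apply: (smooth_on_lsubmx (n:=n) (f := fun x => invmx ('J (transition (M := M) i j) x) l m) to).
  apply: smooth_on_invmx => //.
    by move=> x xij; exact: (jacobian_transition_unit HM xij).
  by move=> a b; exact: smooth_on_jacobian.
apply/funext => z; rewrite cotangent_liftr row_mxKl; apply: eq_bigr => m _.
by congr (_ * _); rewrite row_mxEr mxE mxE.
Qed.

(** [pullback] is computed in the preferred chart of the image point; the transformation law of [h]
    brings it back to chart [i], where the map is the shear. *)
Lemma pullback_translation (h : tensor2 (cotangent M)) i z : is_tensor2 h ->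
  chart_image i (lsubmx z) ->
  pullback translation h i z = 'J (shear i) z *m h i (shear i z) *m ('J (shear i) z)^T.
Proof.
move=> [_ hL] zi; set c := chart_at M (param M i (lsubmx z)).
have zc : overlap i c (lsubmx z) by exact: chart_at_overlap.
have Szc : overlap (M := cotangent M) i c (shear i z).
  by apply/(cotangent_overlap HM); rewrite row_mxKl.
have to := @overlap_open _ _ _ HM i c.
have ts := @transition_smooth _ _ _ HM i c.
have oO := open_lsub_set (n:=n) to.
have dS := smooth_map_diff (@shear_smooth i) zi.
have tu (x : 'rV[R]_n) : overlap i c x -> 'J (transition i c) x \in unitmx.
  exact: (jacobian_transition_unit HM).
have Szc' : lsub_set (n:=n) (overlap i c) (shear i z).
  by rewrite /lsub_set /= row_mxKl.
have dT := smooth_map_diff (smooth_cotangent_lift to ts tu) Szc'.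
have dTS := differentiable_comp dS dT.
have FE y : lsub_set (n:=n) (overlap i c) y ->
    (cotangent_lift (transition i c) \o shear i) y = local_map translation i c y.
  by move=> yic; rewrite local_translation.
have [_ JF] := eq_jacobian oO zc FE dTS.
rewrite /pullback -/c -[chart_at _ _]/c JF -(FE _ zc) (jacobian_comp dS dT).
rewrite (hL i c (shear i z) Szc) (cotangent_transition HM Szc').
rewrite (cotangent_transition_jacobian HM Szc') trmx_mul !mulmxA.
by [].
Qed.

End Translation.

Lemma pw_mx_shear (R : numFieldType) n (A Q : 'M[R]_n) :
  block_mx 1%:M Q 0 1%:M *m pw_mx A *m (block_mx 1%:M Q 0 1%:M)^T =
  pw_mx (A + 2^-1 *: (Q + Q^T)).
Proof.
rewrite /pw_mx tr_block_mx !mulmx_block !trmx0 !trmx1.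
rewrite !(mulmx0, mul0mx, addr0, add0r, mulmx1, mul1mx) mul_mx_scalar.
by rewrite mul_scalar_mx scalerDr -addrA.
Qed.

(** Taking the trace gives (2n - 2) t = 0 for the trace t of X, and then (n-2) X = 0. This is what
    allows Sym P to be recovered from the symmetrised Ricci tensor. *)
Lemma linear_trace_inj (R : numFieldType) n (g gi X : 'I_n -> 'I_n -> R) :
  (3 <= n)%N -> \sum_a \sum_b gi a b * g a b = n%:R ->
  (forall a b, (n%:R - 2) * X a b
     + (\sum_c \sum_d gi c d * X c d) * g a b = 0) ->
  forall a b, X a b = 0.
Proof.
move=> n3 trg E; set t := \sum_c \sum_d gi c d * X c d.
have n2 : n%:R - 2 != 0 :> R by rewrite subr_eq0 (eqr_nat R n 2) gtn_eqF.
have n1 : (n%:R - 2) + n%:R != 0 :> R.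
  rewrite addrAC -natrD subr_eq0 (eqr_nat R (n + n) 2) gtn_eqF //.
  by rewrite (leq_trans n3) // leq_addr.
have t0 : t = 0.
  have : \sum_a \sum_b gi a b * ((n%:R - 2) * X a b + t * g a b) = 0.
    by rewrite big1 // => a _; rewrite big1 // => b _; rewrite E mulr0.
  rewrite (eq_bigr (fun a => (n%:R - 2) * (\sum_b gi a b * X a b)
      + t * \sum_b gi a b * g a b)); last first.
    move=> a _; rewrite !mulr_sumr -big_split /=.
    by apply: eq_bigr => b _; ring.
  rewrite big_split /= -!mulr_sumr trg -/t mulrC -mulrDr => /eqP.
  by rewrite mulf_eq0 (negbTE n1) orbF => /eqP.
move=> a b; have := E a b; rewrite -/t t0 mul0r addr0 => /eqP.
by rewrite mulf_eq0 (negbTE n2) => /eqP.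
Qed.

(** * Comparison of the metrics of two Weyl connections *)

Section Isometry.
Variables (R : realType) (n : nat) (M : atlas R n).
Hypothesis HM : is_manifold M.
Variables (g : tensor2 M) (D D' : connection M).
Hypotheses (n3 : (3 <= n)%N) (gm : is_metric g).
Hypotheses (WD : weyl_connection g D) (WD' : weyl_connection g D').
Implicit Types (i j : idx M) (x : 'rV[R]_n).

Let gs i x a b : chart_image i x -> g i x a b = g i x b a.
Proof. by move=> xi; rewrite -{1}(metric_tr gm xi) mxE. Qed.

Let gis i x a b : chart_image i x -> invmx (g i x) a b = invmx (g i x) b a.
Proof. by move=> xi; rewrite -{1}(metric_tr gm xi) -trmx_inv mxE. Qed.

Let giE i x a c : chart_image i x ->
  \sum_b invmx (g i x) a b * g i x b c = (a == c)%:R.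
Proof.
move=> xi; have /matrixP /(_ a c) := mulVmx (metric_unit gm xi).
by rewrite [LHS]mxE [RHS]mxE.
Qed.

Variables beta : oneform M.
Hypothesis compat : forall i x, chart_image i x -> forall e a b,
  partial e (fun y => g i y a b) x =
  \sum_d D i d x e a * g i x d b + \sum_d D i d x e b * g i x d a
  + beta i x 0 e * g i x a b.

Variable Y : oneform M.
Hypothesis YF : is_oneform Y.
Let V i x k := \sum_d invmx (g i x) k d * Y i x 0 d.
Hypothesis D'E : forall i x, chart_image i x -> forall k a b,
  D' i k x a b = D i k x a b
    + weyl_change (fun a b => g i x a b) (fun d => Y i x 0 d) (V i x) k a b.

Let YV i x d : chart_image i x -> Y i x 0 d = \sum_c V i x c * g i x c d.
Proof.
move=> xi; rewrite /V -[LHS](sum_deltal (fun d => Y i x 0 d)).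
under [RHS]eq_bigr => c _ do rewrite mulr_suml.
rewrite [RHS]exchange_big /=; apply: eq_bigr => e _.
rewrite -(@giE i x e d xi) mulr_suml; apply: eq_bigr => c _.
by rewrite (@gis i x e c xi); ring.
Qed.

Let Yd i x d : chart_image i x -> differentiable (fun y => Y i y 0 d) x.
Proof. exact: (smooth_on_diff (YF.1 i d)). Qed.

Let gd i x a b : chart_image i x -> differentiable (fun y => g i y a b) x.
Proof. exact: (smooth_on_diff (metric_smooth gm (i:=i) a b)). Qed.

Let Vd i x k : chart_image i x -> differentiable (fun y => V i y k) x.
Proof.
move=> xi; apply: differentiable_bigsum => d _; apply: differentiableM.
  exact: (smooth_on_diff (metric_inv_smooth HM gm (i:=i) k d) xi).
exact: Yd.
Qed.

Let dY i x e d := partial e (fun y => Y i y 0 d) x.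
Let dV i x e c := partial e (fun y => V i y c) x.
Let dg i x e a b := partial e (fun y => g i y a b) x.

Let S i x a b := sym_mx (schouten g D i x) a b.
Let S' i x a b := sym_mx (schouten g D' i x) a b.
Let T i x := schouten_change (fun a b => g i x a b) (fun d => Y i x 0 d) (V i x)
  (fun k a b => D i k x a b) (dY i x).

Let partial_D' i x e k a b : chart_image i x ->
  partial e (fun y => D' i k y a b) x = partial e (fun y => D i k y a b) x
  + dweyl_change (fun a b => g i x a b) (V i x) (dg i x) (dY i x) (dV i x) e k a b.
Proof.
move=> xi; have [[DS _] _ _] := WD.
rewrite (eq_partial _ (chart_image_open HM (i:=i)) xi (fun y yi => D'E yi k a b)).
have d1 c d : differentiable (fun y => (k == c)%:R * Y i y 0 d) x.
  by apply: differentiableM; [exact: differentiable_cst|exact: Yd].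
have d2 : differentiable (fun y => g i y a b * V i y k) x.
  by apply: differentiableM; [exact: gd|exact: Vd].
rewrite partialD; [|exact: (smooth_on_diff (DS i k a b) xi)|]; last first.
  by apply: differentiableB d2; exact: differentiableD.
rewrite partialB; [|exact: differentiableD|exact: d2].
rewrite (partialD _ (d1 a b) (d1 b a)) !partialZ; [|exact: Yd|exact: Yd].
by rewrite (partialM _ (gd a b xi) (@Vd i x k xi)).
Qed.

Let dYV i x e d : chart_image i x ->
  dY i x e d = \sum_c dV i x e c * g i x c d + \sum_c V i x c * dg i x e c d.
Proof.
move=> xi; rewrite /dY.
rewrite (eq_partial _ (chart_image_open HM (i:=i)) xi (fun y yi => YV d yi)).
rewrite partial_sum => [|c _]; last first.
  by apply: differentiableM; [exact: Vd|exact: gd].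
rewrite -big_split /=; apply: eq_bigr => c _.
by rewrite (partialM _ (@Vd i x c xi) (gd c d xi)).
Qed.

(** Both connections satisfy the symmetrised defining equation. Compared with the change formula for
    the Ricci tensor, the discrepancy X = Sym P' - (Sym P + T) satisfies (n-2) X + tr(X) g = 0,
    hence vanishes. *)
Lemma sym_schouten_change i x a b : chart_image i x ->
  sym_mx (schouten g D' i x) a b = sym_mx (schouten g D i x) a b
    + schouten_change (fun a b => g i x a b) (fun d => Y i x 0 d) (V i x)
        (fun k a b => D i k x a b) (dY i x) a b.
Proof.
move=> xi; have Do := chart_image_open HM (i:=i).
have sE (DD : connection M) : weyl_connection g DD -> forall c d,
    sricci (fun k a b => DD i k x a b)
      (fun e k a b => partial e (fun y => DD i k y a b) x) c d =
    (n%:R - 2) * sym_mx (schouten g DD i x) c d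
    + metric_trace (g i x) (sym_mx (schouten g DD i x)) * g i x c d.
  move=> WDD c d; rewrite -(ricci_sym c d Do xi (weyl_christoffel_sym WDD (i:=i))).
  exact: (sym_schouten_mx _ _ _ n3 (metric_tr gm xi) (metric_unit gm xi)).
have tr_g : \sum_c \sum_d invmx (g i x) c d * g i x c d = n%:R.
  rewrite -[n in RHS]card_ord -sumr_const; apply: eq_bigr => c _.
  under eq_bigr => d _ do rewrite (gs c d xi).
  by rewrite giE // eqxx.
apply/eqP; rewrite -subr_eq0; apply/eqP; move: a b.
apply: (linear_trace_inj n3 tr_g) => a b.
have E := @sricci_weyl_change R n (fun a b => g i x a b) (fun d => Y i x 0 d)
  (V i x) (fun a b => gs a b xi) (fun d => YV d xi)
  (fun k a b => D i k x a b) (weyl_christoffel_sym WD xi)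
  (fun e k a b => partial e (fun y => D i k y a b) x)
  (fun e => beta i x 0 e) (dg i x) (dY i x) (dV i x) (fun a b => invmx (g i x) a b)
  (compat xi) (fun e d => dYV e d xi) (fun a c => giE a c xi)
  (fun a b => gis a b xi) a b.
have E' := sE D' WD' a b.
rewrite (_ : (fun k a b => D' i k x a b) = fun k a b => D i k x a b
    + weyl_change (fun a b => g i x a b) (fun d => Y i x 0 d) (V i x) k a b) in E';
  last by apply/funext => k; apply/funext => c; apply/funext => d; exact: D'E.
rewrite (_ : (fun e k a b => partial e (fun y => D' i k y a b) x) =
    fun e k a b => partial e (fun y => D i k y a b) x
    + dweyl_change (fun a b => g i x a b) (V i x) (dg i x) (dY i x) (dV i x) e k a b)
  in E'; last first.
  apply/funext => e; apply/funext => k; apply/funext => c; apply/funext => d.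
  exact: partial_D'.
rewrite E (sE D WD) in E'.
have trl (gi X1 X2 X3 : 'I_n -> 'I_n -> R) :
    \sum_c \sum_d gi c d * (X1 c d - (X2 c d + X3 c d)) =
    \sum_c \sum_d gi c d * X1 c d
    - (\sum_c \sum_d gi c d * X2 c d + \sum_c \sum_d gi c d * X3 c d).
  rewrite -big_split /= -sumrB; apply: eq_bigr => c _.
  rewrite -big_split /= -sumrB; apply: eq_bigr => d _.
  by rewrite mulrBr mulrDr.
rewrite (trl (fun c d => invmx (g i x) c d) (S' i x) (S i x) (T i x)).
have alg (p s s' t h m m' tt : R) : p * s' + m' * h = p * s + m * h + p * t + tt * h ->
    p * (s' - (s + t)) + (m' - (m + tt)) * h = 0.
  move=> H; rewrite [LHS](_ : _ = (p * s' + m' * h) - (p * s + m * h + p * t + tt * h)).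
    by rewrite H subrr.
  by ring.
by apply: alg; exact: (esym E').
Qed.

Let thN : oneform M := fun i x => - Y i x.

Lemma weyl_block_translation i (z : 'rV[R]_(n + n)) : chart_image i (lsubmx z) ->
  let Q := \matrix_(a, l) partial a (fun x => thN i x 0 l) (lsubmx z) in
  weyl_block g D' i (shear thN i z) + 2^-1 *: (Q + Q^T) = weyl_block g D i z.
Proof.
move=> zi Q; set x := lsubmx z; apply/matrixP => a b.
pose xi d := z 0 (rshift n d).
have QE c d : Q c d = - dY i x c d.
  rewrite mxE -(partialN _ (Yd d zi)).
  congr (partial _ _ _); apply/funext => y; by rewrite mxE.
have sl : lsubmx (shear thN i z) = x by rewrite row_mxKl.
have sr d : shear thN i z 0 (rshift n d) = xi d - Y i x 0 d.
  by rewrite row_mxEr !mxE.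
rewrite [LHS]mxE [X in _ + X]mxE [X in _ + _ * X]mxE [Q^T _ _]mxE !QE.
rewrite !weyl_blockE sl (sym_schouten_change a b zi) !sr -/x.
(* The two places where the translated covector xi - Y is paired with something: the symbols of [D']
   here, the inverse metric in [h2]. What remains is a polynomial identity. *)
have h1 : \sum_k D' i k x a b * shear thN i z 0 (rshift n k) =
    \sum_k D i k x a b * xi k - \sum_k Y i x 0 k * D i k x a b
    + ((xi a - Y i x 0 a) * Y i x 0 b + (xi b - Y i x 0 b) * Y i x 0 a
       - g i x a b * (\sum_k xi k * V i x k - \sum_k V i x k * Y i x 0 k)).
  have -> : \sum_k xi k * V i x k - \sum_k V i x k * Y i x 0 k =
      \sum_k (xi k - Y i x 0 k) * V i x k.
    by rewrite -sumrB; apply: eq_bigr => k _; ring.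
  have := weyl_change_contract (fun a b => g i x a b) (fun d => Y i x 0 d) (V i x)
    (fun k => xi k - Y i x 0 k) a b.
  move=> <-; rewrite -sumrB -big_split /=; apply: eq_bigr => k _.
  by rewrite sr (D'E zi); ring.
have h2 : \sum_c (\sum_d shear thN i z 0 (rshift n d) * invmx (g i x) d c)
      * shear thN i z 0 (rshift n c) =
    \sum_c (\sum_d xi d * invmx (g i x) d c) * xi c
    - 2 * (\sum_k xi k * V i x k) + \sum_k V i x k * Y i x 0 k.
  have gY c : \sum_d Y i x 0 d * invmx (g i x) d c = V i x c.
    by apply: eq_bigr => d _; rewrite (gis d c zi) mulrC.
  have gxiY : \sum_c (\sum_d xi d * invmx (g i x) d c) * Y i x 0 c =
      \sum_k xi k * V i x k.
    under eq_bigr => c _ do rewrite mulr_suml.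
    rewrite exchange_big /=; apply: eq_bigr => d _; rewrite mulr_sumr.
    by apply: eq_bigr => c _; rewrite mulrA.
  rewrite mulr_natl mulr2n opprD addrA -{1}gxiY -!sumrB -big_split /=.
  apply: eq_bigr => c _; rewrite -gY sr.
  rewrite (eq_bigr (fun d => xi d * invmx (g i x) d c - Y i x 0 d * invmx (g i x) d c)).
    by rewrite sumrB gY; ring.
  by move=> d _; rewrite sr; ring.
rewrite h1 h2 /schouten_change.
move: (\sum_k D i k x a b * xi k) (\sum_k Y i x 0 k * D i k x a b) => s1 s2.
move: (\sum_k xi k * V i x k) (\sum_k V i x k * Y i x 0 k) => s3 s4.
rewrite -/(xi a) -/(xi b).
move: (\sum_c _) (xi a) (xi b) (Y i x 0 a) (Y i x 0 b) => s5 u v p q.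
move: (dY i x a b) (dY i x b a) (g i x a b) (sym_mx _ a b) => w1 w2 h s.
by field.
Qed.

End Isometry.

Lemma is_oneform_scaleB (R : realType) n (M : atlas R n) (a a' : oneform M) (c : R) :
  is_manifold M -> is_oneform a -> is_oneform a' ->
  is_oneform (fun i x => c *: (a i x - a' i x)).
Proof.
move=> HM aF a'F; have Do i := chart_image_open HM (i:=i).
split=> [i l|i j x xij].
  rewrite (_ : (fun x => _) = fun x => c * (a i x 0 l - a' i x 0 l)).
    apply: smooth_onM => //; first exact: smooth_on_cst.
    by apply: smooth_onB => //; [exact: aF.1|exact: a'F.1].
  by apply/funext => x; rewrite !mxE.
by rewrite (aF.2 i j x xij) (a'F.2 i j x xij) -mulmxBl scalemxAl.
Qed.

Lemma translationK (R : realType) n (M : atlas R n) (a a' : oneform M) :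
  (forall i x, a' i x = - a i x) -> cancel (translation a) (translation a').
Proof. by move=> aN [p v]; rewrite /translation /= aN addrK. Qed.

Lemma weyl_metric_isometric (R : realType) n (M : atlas R n) (g : tensor2 M)
    (D D' : connection M) : (3 <= n)%N -> is_manifold M -> is_metric g ->
  weyl_connection g D -> weyl_connection g D' ->
  isometric (weyl_metric g D) (weyl_metric g D').
Proof.
move=> n3 HM gm WD WD'.
have [beta bF compat] := weyl_compat gm WD.
have [beta' b'F compat'] := weyl_compat gm WD'.
pose Y : oneform M := fun i x => 2^-1 *: (beta i x - beta' i x).
have YF : is_oneform Y by exact: is_oneform_scaleB.
pose N : oneform M := fun i x => - Y i x.
have NF : is_oneform N.
  have -> : N = fun i x => 2^-1 *: (beta' i x - beta i x).
    by apply/funext => i; apply/funext => x; rewrite /N /Y -scalerN opprB.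
  exact: is_oneform_scaleB.
have D'E i x : chart_image i x -> forall k a b,
    D' i k x a b = D i k x a b + weyl_change (fun a b => g i x a b)
      (fun d => Y i x 0 d) (fun k => \sum_d invmx (g i x) k d * Y i x 0 d) k a b.
  move=> xi k a b.
  have gs c d : g i x c d = g i x d c by rewrite -{1}(metric_tr gm xi) mxE.
  have giE c d : \sum_e invmx (g i x) c e * g i x e d = (c == d)%:R.
    have /matrixP /(_ c d) := mulVmx (metric_unit gm xi).
    by rewrite [LHS]mxE [RHS]mxE.
  have gis c d : invmx (g i x) c d = invmx (g i x) d c.
    by rewrite -{1}(metric_tr gm xi) -trmx_inv mxE.
  have cc e c d : \sum_f D i f x e c * g i x f d + \sum_f D i f x e d * g i x f c
      + beta i x 0 e * g i x c d =
      \sum_f D' i f x e c * g i x f d + \sum_f D' i f x e d * g i x f c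
      + beta' i x 0 e * g i x c d.
    by rewrite -(compat i x xi) -(compat' i x xi).
  have := @weyl_connection_change R n (fun a b => g i x a b)
    (fun a b => invmx (g i x) a b) (fun k a b => D i k x a b)
    (fun k a b => D' i k x a b) (fun e => beta i x 0 e) (fun e => beta' i x 0 e)
    gs giE (weyl_christoffel_sym WD xi) (weyl_christoffel_sym WD' xi) cc gis k a b.
  move=> ->; congr (_ + weyl_change _ _ _ _ _ _).
    by apply/funext => d; rewrite !mxE.
  by apply/funext => e; apply: eq_bigr => d _; rewrite !mxE.
exists (translation N), (translation Y); split.
- exact: translation_smooth.
- exact: translation_smooth.
- by apply: translationK => i x; rewrite opprK.
- exact: translationK.
move=> i z /(cotangent_chart_image HM) zi.
have zi' : chart_image (M := M) i (lsubmx (shear N i z)) by exact: shear_chart.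
rewrite (pullback_translation HM NF (weyl_metric_tensor HM gm WD') zi).
rewrite (shear_jacobian HM NF zi) (weyl_metric_block HM gm WD' zi').
rewrite pw_mx_shear (weyl_metric_block HM gm WD zi); congr pw_mx.
exact: (weyl_block_translation HM n3 gm WD WD' compat YF D'E).
Qed.

Theorem proposition1p2 (R : realType) (n : nat) (M : atlas R n)
    (g : tensor2 M) :
  (3 <= n)%N -> is_manifold M -> is_metric g ->
  (forall D : connection M, weyl_connection g D ->
     einstein_metric (weyl_metric g D) /\
     almost_para_kahler (weyl_metric g D) (weyl_symplectic g D)) /\
  (forall D D' : connection M, weyl_connection g D -> weyl_connection g D' ->
     isometric (weyl_metric g D) (weyl_metric g D')).
Proof.
move=> n3 HM gm; split=> [D WD|D D' WD WD'].
  split; first exact: weyl_metric_einstein.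
  exact: weyl_almost_para_kahler.
exact: weyl_metric_isometric.
Qed.
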